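(* Let $d\ge 1$, $\nu>0$, $\alpha\in(0,2)$, and let $a:\mathbb Z^d\to[0,\infty)$ satisfy $\sum_{z\in\mathbb Z^d}a(z)=1$ and $a(z)=a(-z)$ for all $z$. Put $\epsilon_\alpha=1$ if $\alpha=1$ and $\epsilon_\alpha=0$ otherwise, and assume that $$a(z)=\sum_{j=0}^{d+\epsilon_\alpha}\frac{a_j(\dot z)}{|z|^{d+\alpha+j}}+O\!\left(\frac{1}{|z|^{2d+\alpha+1+\epsilon_\alpha}}\right),\qquad |z|\to\infty,\quad \dot z=\frac{z}{|z|},$$ where $a_j\in C^{d+1-j+\epsilon_\alpha}(S^{d-1})$ for $0\le j\le d+\epsilon_\alpha$, and $a_0(\dot z)>\delta$ on $S^{d-1}$ for some constant $\delta>0$. Let $m_1(t,x)$ be the expected number of particles at $x\in\mathbb Z^d$ at time $t$ for the branching random walk with jump distribution $a$ and branching rate $\nu$ started from a single particle at the origin, and let $F(t)$ be the front at time $t$ (both defined in the context). Then for the points $x\in F(t)$, $$|x|=[a_0(\dot x)\,t]^{\frac{1}{d+\alpha}}\,e^{\frac{\nu}{d+\alpha}t}\,\bigl(1+O(t^{-1})\bigr),\qquad t\to\infty,\qquad \dot x=\frac{x}{|x|}.$$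
   Context: Branching random walk on $\mathbb Z^d$: a particle located at $y$ waits at $y$ a random exponentially distributed time with parameter $1$ and then jumps to $y+z$ with probability $a(z)$; in addition, each particle splits with constant rate $\nu$ (probability $\nu\,dt$ in time $dt$) into two particles located at the same point. All particles behave independently of each other and according to the same law. Let $n(t,x)$ be the number of particles at $x\in\mathbb Z^d$ at time $t\ge 0$ when the process starts at $t=0$ with a single particle at the origin, and let $m_1(t,x)=E\,n(t,x)$. With $$(\mathcal L f)(x)=\sum_{z\in\mathbb Z^d}[f(x+z)-f(x)]\,a(z)$$ acting on $\ell^2(\mathbb Z^d)$, the function $m_1$ is the solution of $$\frac{\partial m_1}{\partial t}(t,x)=(\mathcal L+\nu)m_1(t,x),\quad t\ge 0,\qquad m_1(0,x)=\delta(x),$$ where $\delta(x)=1$ if $x=0$ and $\delta(x)=0$ for other $x\in\mathbb Z^d$ (this function $\delta(\cdot)$ is unrelated to the constant $\delta$ in the claim). The front $F(t)$ is the boundary of the set $\{x\in\mathbb Z^d: m_1(t,x)\ge 1\}$, i.e. the set of points $x\in\mathbb Z^d$ for which there exist $e_+,e_-\in\mathbb Z^d$, each either equal to $0$ or of length $1$, such that $m_1(t,x+e_+)\ge 1$ and $m_1(t,x+e_-)<1$. *)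

(* Defs.v *)
From HB Require Import structures.
From mathcomp Require Import all_boot all_order all_algebra.
From mathcomp Require Import all_classical all_reals all_analysis.

Set Implicit Arguments.
Unset Strict Implicit.
Unset Printing Implicit Defensive.

Import Order.TTheory GRing.Theory Num.Theory.
Import numFieldNormedType.Exports.

Local Open Scope classical_set_scope.
Local Open Scope ring_scope.

Section Euclidean.
Context {R : realType} {d : nat}.

(* The library's norm on 'rV[R]_d is the sup norm; |z| is the Euclidean one. *)
Definition enorm (v : 'rV[R]_d) : R := Num.sqrt (\sum_i v 0 i ^+ 2).

Definition sphere : set 'rV[R]_d := [set s | enorm s = 1].

Definition latt (z : 'rV[int]_d) : 'rV[R]_d := map_mx intr z.

Definition lnorm (z : 'rV[int]_d) : R := enorm (latt z).

Definition ldir (z : 'rV[int]_d) : 'rV[R]_d := (lnorm z)^-1 *: latt z.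

Fixpoint Ck (k : nat) (U : set 'rV[R]_d) (f : 'rV[R]_d -> R) : Prop :=
  (forall x, U x -> {for x, continuous f}) /\
  if k is k'.+1 then
    forall i : 'I_d,
      (forall x, U x -> derivable f x (delta_mx 0 i)) /\
      Ck k' U (fun x => 'D_(delta_mx 0 i) f x)
  else True.

(* f is C^k as a function on the submanifold S^{d-1}: near each of its points
   it is the restriction of a C^k function of d variables.  Only the values of
   f on the sphere matter. *)
Definition Ck_sphere (k : nat) (f : 'rV[R]_d -> R) : Prop :=
  forall s, sphere s ->
    exists (U : set 'rV[R]_d) (g : 'rV[R]_d -> R),
      [/\ open U, U s, Ck k U g & forall x, U x -> sphere x -> f x = g x].

End Euclidean.
Arguments sphere : clear implicits.
Arguments lnorm R {d} z.
Arguments ldir R {d} z.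

Section Independence.
Context {disp : measure_display} {T : measurableType disp} {R : realType}.

Definition mutually_independent (P : probability T R) (I : eqType)
    (G : I -> set (set T)) : Prop :=
  forall (s : seq I) (E : I -> set T), uniq s ->
    (forall i, i \in s -> G i (E i)) ->
    P (\bigcap_(i in [set` s]) E i) = (\prod_(i <- s) P (E i))%E.

Definition preimages (S : Type) (C : set (set S)) (X : T -> S) : set (set T) :=
  [set X @^-1` B | B in C].

End Independence.

(* Particles are labelled by binary words, the most recent letter first.  A
   label is used between two consecutive events of the life of a particle.
   The particle u carries an Exp(1) waiting time before its next jump, an
   Exp(nu) time before its next splitting, and the displacement of its next
   jump.  If the waiting time ends first, u jumps and goes on under the label
   false :: u; otherwise it is replaced by the two particles false :: u and
   true :: u at the same site.  Drawing fresh clocks after each event is the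
   usual construction of constant rates: exponential laws are memoryless. *)
Record branching_walk (disp : measure_display) (Omega : measurableType disp)
    (R : realType) (P : probability Omega R) (d : nat)
    (a : 'rV[int]_d -> R) (nu : R) := BranchingWalk {
  wait : seq bool -> {RV P >-> R} ;
  splt : seq bool -> {RV P >-> R} ;
  jump : seq bool -> Omega -> 'rV[int]_d ;
  wait_law : forall u A, measurable A ->
    distribution P (wait u) A = exponential_prob (1 : R) A ;
  splt_law : forall u A, measurable A ->
    distribution P (splt u) A = exponential_prob nu A ;
  jump_measurable : forall u z, measurable (jump u @^-1` [set z]) ;
  jump_law : forall u z, P (jump u @^-1` [set z]) = (a z)%:E ;
  clocks_independent : mutually_independent P
    (fun i : seq bool + seq bool + seq bool =>
       match i with
       | inl (inl u) => preimages measurable (wait u)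
       | inl (inr u) => preimages measurable (splt u)
       | inr u => preimages setT (jump u)
       end)
}.

Section Population.
Context {disp : measure_display} {Omega : measurableType disp} {R : realType}.
Context {P : probability Omega R} {d : nat} {a : 'rV[int]_d -> R} {nu : R}.
Variable X : branching_walk P a nu.
Implicit Types (u : seq bool) (w : Omega) (t : R) (x : 'rV[int]_d).

Definition jumps u w : bool := wait X u w < splt X u w.

Fixpoint exists_particle u w : bool :=
  if u is b :: v then exists_particle v w && (b ==> ~~ jumps v w) else true.

Definition duration u w : R := Num.min (wait X u w) (splt X u w).

Fixpoint start u w : R :=
  if u is _ :: v then start v w + duration v w else 0.

Fixpoint site u w : 'rV[int]_d :=
  if u is _ :: v then site v w + (if jumps v w then jump X v w else 0) else 0.

Definition alive u t w : bool :=
  exists_particle u w && (start u w <= t < start u w + duration u w).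

Definition particles t x w : \bar R :=
  counting [set u | alive u t w /\ site u w = x].

Definition m1 t x : \bar R := (\int[P]_w particles t x w)%E.

Definition front t : set 'rV[int]_d :=
  [set x | exists ep em : 'rV[int]_d,
     [/\ ep = 0 \/ lnorm R ep = 1, em = 0 \/ lnorm R em = 1,
         (1 <= m1 t (x + ep))%E & (m1 t (x + em) < 1)%E]].

End Population.

(* Main.v *)
(* Integrating out the clocks and displacements along the ancestral line of each label, and
   summing over the labels of length n, gives
     m1(t, x) = e^(-(1+nu)t) * sum_n (lam t)^n / n! * b^{*n}(x),
   with lam = 1 + 2 nu and b = (2 nu delta_0 + a) / lam: an event of a line keeps one offspring
   at a jump and two at a splitting.

   The kernel b has the regular tail a0(z/|z|) |z|^(-gam) / lam, gam = d + alpha.  Put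
   w(x) = 1 + |x| and h = w^(-gam-c) for a small c > 0.  A sum of n independent steps is far away
   essentially only if a single step is, whence, for every s > 1 and uniformly in n and x,
     |b^{*n}(x) - n b(x)| <= K s^n h(x),        b^{*(n+2)}(x) >= K' s^(-n) w(x)^(-gam).
   The first bound needs |b(x-y) - b(x)| <= C w(y)^c h(x) for |y| <= |x|/2, which follows from the
   expansion of a, since a0 is Lipschitz on the sphere.

   The second bound makes m1(t, .) huge on a ball of exponentially growing radius, so points of
   the front are exponentially far.  There the first bound, with s close to 1, reads
     m1(t, x + e) = Q (1 + O(1/t)),   Q = t e^(nu t) a0(x/|x|) |x|^(-gam),   |e| <= 1.
   As m1 takes values on both sides of 1 near x, Q = 1 + O(1/t), and |x| is recovered from Q. *)
Require Import Defs.
From HB Require Import structures.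
From mathcomp Require Import all_boot all_order all_algebra.
From mathcomp Require Import all_classical all_reals all_analysis.
From mathcomp Require Import measurable_realfun ring lra.
Import Order.TTheory GRing.Theory Num.Theory.
Import numFieldNormedType.Exports.
Set Implicit Arguments.
Unset Strict Implicit.
Unset Printing Implicit Defensive.
Local Open Scope classical_set_scope.
Local Open Scope ring_scope.


(** The loss of a factor [s] per step is affordable: the weights of the series turn [s^n] into
    [e^(lam (s-1) t)], a rate as small as desired, whereas at exponential distance passing from
    [w^(-gam)] to [h] gains [|x|^(-c)], a fixed exponential rate. The relative error of Q is
    therefore exponentially small, and [1/t] only bounds it at the end. The exponent c meets two
    demands: [w^c w^(-gam)] must be summable over the lattice, that is c < alpha, and the relative
    change [|y|/|x|] of the tail under a shift must be at most its c-th power, that is c <= 1. To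
    reach the series, the birth time and the site of a label must be independent of its own clocks.
    Mutual independence is assumed for finite families of events, so it is first extended to
    generated sigma-algebras. The lower bound spends two extra steps because [a] may vanish at
    moderate distances: a long step reaches the range where the tail is positive, and the atom of b
    at 0 fills the spare step when the target is already far. *)

(** * Independence of one clock from all the others *)

Section Independence.
Context {disp : measure_display} {T : measurableType disp} {R : realType}.
Context {P : probability T R} {I : eqType} {G : I -> set (set T)}.
Hypothesis GT : forall i, G i setT.
Hypothesis GI : forall i, setI_closed (G i).
Hypothesis Gm : forall i, G i `<=` measurable.
Hypothesis indG : mutually_independent P G.

Definition others (i : I) : set (set T) := \bigcup_(j in [set j | j != i]) G j.

(** [F] is total, with [F j] in [G j] even outside [s], so that two rectangles over different lists
    can be intersected after padding with [setT]. *)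
Let rects i : set (set T) := [set D | exists (s : seq I) (F : I -> set T),
  [/\ i \notin s, forall j, G j (F j) & D = \bigcap_(j in [set` s]) F j]].

Let rects_setI i : setI_closed (rects i).
Proof.
move=> A B [s [F [iNs FG ->]]] [s' [F' [iNs' FG' ->]]].
exists (s ++ s'), (fun j => (if j \in s then F j else setT) `&`
                            (if j \in s' then F' j else setT)); split.
- by rewrite mem_cat negb_or iNs iNs'.
- by move=> j; apply: GI; case: ifP.
- apply/seteqP; split=> w /=.
    move=> [h1 h2] j /= _; split; case: ifP => // js; [exact: h1|exact: h2].
  move=> h; split=> j /= js.
    by have [] := h j; rewrite /= ?mem_cat ?js.
  by have [] := h j; rewrite /= ?mem_cat ?js ?orbT.
Qed.

Let others_rects i : others i `<=` rects i.
Proof.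
move=> A [j /= ji GA]; exists [:: j], (fun k => if k == j then A else setT).
split.
- by rewrite inE eq_sym.
- by move=> k; case: eqP => [->|].
- apply/seteqP; split=> w /= h; first by move=> k /=; rewrite inE => /eqP ->; rewrite eqxx.
  by have := h j; rewrite /= inE eqxx; apply.
Qed.

Let measurable_rects i : rects i `<=` measurable.
Proof.
move=> _ [s [F [_ FG ->]]]; apply: fin_bigcap_measurable => //= j _.
exact: (Gm (FG j)).
Qed.

Let rects_indep i D E : rects i D -> G i E -> P (D `&` E) = (P D * P E)%E.
Proof.
move=> [s [F [iNs FG ->]]] GE.
(* [mutually_independent] speaks of duplicate-free lists only; an intersection does not see
   repetitions. *)
have eF : \bigcap_(j in [set` undup s]) F j = \bigcap_(j in [set` s]) F j.
  by apply: eq_bigcapl; split=> j /=; rewrite mem_undup.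
have uF : P (\bigcap_(j in [set` s]) F j) = (\prod_(j <- undup s) P (F j))%E.
  by rewrite -indG ?undup_uniq ?eF//.
pose F' j := if j == i then E else F j.
have F'F j : j \in undup s -> F' j = F j.
  rewrite mem_undup /F' => js; case: eqP => // ji; by rewrite ji (negbTE iNs) in js.
have := @indG (i :: undup s) F'.
rewrite cons_uniq mem_undup iNs undup_uniq => /(_ isT) H.
transitivity (P (\bigcap_(j in [set` i :: undup s]) F' j)).
  congr (P _); rewrite -eF; apply/seteqP; split=> w /=.
    move=> [h Ew] j /=; rewrite inE => /predU1P[->|js]; first by rewrite /F' eqxx.
    by rewrite F'F//; exact: h.
  move=> h; split; last by have := h i; rewrite /= /F' inE eqxx; exact.
  by move=> j /= js; rewrite -F'F//; apply: h; rewrite /= inE js orbT.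
rewrite H; last first.
  by move=> j _; rewrite /F'; case: eqP => [->|].
rewrite uF big_cons {1}/F' eqxx muleC; congr (_ * _)%E.
by rewrite big_seq [RHS]big_seq; apply: eq_bigr => j /F'F ->.
Qed.

Lemma others_measurable i : <<s others i >> `<=` measurable.
Proof.
apply: smallest_sub; first exact: sigma_algebra_measurable.
by move=> A [j _ /Gm].
Qed.

(** Rectangles off [i] form a pi-system on which the product formula is the hypothesis for finite
    families; Dynkin's theorem carries it to the generated sigma-algebra. *)
Lemma indep_others i D E : <<s others i >> D -> G i E ->
  P (D `&` E) = (P D * P E)%E.
Proof.
move=> oD GE; have mE := Gm GE.
have sub : <<s rects i >> `<=` measurable.
  by apply: smallest_sub => //; exact: sigma_algebra_measurable.
have {oD} rD : <<s rects i >> D.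
  by apply: sub_smallest2r oD => //; exact: smallest_sigma_algebra.
pose Q (S : set T) := P (S `&` E) = (P S * P E)%E.
have QC (A : set T) : measurable A -> Q A -> Q (~` A).
  move=> mA; rewrite /Q => QA.
  transitivity (P E - P (A `&` E))%E.
    rewrite setIC -setDE measureD//; last by rewrite -ge0_fin_numE ?fin_num_measure.
    by rewrite (setIC E).
  rewrite QA probability_setC// muleBl ?mul1e ?fin_num_measure//.
have QU (F : (set T)^nat) : (forall n, measurable (F n)) -> trivIset setT F ->
    (forall n, Q (F n)) -> Q (\bigcup_n F n).
  move=> mF tF QF; rewrite /Q setI_bigcupl.
  rewrite measure_semi_bigcup//; last 3 first.
  - by move=> n; exact: measurableI.
  - exact: trivIset_setIr.
  - by apply: bigcup_measurable => n _; exact: measurableI.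
  rewrite measure_semi_bigcup//; last by exact: bigcup_measurable.
  rewrite muleC -(@fineK _ (P E)) ?fin_num_measure// -nneseriesZl//.
  by apply: eq_eseriesr => n _; rewrite muleC fineK ?fin_num_measure//; exact: QF.
have step S : <<s rects i >> S -> Q S; last exact: step.
apply: (@dynkin_induction _ (g_sigma_algebraType (rects i)) (rects i) Q) => //.
- by rewrite /Q setTI probability_setT mul1e.
- by move=> A rA; exact: (rects_indep rA GE).
- by move=> A /sub; exact: QC.
- by move=> F mF tF QF; apply: QU => // n; exact: (sub _ (mF n)).
Qed.

End Independence.

(** * Integration against independent variables and against densities *)

Section IntegralIndependent.
Context {disp : measure_display} {T : measurableType disp} {R : realType}.
Context {P : probability T R}.
Local Open Scope ereal_scope.

(** The law of the pair agrees with the product law on rectangles, hence everywhere, and Tonelli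
    applies. Both integrals stay on the probability space, so that variables can be integrated out
    one at a time. *)
Lemma integral_indep d1 d2 (T1 : measurableType d1) (T2 : measurableType d2)
    (X : T -> T1) (Y : T -> T2) (F : T1 * T2 -> \bar R) :
  measurable_fun setT X -> measurable_fun setT Y ->
  measurable_fun [set: (T1 * T2)%type] F ->
  (forall z, 0 <= F z) ->
  (forall A B, measurable A -> measurable B ->
     P (X @^-1` A `&` Y @^-1` B) = P (X @^-1` A) * P (Y @^-1` B)) ->
  \int[P]_w F (X w, Y w) = \int[P]_w \int[P]_w' F (X w, Y w').
Proof.
move=> mX mY mF F0 ind.
pose X' : {mfun T >-> T1} := mfun_Sub (mem_set mX).
pose Y' : {mfun T >-> T2} := mfun_Sub (mem_set mY).
have mXY := measurable_fun_pair mX mY.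
pose XY : {mfun T >-> (T1 * T2)%type} := mfun_Sub (mem_set mXY).
pose m1 := distribution P X'; pose m2 := distribution P Y'.
have eqm := @product_measure_unique _ _ T1 T2 R m1 m2 (distribution P XY).
transitivity (\int[distribution P XY]_z F z).
  by rewrite ge0_integral_distribution.
transitivity (\int[m1 \x m2]_z F z).
  by apply: eq_measure_integral => A mA _; apply/esym/eqm => // A1 A2 mA1 mA2; exact: ind.
rewrite fubini_tonelli1// ge0_integral_distribution//; last 2 first.
- exact: measurable_fun_fubini_tonelli_F.
- by move=> y; apply: integral_ge0.
apply: eq_integral => w _ /=; rewrite /fubini_F ge0_integral_distribution//.
by apply: measurableT_comp => //; exact: measurable_pair1.
Qed.

End IntegralIndependent.

Section Density.
Context {d : measure_display} {T : measurableType d} {R : realType}.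
Context {m mu : {measure set T -> \bar R}} {g : T -> R}.
Hypothesis mg : measurable_fun setT g.
Hypothesis g0 : forall x, 0 <= g x.
Hypothesis mE : forall A, measurable A -> m A = (\int[mu]_(x in A) (g x)%:E)%E.
Local Open Scope ereal_scope.
Import HBNNSimple.

Let integral_density_nnsfun (h : {nnsfun T >-> R}) :
  \int[m]_x (h x)%:E = \int[mu]_x ((h x)%:E * (g x)%:E).
Proof.
under eq_integral do rewrite fimfunE -fsumEFin//.
rewrite ge0_integral_fsum//; last 2 first.
- by move=> y; exact/measurable_EFinP/measurable_funM.
- by move=> y x _; rewrite nnfun_muleindic_ge0.
transitivity (\sum_(k \in range h)
    \int[mu]_x ((k * \1_(h @^-1` [set k]) x)%:E * (g x)%:E)).
  apply: eq_fsbigr => r; rewrite inE => -[x _ hx].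
  have r0 : (0 <= r)%R by rewrite -hx.
  rewrite integralZl_indic_nnsfun// integral_indic//= setIT mE//.
  rewrite -ge0_integralZl//; last first.
  - by move=> y _; rewrite lee_fin.
  - by apply/measurable_EFinP; exact: measurable_funTS.
  rewrite integral_mkcond; apply: eq_integral => y _; rewrite patchE indicE.
  by case: ifPn => _; rewrite ?mulr1 ?mulr0 ?mul0e.
rewrite -ge0_integral_fsum//; last 2 first.
- by move=> y; apply: emeasurable_funM; apply/measurable_EFinP => //; exact: measurable_funM.
- by move=> y x _; rewrite mule_ge0 ?lee_fin// -lee_fin EFinM nnfun_muleindic_ge0.
apply: eq_integral => x _; rewrite [in RHS]fimfunE -fsumEFin//.
by rewrite ge0_mule_fsuml// => y; rewrite EFinM nnfun_muleindic_ge0.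
Qed.

(** The laws of the clocks are given on sets; monotone convergence from simple functions makes them
    usable in integrals. *)
Lemma integral_density (f : T -> \bar R) :
  measurable_fun setT f -> (forall x, 0 <= f x) ->
  \int[m]_x f x = \int[mu]_x (f x * (g x)%:E).
Proof.
move=> mf f0; pose f_ := nnsfun_approx measurableT mf.
have f_f x : EFin \o f_ ^~ x @ \oo --> f x by exact: cvg_nnsfun_approx.
have f_nd x k n : (k <= n)%N -> (f_ k x)%:E <= (f_ n x)%:E.
  by move=> kn; rewrite lee_fin; exact/lefP/nd_nnsfun_approx.
transitivity (limn (fun n => \int[m]_x (f_ n x)%:E)).
  rewrite -monotone_convergence//.
  - by apply: eq_integral => y _; apply/esym/cvg_lim => //; exact: f_f.
  - by move=> n; exact/measurable_EFinP/measurable_funP.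
  - by move=> n y _; rewrite lee_fin.
  - by move=> y _ k n kn; exact: f_nd.
under eq_fun do rewrite integral_density_nnsfun.
rewrite -monotone_convergence//.
- apply: eq_integral => y _; apply/cvg_lim => //; apply: cvgeZr => //; exact: f_f.
- move=> n; apply: emeasurable_funM; apply/measurable_EFinP => //; exact: measurable_funP.
- by move=> n y _; rewrite mule_ge0// lee_fin.
- by move=> y _ k n kn; rewrite lee_wpmul2r ?lee_fin//; apply: f_nd.
Qed.

End Density.

(** * Exponential laws and Gamma weights *)

Section Exponential.
Context {R : realType}.
Local Open Scope ereal_scope.
Notation mu := (@lebesgue_measure R).

Lemma exponential_prob_ge0 (rate r : R) : (0 < rate)%R -> (0 <= r)%R ->
  exponential_prob rate `[r, +oo[ = (expR (- rate * r))%:E.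
Proof.
move=> rate0 r0; rewrite /exponential_prob.
transitivity (\int[mu]_(x in `[r, +oo[) (rate * expR (- rate * x))%:E).
  apply: eq_integral => x.
  rewrite inE/= in_itv/= andbT => rx.
  by rewrite exponential_pdfE// (le_trans r0).
have cexp : continuous (fun z : R => expR (- rate * z)).
  move=> z; apply: continuous_comp; last exact: continuous_expR.
  by apply: cvgM; [exact: cvg_cst|exact: cvg_id].
have crexp : continuous (fun z : R => rate * expR (- rate * z))%R.
  by move=> z; apply: cvgM; [exact: cvg_cst|exact: cexp].
rewrite (@ge0_continuous_FTC2y _ _ (fun x => - (expR (- rate * x)))%R _ 0%R)//.
- by rewrite EFinN oppeK add0e.
- by move=> x _; rewrite mulr_ge0 ?expR_ge0// ltW.
- exact: continuous_subspaceT crexp.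
- rewrite -oppr0; apply: cvgN.
  rewrite (_ : (fun x => expR (- rate * x)) =
               (fun z => expR (- z)) \o (fun z => rate * z))%R; last first.
    by apply: eq_fun => x; rewrite mulNr.
  apply: (@cvg_comp _ _ _ _ _ _ (pinfty_nbhs R)); last exact: cvgr_expR.
  exact: gt0_cvgMry.
- by apply: cvgN; apply/cvg_at_right_filter; exact: cexp.
- move=> z _.
  rewrite derive1_comp// derive1N// derive1_id mulN1r derive1_comp// derive1E.
  have /funeqP -> := @derive_expR R.
  by rewrite derive1Ml// derive1_id mulr1 mulrN opprK mulrC.
Qed.

Definition surv (m x : R) : R := if (x < 0)%R then 1%R else expR (- m * x).

Lemma surv_ge0 m x : (0 <= surv m x)%R.
Proof. by rewrite /surv; case: ifP => _; rewrite ?ler01 ?expR_ge0. Qed.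

Lemma measurable_surv m : measurable_fun setT (surv m).
Proof.
apply: measurable_fun_ifT => //; first exact: measurable_fun_ltr.
by apply: measurableT_comp => //; apply: measurable_funM.
Qed.

(** The law has no atom, so open and closed rays have the same mass. Both kinds occur, since a tie
    between two clocks counts as a splitting. *)
Lemma exponential_prob_surv (rate r : R) b : (0 < rate)%R ->
  exponential_prob rate [set` Interval (BSide b r) +oo%O] = (surv rate r)%:E.
Proof.
move=> rate0; rewrite /surv.
have <- : exponential_prob rate `[r, +oo[ =
    exponential_prob rate [set` Interval (BSide b r) +oo%O].
  case: b => //; rewrite /exponential_prob -integral_itv_obnd_cbnd//.
  by apply/measurable_EFinP/measurable_funTS; exact: measurable_exponential_pdf.
have [r0|r0] := ltP; last by rewrite exponential_prob_ge0.
rewrite -(integral_exponential_pdf rate0) /exponential_prob integral_mkcond.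
apply: eq_integral => x _; rewrite patchE mem_setE in_itv/= andbT.
by have [//|xr] := leP r x; rewrite lt0_exponential_pdf// (lt_trans xr).
Qed.

(* The law of [start] is a Gamma law: [gammaw k] is the survival weight it leads to. *)
Definition gammaw (r t : R) (k : nat) (s : R) : R :=
  if (s <= t)%R then ((t - s) ^+ k / k`!%:R * expR (- r * (t - s)))%R else 0%R.

Lemma gammaw_ge0 r t k s : (0 <= gammaw r t k s)%R.
Proof.
rewrite /gammaw; case: ifP => // st.
by rewrite mulr_ge0 ?expR_ge0// divr_ge0// exprn_ge0// subr_ge0.
Qed.

Lemma measurable_gammaw r t k : measurable_fun setT (gammaw r t k).
Proof.
apply: measurable_fun_ifT => //; first exact: measurable_fun_ler.
apply: measurable_funM.
  apply: measurable_funM => //; apply: measurable_funX.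
  exact: measurable_funB.
apply: measurableT_comp => //; apply: measurable_funM => //.
exact: measurable_funB.
Qed.

(** The survival factor [q], the density and the weight multiply to a constant times
    [(t - s - x)^k], because the weight decays at the total rate [l + m]; integrating the power
    raises [k] by one. *)
Lemma integral_gammaw (l m t s : R) k (q : R -> R) :
  (forall x, (0 <= x)%R -> q x = expR (- m * x)) ->
  \int[mu]_x ((q x * gammaw (l + m) t k (s + x)) * exponential_pdf l x)%:E =
  (l * gammaw (l + m) t k.+1 s)%:E.
Proof.
move=> qE.
pose c : R := (l * expR (- (l + m) * (t - s)))%R.
have fne n : (n`!%:R : R) != 0%R by rewrite pnatr_eq0 -lt0n fact_gt0.
transitivity (\int[mu]_(x in `[0%R, (t - s)%R]) (c * ((t - s - x) ^+ k / k`!%:R))%:E).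
  rewrite [RHS]integral_mkcond; apply: eq_integral => x _; rewrite patchE.
  rewrite mem_setE in_itv/=.
  have [x0|x0] := ltP x 0%R; first by rewrite lt0_exponential_pdf// mulr0.
  rewrite exponential_pdfE// qE// /gammaw lerBrDl.
  case: ifPn => _ /=; last by rewrite mulr0 mul0r.
  congr EFin; rewrite /c.
  have -> : (- (l + m) * (t - s) = - (l + m) * (t - (s + x)) + - m * x + - l * x)%R by ring.
  rewrite !expRD opprD addrA; ring.
have [ts|st] := leP t s.
  rewrite (_ : gammaw _ _ _ _ = 0%R) ?mulr0; last first.
    rewrite /gammaw; case: ifP => // st.
    by rewrite (le_anti (introT andP (conj ts st))) subrr expr0n/= !mul0r.
  have [->|ts'] := eqVneq t s; first by rewrite subrr set_itv1 integral_set1.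
  rewrite set_itv_ge ?integral_set0// bnd_simp -ltNge subr_lt0.
  by rewrite lt_neqAle ts' ts.
have fE : (fun x => c * ((t - s - x) ^+ k / k`!%:R))%R = horner ((c / k`!%:R) *: (((t - s)%:P - 'X) ^+ k))%R.
  apply/funext => x; rewrite ?hornerN hornerZ horner_exp hornerD hornerN hornerC hornerX; ring.
have FE : (fun x => - (c * ((t - s - x) ^+ k.+1 / k.+1`!%:R)))%R = horner (- ((c / k.+1`!%:R) *: (((t - s)%:P - 'X) ^+ k.+1)))%R.
  apply/funext => x; rewrite ?hornerN hornerZ horner_exp hornerD hornerN hornerC hornerX; ring.
rewrite (@continuous_FTC2 _ _ (fun x => - (c * ((t - s - x) ^+ k.+1 / k.+1`!%:R)))%R)//.
- rewrite subrr subr0 expr0n/= mul0r mulr0 oppr0 -EFinB sub0r opprK /gammaw (ltW st) /c.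
  congr EFin; ring.
- by rewrite subr_gt0.
- apply: continuous_subspaceT; rewrite fE; exact: continuous_horner.
- rewrite FE; split.
  + by move=> x _; exact: derivable_horner.
  + by apply/cvg_at_right_filter; exact: continuous_horner.
  + by apply/cvg_at_left_filter; exact: continuous_horner.
- move=> x _; rewrite FE -derivE derivN derivZ deriv_exp derivB derivC derivX.
  rewrite sub0r !(hornerN, hornerZ, hornerMn, hornerM, horner_exp, hornerD, hornerC, hornerX).
  rewrite factS natrM -mulr_natr /=; clearbody c.
  rewrite mul1r mulN1r mulNrn mulrN opprK -mulr_natr; field.
  by rewrite fne addrC natr1 pnatr_eq0.
Qed.

End Exponential.

(** * Sums of nonnegative terms over a countable type *)

Lemma esum_nneseries (R : realType) (T : countType) (x0 : T) (f : T -> \bar R) :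
  (forall x, 0 <= f x)%E ->
  (\esum_(x in [set: T]) f x =
   \sum_(0 <= n <oo | isSome (@pickle_inv T n)) f (odflt x0 (@pickle_inv T n)))%E.
Proof.
move=> f0; rewrite -(@esum_pred_image _ _ f (fun n => odflt x0 (pickle_inv n)))//.
  congr esum; apply/esym/seteqP; split => // x _ /=.
  by exists (pickle x); rewrite /= pickleK_inv.
move=> n m; rewrite !inE /=.
case En : (pickle_inv n) => [x|]// _; case Em : (pickle_inv m) => [y|]// _ /= xy.
have := @pickle_invK T n; have := @pickle_invK T m.
by rewrite En Em /= xy => -> ->.
Qed.

Lemma esumZl (R : realType) (T : countType) (c : R) (f : T -> \bar R) :
  0 <= c -> (forall x, 0 <= f x)%E ->
  (\esum_(x in [set: T]) (c%:E * f x) = c%:E * \esum_(x in [set: T]) f x)%E.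
Proof.
move=> c0 f0.
have [[x0 _]|T0] := pselect ([set: T] !=set0); last first.
  have -> : [set: T] = set0 by apply/seteqP; split => // x _; apply: T0; exists x.
  by rewrite !esum_set0 mule0.
rewrite !(esum_nneseries x0)//; last by move=> x; rewrite mule_ge0// lee_fin.
by rewrite nneseriesZl.
Qed.

Lemma measurable_esum d (Y : measurableType d) (R : realType)
    (T : countType) (f : T -> Y -> \bar R) :
  (forall x, measurable_fun setT (f x)) -> (forall x y, 0 <= f x y)%E ->
  measurable_fun setT (fun y => \esum_(x in [set: T]) f x y)%E.
Proof.
move=> mf f0.
have [[x0 _]|T0] := pselect ([set: T] !=set0); last first.
  have -> : [set: T] = set0 by apply/seteqP; split => // x _; apply: T0; exists x.
  under eq_fun do rewrite esum_set0; exact: measurable_cst.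
under eq_fun do rewrite (esum_nneseries x0)//.
exact: ge0_emeasurable_sum.
Qed.

Lemma integral_esum d (Y : measurableType d) (R : realType)
    (mu : {measure set Y -> \bar R}) (T : countType) (f : T -> Y -> \bar R) :
  (forall x, measurable_fun setT (f x)) -> (forall x y, 0 <= f x y)%E ->
  (\int[mu]_y (\esum_(x in [set: T]) f x y) = \esum_(x in [set: T]) (\int[mu]_y f x y))%E.
Proof.
move=> mf f0.
have [[x0 _]|T0] := pselect ([set: T] !=set0); last first.
  have -> : [set: T] = set0 by apply/seteqP; split => // x _; apply: T0; exists x.
  by under eq_integral do rewrite esum_set0; rewrite esum_set0 integral0.
under eq_integral do rewrite (esum_nneseries x0)//.
rewrite (esum_nneseries x0)//; last by move=> x; exact: integral_ge0.
under eq_integral do rewrite eseries_mkcond.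
rewrite [RHS]eseries_mkcond integral_nneseries//.
- by apply: eq_eseriesr => n _; case: ifP => // _; rewrite integral0.
- by move=> n; case: (isSome _).
- by move=> n y _; case: ifP.
Qed.

(** * From the branching walk to a series over the number of events *)

Section Walk.
Context {disp : measure_display} {Omega : measurableType disp} {R : realType}.
Context {P : probability Omega R} {d : nat} {a : 'rV[int]_d -> R} {nu : R}.
Variable X : branching_walk P a nu.
Hypothesis nu0 : 0 < nu.

Local Notation index := (seq bool + seq bool + seq bool)%type.

Definition clock (i : index) : set (set Omega) :=
  match i with
  | inl (inl u) => preimages measurable (wait X u)
  | inl (inr u) => preimages measurable (splt X u)
  | inr u => preimages setT (jump X u)
  end.

Definition particle (i : index) : seq bool :=
  match i with inl (inl u) | inl (inr u) | inr u => u end.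

Let clockT i : clock i setT.
Proof. by case: i => [[u|u]|u]; exists setT. Qed.

Let clockI i : setI_closed (clock i).
Proof.
by case: i => [[u|u]|u] _ _ [A mA <-] [B mB <-]; exists (A `&` B) => //; exact: measurableI.
Qed.

Let clock_measurable i : clock i `<=` measurable.
Proof.
case: i => [[u|u]|u] _ [A mA <-].
- by rewrite -[_ @^-1` _]setTI; exact: measurable_funP.
- by rewrite -[_ @^-1` _]setTI; exact: measurable_funP.
- rewrite (_ : _ @^-1` A = \bigcup_(z in A) (jump X u @^-1` [set z])).
    rewrite bigcup_mkcond; apply: countable_bigcupT_measurable => [|z].
      exact: countableP.
    by case: ifP => // _; exact: jump_measurable.
  by apply/seteqP; split=> [w Aw|w [z Az /= ->]]//; exists (jump X u w).
Qed.

Local Notation off i := (g_sigma_algebraType (@others _ Omega index clock i)).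

Let clock_off (i : index) (j : index) B : clock j B -> j != i -> measurable (B : set (off i)).
Proof. by move=> cB ji; apply: sub_sigma_algebra; exists j. Qed.

Let off_measurable d' (T : measurableType d') (i : index) (H : Omega -> T) :
  measurable_fun [set: off i] (H : off i -> T) -> measurable_fun setT H.
Proof.
move=> mH _ B mB; apply: (others_measurable clock_measurable (i := i)).
exact: (mH measurableT B mB).
Qed.

Lemma measurable_wait_off (i : index) u : inl (inl u) != i ->
  measurable_fun [set: off i] (wait X u : off i -> R).
Proof. by move=> ui _ B mB; rewrite setTI; apply: (clock_off _ ui); exists B. Qed.

Lemma measurable_splt_off (i : index) u : inl (inr u) != i ->
  measurable_fun [set: off i] (splt X u : off i -> R).
Proof. by move=> ui _ B mB; rewrite setTI; apply: (clock_off _ ui); exists B. Qed.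

Lemma measurable_jump_off (i : index) u z : inr u != i ->
  measurable (jump X u @^-1` [set z] : set (off i)).
Proof. by move=> ui; apply: (clock_off _ ui); exists [set z]. Qed.

Lemma integral_clock d1 d2 (T1 : measurableType d1) (T2 : measurableType d2) (i : index)
    (H : Omega -> T1) (Y : Omega -> T2) (F : T1 * T2 -> \bar R) :
  measurable_fun [set: off i] (H : off i -> T1) ->
  (forall B, measurable B -> clock i (Y @^-1` B)) ->
  measurable_fun [set: T1 * T2] F -> (forall z, 0 <= F z)%E ->
  (\int[P]_w F (H w, Y w) = \int[P]_w \int[P]_w' F (H w, Y w'))%E.
Proof.
move=> mH mY mF F0; apply: integral_indep => //.
- exact: off_measurable mH.
- by move=> _ B mB; rewrite setTI; apply: clock_measurable; exact: mY.
- move=> A B mA mB.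
  have := @indep_others _ _ _ P index clock clockT clockI clock_measurable
    (@clocks_independent _ _ _ _ _ _ _ X) i (H @^-1` A) (Y @^-1` B).
  apply; last exact: mY.
  by rewrite -[_ @^-1` _]setTI; exact: (mH measurableT A mA).
Qed.

Definition at_site u z : set Omega := [set w | exists_particle X u w /\ site X u w = z].

Let measurable_jumps_off (i : index) u : inl (inl u) != i -> inl (inr u) != i ->
  measurable [set w : off i | jumps X u w].
Proof.
move=> iw js; rewrite -[X in measurable X]setTI; apply: measurable_fun_ltr => //.
- exact: measurable_wait_off.
- exact: measurable_splt_off.
Qed.

Lemma at_site_true v z : at_site (true :: v) z = at_site v z `&` ~` [set w | jumps X v w].
Proof.
apply/seteqP; split=> w; rewrite /at_site /=.
  by move=> [/andP[-> /negP nj]]; case: ifP => // _; rewrite addr0.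
by move=> [[-> <-] /negP nj]; rewrite nj (negbTE nj) addr0.
Qed.

Lemma at_site_false v z : at_site (false :: v) z =
  (at_site v z `&` ~` [set w | jumps X v w]) `|`
  \bigcup_y (at_site v (z - y) `&` [set w | jumps X v w] `&` jump X v @^-1` [set y]).
Proof.
apply/seteqP; split=> w; rewrite /at_site /= ?andbT.
  case: ifPn => [j|/negP nj] [ev <-]; [right|left].
    by exists (jump X v w) => //; do 2?split; rewrite //= ?addrK.
  by rewrite addr0.
case.
  by move=> [[-> <-] /negP nj]; rewrite (negbTE nj) addr0.
by move=> [y _ /= [[[-> sv] ->] ->]]; rewrite sv subrK.
Qed.

Lemma in_at_site u z w : (w \in at_site u z) = exists_particle X u w && (site X u w == z).
Proof.
by apply/idP/andP => [/set_mem[-> /eqP]//|[wu /eqP wz]]; apply/mem_set.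
Qed.

(** The history of [u] involves only the clocks of its strict ancestors, whose labels are shorter; a
    clock whose label is at least as long as [u] is not among them. In particular the history is
    independent of the clocks of [u]. *)
Lemma measurable_history u (i : index) : (size u <= size (particle i))%N ->
  measurable_fun [set: off i] (start X u : off i -> R) /\
  forall z, measurable (at_site u z : set (off i)).
Proof.
elim: u => [|b v IH] /= sz.
  split; first exact: measurable_cst.
  move=> z; have [<-|z0] := eqVneq 0 z.
    by rewrite (_ : at_site _ _ = setT)//; apply/seteqP; split.
  rewrite (_ : at_site _ _ = set0)//; apply/seteqP; split => // w [_ /=].
  by move/eqP; rewrite (negbTE z0).
have {IH} [mst msite] := IH (ltnW sz).
have wi : inl (inl v) != i by apply/eqP => iv; rewrite -iv ltnn in sz.
have si : inl (inr v) != i by apply/eqP => iv; rewrite -iv ltnn in sz.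
have ji : inr v != i by apply/eqP => iv; rewrite -iv ltnn in sz.
have mj := measurable_jumps_off wi si.
split.
  apply: measurable_funD => //; apply: measurable_minr.
  - exact: measurable_wait_off.
  - exact: measurable_splt_off.
move=> z; case: b.
  by rewrite at_site_true; apply: measurableI => //; exact: measurableC.
rewrite at_site_false; apply: measurableU.
  by apply: measurableI => //; exact: measurableC.
apply: countable_bigcupT_measurable => [|y].
  exact: countableP.
apply: measurableI; first exact: measurableI.
exact: measurable_jump_off.
Qed.


Let Pm (Y : {RV P >-> R}) r B : (forall A, measurable A ->
    distribution P Y A = exponential_prob r A) -> measurable B ->
  P (Y @^-1` B) = exponential_prob r B.
Proof. by move=> YE mB; rewrite -YE. Qed.

Let integral_cond b (Y : {RV P >-> R}) r x : 0 < r -> (forall A, measurable A ->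
    distribution P Y A = exponential_prob r A) ->
  (\int[P]_w (if x < Y w ?<= if b then 1 else 0)%:E = (surv r x)%:E)%E.
Proof.
move=> r0 YE; pose B := [set` Interval (BSide b x) +oo%O].
rewrite -(exponential_prob_surv x b r0) -(Pm YE)//.
rewrite -[RHS]mul1e -integral_cst//; last by rewrite -[X in measurable X]setTI; exact: measurable_funP.
rewrite integral_mkcond; apply: eq_integral => w _; rewrite patchE.
have -> : (w \in Y @^-1` [set` Interval (BSide b x) +oo%O]) = (Y w \in Interval (BSide b x) +oo%O).
  by apply/idP/idP => [/set_mem //|h]; exact: mem_set.
by rewrite itv_boundlr /= andbT; case: b {B} => /=; rewrite bnd_simp; case: ifP.
Qed.

Let integral_exponential (Y : {RV P >-> R}) r (f : R -> \bar R) : 0 < r ->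
  (forall A, measurable A -> distribution P Y A = exponential_prob r A) ->
  measurable_fun setT f -> (forall x, 0 <= f x)%E ->
  (\int[P]_w f (Y w) = \int[lebesgue_measure]_x (f x * (exponential_pdf r x)%:E))%E.
Proof.
move=> r0 YE mf f0.
have mg := @measurable_exponential_pdf R r.
have g0 x : 0 <= exponential_pdf r x by rewrite exponential_pdf_ge0// ltW.
(* Lebesgue measure is carried by [measurableTypeR R], so [Y] is retyped before its law is given a
   density. *)
have mY : @measurable_fun _ _ Omega (measurableTypeR R) setT Y.
  move=> _ A mA; have mA' : measurable (A : set R) by [].
  exact: (measurable_funPT Y measurableT A mA').
pose Y' : {mfun Omega >-> measurableTypeR R} :=
  @mfun_Sub _ _ Omega (measurableTypeR R) Y (mem_set mY).
rewrite -(@integral_density _ (measurableTypeR R) R (distribution P Y') lebesgue_measure (exponential_pdf r) mg g0)//.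
by rewrite ge0_integral_distribution.
Qed.

Let measurable_lteif d' (T : measurableType d') b (f g : T -> R) :
  measurable_fun setT f -> measurable_fun setT g ->
  measurable_fun setT (fun x => f x < g x ?<= if b).
Proof.
by case: b => /= mf mg; [exact: measurable_fun_ler|exact: measurable_fun_ltr].
Qed.

Ltac mfun := repeat first
  [ assumption | exact: measurable_cst
  | apply: (measurableT_comp (measurable_gammaw _ _ _))
  | apply: (measurableT_comp (measurable_surv _))
  | apply: (measurableT_comp (@normr_measurable R setT))
  | apply: measurable_funM | apply: measurable_funB | apply: measurable_funD
  | apply: measurable_lteif | apply: measurable_fun_ler
  | apply: measurable_fun_ltr | apply: measurable_fun_ifT ].

(** Two competing clocks: integrating out [Z] leaves a survival factor of rate [m], then [Y] is
    integrated against its density. [A] and [S] stand for the history and must avoid both clocks.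
    The flag [b] settles ties, so that jumps and splittings partition the space exactly. *)
Lemma integral_race (i j : index) (Y Z : {RV P >-> R}) (l m t : R) b k
    (A : Omega -> R) (S : Omega -> R) :
  0 < l -> 0 < m -> i != j ->
  (forall B, measurable B -> clock i (Y @^-1` B)) ->
  (forall B, measurable B -> clock j (Z @^-1` B)) ->
  (forall B, measurable B -> distribution P Y B = exponential_prob l B) ->
  (forall B, measurable B -> distribution P Z B = exponential_prob m B) ->
  (forall w, 0 <= A w) ->
  (forall i', i' = i \/ i' = j -> measurable_fun [set: off i'] (A : off i' -> R)) ->
  (forall i', i' = i \/ i' = j -> measurable_fun [set: off i'] (S : off i' -> R)) ->
  (\int[P]_w (A w * (if Y w < Z w ?<= if b then gammaw (l + m) t k (S w + Y w) else 0))%:E =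
   l%:E * \int[P]_w (A w * gammaw (l + m) t k.+1 (S w))%:E)%E.
Proof.
move=> l0 m0 ij Yi Zj YE ZE A0 mA mS.
have A_abs w : `|A w| = A w by rewrite ger0_norm.
(* The absolute value makes the integrand nonnegative on the whole product space, as Tonelli
   requires; on values of [A] it changes nothing. *)
pose F (z : (R * R * R) * R) : R :=
  `|z.1.1.1| * gammaw (l + m) t k (z.1.1.2 + z.1.2) *
  (if z.1.2 < z.2 ?<= if b then 1 else 0).
have F0 z : (0 <= (F z)%:E)%E.
  by rewrite lee_fin /F !mulr_ge0 ?gammaw_ge0//; case: ifP.
have mF : measurable_fun setT F.
  have p1 : measurable_fun setT (fun z : (R * R * R) * R => z.1.1.1).
    exact: (measurableT_comp measurable_fst (measurableT_comp measurable_fst measurable_fst)).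
  have p2 : measurable_fun setT (fun z : (R * R * R) * R => z.1.1.2).
    exact: (measurableT_comp measurable_snd (measurableT_comp measurable_fst measurable_fst)).
  have p3 : measurable_fun setT (fun z : (R * R * R) * R => z.1.2).
    exact: (measurableT_comp measurable_snd measurable_fst).
  have p4 : measurable_fun setT (fun z : (R * R * R) * R => z.2).
    exact: measurable_snd.
  by rewrite /F; mfun.
pose F2 (z : (R * R) * R) : R :=
  `|z.1.1| * (surv m z.2 * gammaw (l + m) t k (z.1.2 + z.2)).
have F20 z : (0 <= (F2 z)%:E)%E.
  by rewrite lee_fin /F2 !mulr_ge0 ?gammaw_ge0 ?surv_ge0.
have mF2 : measurable_fun setT F2.
  have p1 : measurable_fun setT (fun z : (R * R) * R => z.1.1).
    exact: (measurableT_comp measurable_fst measurable_fst).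
  have p2 : measurable_fun setT (fun z : (R * R) * R => z.1.2).
    exact: (measurableT_comp measurable_snd measurable_fst).
  have p3 : measurable_fun setT (fun z : (R * R) * R => z.2).
    exact: measurable_snd.
  by rewrite /F2; mfun.
transitivity (\int[P]_w (F ((A w, S w, Y w), Z w))%:E)%E.
  apply: eq_integral => w _; rewrite /F/= A_abs.
  by case: ifP => _; rewrite ?mulr1 ?mulr0.
rewrite (@integral_clock _ _ _ _ j (fun w => (A w, S w, Y w)) Z (fun z => (F z)%:E))//; last 2 first.
- apply: measurable_fun_pair; first by apply: measurable_fun_pair; [apply: mA|apply: mS]; right.
  move=> _ B mB; rewrite setTI; exact: (clock_off (Yi _ mB) ij).
- exact/measurable_EFinP.
transitivity (\int[P]_w (F2 ((A w, S w), Y w))%:E)%E.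
  apply: eq_integral => w _; rewrite /F/=.
  under eq_integral do rewrite EFinM.
  rewrite ge0_integralZl_EFin//=; last 3 first.
  - by move=> w' _; case: ifP.
  - apply/measurable_EFinP; mfun; exact: measurable_funP.
  - by rewrite mulr_ge0// gammaw_ge0.
  by rewrite (integral_cond _ _ m0 ZE) -EFinM /F2/= mulrAC mulrA.
rewrite (@integral_clock _ _ _ _ i (fun w => (A w, S w)) Y (fun z => (F2 z)%:E))//; last 2 first.
- by apply: measurable_fun_pair; [apply: mA|apply: mS]; left.
- exact/measurable_EFinP.
rewrite -ge0_integralZl_EFin//; last 3 first.
- by move=> w _; rewrite lee_fin mulr_ge0// gammaw_ge0.
- apply/measurable_EFinP; apply: measurable_funM.
    by apply: (@off_measurable _ _ i); apply: mA; left.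
  apply: measurableT_comp; first exact: measurable_gammaw.
  by apply: (@off_measurable _ _ i); apply: mS; left.
- exact: ltW.
apply: eq_integral => w _; rewrite /F2/=.
under eq_integral do rewrite EFinM.
pose f x := (surv m x * gammaw (l + m) t k (S w + x))%:E.
have mf : measurable_fun setT f by apply/measurable_EFinP; mfun.
have f0 x : (0 <= f x)%E by rewrite lee_fin mulr_ge0 ?surv_ge0 ?gammaw_ge0.
rewrite (@ge0_integralZl_EFin _ _ _ _ _ measurableT (fun w' => f (Y w')))//; last exact: measurableT_comp.
rewrite (integral_exponential l0 YE mf f0).
rewrite -EFinM A_abs.
have -> : (\int[lebesgue_measure]_x (f x * (exponential_pdf l x)%:E) = (l * gammaw (l + m) t k.+1 (S w))%:E)%E.
  rewrite -(@integral_gammaw _ l m t (S w) k (surv m)); first by apply: eq_integral => x _; rewrite -EFinM.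
  by move=> x x0; rewrite /surv ltNge x0.
by rewrite -EFinM mulrCA.
Qed.

Fixpoint weight u (z : 'rV[int]_d) : \bar R :=
  if u is b :: v then
    (nu%:E * weight v z +
     if b then 0 else \esum_(y in [set: 'rV[int]_d]) (a y)%:E * weight v (z - y))%E
  else if z == 0 then 1%E else 0%E.

Hypothesis a0 : forall z, 0 <= a z.

Lemma weight_ge0 u z : (0 <= weight u z)%E.
Proof.
elim: u z => [|b v IH] z /=; first by case: ifP.
apply: adde_ge0; first by rewrite mule_ge0// lee_fin ltW.
case: b => //; apply: esum_ge0 => y _; by rewrite mule_ge0// lee_fin.
Qed.

Let measurable_at_site_off u z i : (size u <= size (particle i))%N ->
  measurable_fun [set: off i] ((\1_(at_site u z) : Omega -> R) : off i -> R).
Proof. by move=> ui; apply: measurable_indic; exact: (measurable_history ui).2. Qed.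

Let measurable_start_off u i : (size u <= size (particle i))%N ->
  measurable_fun [set: off i] (start X u : off i -> R).
Proof. by move=> ui; exact: (measurable_history ui).1. Qed.

Let measurable_at_site u z : measurable_fun setT (\1_(at_site u z) : Omega -> R).
Proof. by apply: (@off_measurable _ _ (inr u)); exact: measurable_at_site_off. Qed.

Let measurable_start u : measurable_fun setT (start X u).
Proof. by apply: (@off_measurable _ _ (inr u)); exact: measurable_start_off. Qed.

Let M t u z k := (\int[P]_w (\1_(at_site u z) w * gammaw (1 + nu) t k (start X u w))%:E)%E.

Let M_split t v z k :
  (\int[P]_w (\1_(at_site v z) w * (if splt X v w < wait X v w ?<= if true then
      gammaw (1 + nu) t k (start X v w + splt X v w) else 0))%:E = nu%:E * M t v z k.+1)%E.
Proof.
rewrite /M (addrC 1 nu).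
apply: (@integral_race (inl (inr v)) (inl (inl v))) => //.
- by move=> B mB; exists B.
- by move=> B mB; exists B.
- exact: splt_law.
- exact: wait_law.
- by move=> i' [->|->]; exact: measurable_at_site_off.
- by move=> i' [->|->]; exact: measurable_start_off.
Qed.

Let M_jump t v z k y :
  (\int[P]_w (\1_(at_site v z) w * \1_(jump X v @^-1` [set y]) w *
    (if wait X v w < splt X v w ?<= if false then
      gammaw (1 + nu) t k (start X v w + wait X v w) else 0))%:E = (a y)%:E * M t v z k.+1)%E.
Proof.
transitivity ((1 : R)%:E * (\int[P]_w (\1_(at_site v z) w * \1_(jump X v @^-1` [set y]) w *
    gammaw (1 + nu) t k.+1 (start X v w))%:E))%E.
  apply: (@integral_race (inl (inl v)) (inl (inr v)) _ _ 1 nu _ false k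
    (fun w => \1_(at_site v z) w * \1_(jump X v @^-1` [set y]) w)) => //.
  - by move=> B mB; exists B.
  - by move=> B mB; exists B.
  - exact: wait_law.
  - exact: splt_law.
  - move=> i' Hi'; apply: measurable_funM.
      by case: Hi' => ->; exact: measurable_at_site_off.
    by apply: measurable_indic; case: Hi' => ->; exact: measurable_jump_off.
  - by move=> i' [->|->]; exact: measurable_start_off.
rewrite mul1e /M.
pose F (z : (R * R) * R) : R := `|z.1.1| * gammaw (1 + nu) t k.+1 z.1.2 * `|z.2|.
transitivity (\int[P]_w (F ((\1_(at_site v z) w, start X v w), \1_(jump X v @^-1` [set y]) w))%:E)%E.
  by apply: eq_integral => w _; rewrite /F /= !ger0_norm// mulrAC.
have mF : measurable_fun setT F.
  have p1 : measurable_fun setT (fun z : (R * R) * R => z.1.1).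
    exact: (measurableT_comp measurable_fst measurable_fst).
  have p2 : measurable_fun setT (fun z : (R * R) * R => z.1.2).
    exact: (measurableT_comp measurable_snd measurable_fst).
  have p3 : measurable_fun setT (fun z : (R * R) * R => z.2).
    exact: measurable_snd.
  by rewrite /F; mfun.
have mjump : measurable (jump X v @^-1` [set y]) by exact: jump_measurable.
rewrite (@integral_clock _ _ _ _ (inr v) (fun w => (\1_(at_site v z) w : R, start X v w))
  (\1_(jump X v @^-1` [set y]) : Omega -> R) (fun z => (F z)%:E))//; last 4 first.
- by apply: measurable_fun_pair; [exact: measurable_at_site_off|exact: measurable_start_off].
- move=> B mB; exists [set x | B (\1_[set y] x)] => //.
- exact/measurable_EFinP.
- by move=> w; rewrite lee_fin !mulr_ge0 ?gammaw_ge0.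
rewrite -ge0_integralZl_EFin//; last 2 first.
- by move=> w _; rewrite lee_fin mulr_ge0 ?gammaw_ge0.
- apply/measurable_EFinP; apply: measurable_funM => //.
  by apply: measurableT_comp => //; exact: measurable_gammaw.
apply: eq_integral => w _; rewrite /F /=.
under eq_integral do rewrite EFinM.
rewrite ge0_integralZl_EFin//; last 2 first.
- by apply/measurable_EFinP/measurableT_comp => //; exact: measurable_indic.
- by rewrite mulr_ge0 ?gammaw_ge0.
under eq_integral do rewrite ger0_norm//.
have -> : (\int[P]_w' (\1_(jump X v @^-1` [set y]) w')%:E = (a y)%:E)%E.
  by rewrite integral_indic// setIT; exact: jump_law.
by rewrite -!EFinM ger0_norm// mulrC.
Qed.

Let esum_single (y0 : 'rV[int]_d) (r : R) : 0 <= r ->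
  (\esum_(y in [set: 'rV[int]_d]) (if y == y0 then r else 0)%:E = r%:E)%E.
Proof.
move=> r0; transitivity (\esum_(y in [set y0]) r%:E)%E; last by rewrite esum_set1// lee_fin.
rewrite [RHS]esum_mkcond; apply: eq_esum => y _.
by rewrite in_set1; case: eqP.
Qed.

(** Induction on the label with [k] free: removing the latest event integrates out its clocks and
    replaces [k] by [k + 1], until the root, born at time 0, is left. *)
Lemma integral_at_site t u z k : 0 <= t ->
  (\int[P]_w (\1_(at_site u z) w * gammaw (1 + nu) t k (start X u w))%:E =
   weight u z * (gammaw (1 + nu) t (k + size u) 0)%:E)%E.
Proof.
move=> t0; elim: u z k => [|b v IH] z k.
  rewrite addn0 /=.
  transitivity (\int[P]_w ((z == 0)%:R * gammaw (1 + nu) t k 0)%:E)%E.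
    apply: eq_integral => w _; congr (_ * _)%:E; rewrite indicE; congr (nat_of_bool _)%:R.
    by apply/idP/idP => [/set_mem[_ /= <-]//|/eqP ->]; exact: mem_set.
  rewrite integral_cst//= probability_setT mule1.
  by case: eqP => _; rewrite EFinM ?mul1e ?mul0e.
have IHM y : (M t v y k.+1 = weight v y * (gammaw (1 + nu) t (k.+1 + size v) 0)%:E)%E.
  exact: IH.
have jE w : jumps X v w = (wait X v w < splt X v w) by [].
have jmem w : (w \in [set w | jumps X v w]) = (wait X v w < splt X v w).
  by apply/idP/idP => [/set_mem|jw] //; apply/mem_set.
have durE w : duration X v w = if jumps X v w then wait X v w else splt X v w.
  by rewrite /duration /Order.min jE.
have Sp : (\int[P]_w (\1_(at_site v z) w * (if splt X v w < wait X v w ?<= if true then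
      gammaw (1 + nu) t k (start X v w + splt X v w) else 0))%:E =
    nu%:E * weight v z * (gammaw (1 + nu) t (k + (size v).+1) 0)%:E)%E.
  by rewrite M_split IHM muleA addnS addSn.
case: b => /=.
  rewrite adde0 -Sp; apply: eq_integral => w _.
  congr EFin; rewrite at_site_true indicE in_setI durE /=.
  rewrite in_setC jmem jE leNgt; case: (wait X v w < splt X v w) => /=.
    by rewrite andbF mul0r mulr0.
  by rewrite andbT -indicE.
have F0 y w : 0 <= \1_(at_site v (z - y)) w * \1_(jump X v @^-1` [set y]) w *
    (if wait X v w < splt X v w ?<= if false then
      gammaw (1 + nu) t k (start X v w + wait X v w) else 0).
  by rewrite !mulr_ge0//; case: ifP => // _; exact: gammaw_ge0.
rewrite muleDl; last 2 first.
- by [].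
- by apply: ge0_adde_def; rewrite inE; [rewrite mule_ge0 ?lee_fin ?(ltW nu0)// weight_ge0|
    apply: esum_ge0 => y _; rewrite mule_ge0 ?lee_fin// weight_ge0].
rewrite -Sp muleC -esumZl ?gammaw_ge0//; last first.
  by move=> y; rewrite mule_ge0 ?lee_fin// weight_ge0.
under eq_esum do rewrite muleC -muleA addnS -addSn -IHM -M_jump.
rewrite -integral_esum; last 2 first.
- move=> y; apply/measurable_EFinP.
  have mjump : measurable (jump X v @^-1` [set y]) by exact: jump_measurable.
  apply: measurable_funM; first by apply: measurable_funM => //; exact: measurable_indic.
  have mw := measurable_funPT (wait X v); have ms := measurable_funPT (splt X v).
  by mfun.
- by move=> y w; rewrite lee_fin.
rewrite -ge0_integralD//; last 4 first.
- move=> w _; rewrite lee_fin mulr_ge0//; case: ifP => // _; exact: gammaw_ge0.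
- apply/measurable_EFinP; apply: measurable_funM => //.
  have mw := measurable_funPT (wait X v); have ms := measurable_funPT (splt X v).
  by mfun.
- by move=> w _; apply: esum_ge0 => y _; rewrite lee_fin.
- apply: measurable_esum => [y|y w]; last by rewrite lee_fin.
  apply/measurable_EFinP.
  have mjump : measurable (jump X v @^-1` [set y]) by exact: jump_measurable.
  apply: measurable_funM; first by apply: measurable_funM => //; exact: measurable_indic.
  have mw := measurable_funPT (wait X v); have ms := measurable_funPT (splt X v).
  by mfun.
apply: eq_integral => w _; rewrite durE /=.
have [j|nj] := boolP (jumps X v w).
  have j' : wait X v w < splt X v w by rewrite -jE.
  rewrite leNgt j' mulr0 add0e.
  (* The displacement has a single value, so the sum over [y] has at most one nonzero term. *)
  rewrite -(@esum_single (jump X v w)); last by rewrite mulr_ge0 ?gammaw_ge0.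
  apply: eq_esum => y _; congr EFin; rewrite !indicE !in_at_site /= j andbT.
  rewrite (_ : (w \in jump X v @^-1` [set y]) = (y == jump X v w)); last first.
    by apply/idP/eqP => [/set_mem ->//|->]; apply/mem_set.
  case: eqP => [->|_]; last by rewrite mulr0 mul0r.
  by rewrite mulr1 [in RHS]eq_sym subr_eq [in RHS]eq_sym.
have j' : (wait X v w < splt X v w) = false by rewrite -jE; exact/negbTE.
rewrite leNgt j' /= [X in (_ + X)%E]esum1 ?adde0; last by move=> y _; rewrite mulr0.
by congr EFin; rewrite !indicE !in_at_site /= (negbTE nj) andbT addr0.
Qed.

(** A label born at [start <= t] is alive at [t] exactly when both clocks exceed [t - start];
    integrating them out gives [e^(-(1+nu)(t-start))], the weight with exponent 0. *)
Lemma probability_alive t u z : 0 <= t ->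
  (\int[P]_w (\1_[set w | alive X u t w /\ site X u w = z] w)%:E =
   weight u z * (gammaw (1 + nu) t (size u) 0)%:E)%E.
Proof.
move=> t0; rewrite -(add0n (size u)) -(integral_at_site u z 0 t0).
have mw := measurable_funPT (wait X u); have ms := measurable_funPT (splt X u).
pose F (z : (R * R * R) * R) : R :=
  `|z.1.1.1| * (if z.1.1.2 <= t then 1 else 0) * (if t - z.1.1.2 < z.1.2 ?<= if false then 1 else 0) *
  (if t - z.1.1.2 < z.2 ?<= if false then 1 else 0).
have F0 z' : 0 <= F z' by rewrite /F !mulr_ge0//; case: ifP.
have mF : measurable_fun setT F.
  have p1 : measurable_fun setT (fun z : (R * R * R) * R => z.1.1.1).
    exact: (measurableT_comp measurable_fst (measurableT_comp measurable_fst measurable_fst)).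
  have p2 : measurable_fun setT (fun z : (R * R * R) * R => z.1.1.2).
    exact: (measurableT_comp measurable_snd (measurableT_comp measurable_fst measurable_fst)).
  have p3 : measurable_fun setT (fun z : (R * R * R) * R => z.1.2).
    exact: (measurableT_comp measurable_snd measurable_fst).
  have p4 : measurable_fun setT (fun z : (R * R * R) * R => z.2).
    exact: measurable_snd.
  by rewrite /F; mfun.
pose F2 (z : (R * R) * R) : R :=
  `|z.1.1| * (if z.1.2 <= t then 1 else 0) * surv nu (t - z.1.2) *
  (if t - z.1.2 < z.2 ?<= if false then 1 else 0).
have F20 z' : 0 <= F2 z' by rewrite /F2 !mulr_ge0 ?surv_ge0//; case: ifP.
have mF2 : measurable_fun setT F2.
  have p1 : measurable_fun setT (fun z : (R * R) * R => z.1.1).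
    exact: (measurableT_comp measurable_fst measurable_fst).
  have p2 : measurable_fun setT (fun z : (R * R) * R => z.1.2).
    exact: (measurableT_comp measurable_snd measurable_fst).
  have p3 : measurable_fun setT (fun z : (R * R) * R => z.2).
    exact: measurable_snd.
  by rewrite /F2; mfun.
transitivity (\int[P]_w (F ((\1_(at_site u z) w, start X u w, wait X u w), splt X u w))%:E)%E.
  apply: eq_integral => w _; congr EFin; rewrite /F /= !indicE in_at_site ger0_norm//.
  rewrite (_ : (w \in _) = exists_particle X u w && (site X u w == z) &&
     [&& start X u w <= t, t - start X u w < wait X u w & t - start X u w < splt X u w]).
    by case: (_ && (_ == _)); case: (start X u w <= t); case: (_ < wait X u w); case: (_ < splt X u w);
      rewrite /= ?(mulr1, mulr0, mul0r).
  rewrite !ltrBlDl -andbA andbC.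
  apply/idP/idP.
    move=> /set_mem[/andP[-> /andP[-> h]] ->]; rewrite eqxx !andbT /=.
    by move: h; rewrite /duration addr_minr lt_min.
  move=> /andP[/andP[/eqP <- /and3P[h1 h2 h3]] h4]; apply/mem_set; split => //.
  by rewrite /alive h4 h1 /duration addr_minr lt_min h2 h3.
rewrite (@integral_clock _ _ _ _ (inl (inr u))
  (fun w => (\1_(at_site u z) w : R, start X u w, wait X u w)) (splt X u) (fun z => (F z)%:E))//; last 3 first.
- apply: measurable_fun_pair; last exact: measurable_wait_off.
  by apply: measurable_fun_pair; [exact: measurable_at_site_off|exact: measurable_start_off].
- by move=> B mB; exists B.
- exact/measurable_EFinP.
transitivity (\int[P]_w (F2 ((\1_(at_site u z) w, start X u w), wait X u w))%:E)%E.
  apply: eq_integral => w _; rewrite /F /=.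
  under eq_integral do rewrite EFinM.
  rewrite ge0_integralZl_EFin//; last 3 first.
  - by move=> w' _; case: ifP.
  - by apply/measurable_EFinP; mfun.
  - by rewrite !mulr_ge0//; case: ifP.
  by rewrite (integral_cond false _ nu0 (splt_law X u)) -EFinM /F2 /= mulrAC.
rewrite (@integral_clock _ _ _ _ (inl (inl u))
  (fun w => (\1_(at_site u z) w : R, start X u w)) (wait X u) (fun z => (F2 z)%:E))//; last 3 first.
- by apply: measurable_fun_pair; [exact: measurable_at_site_off|exact: measurable_start_off].
- by move=> B mB; exists B.
- exact/measurable_EFinP.
apply: eq_integral => w _; rewrite /F2 /=.
under eq_integral do rewrite EFinM.
rewrite ge0_integralZl_EFin//; last 3 first.
- by move=> w' _; case: ifP.
- by apply/measurable_EFinP; mfun.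
- by rewrite !mulr_ge0 ?surv_ge0//; case: ifP.
rewrite (integral_cond false _ ltr01 (wait_law X u)) -EFinM ger0_norm//.
rewrite /gammaw; case: ifP => st; last by rewrite !(mulr0, mul0r).
rewrite /surv ltNge subr_ge0 st /= expr0 fact0 divr1 mul1r mulr1 -mulrA -expRD.
congr (_ * expR _)%:E; ring.
Qed.

Fixpoint words k : seq (seq bool) :=
  if k is k'.+1 then [seq false :: u | u <- words k'] ++ [seq true :: u | u <- words k']
  else [:: [::]].

Lemma mem_words k u : (u \in words k) = (size u == k).
Proof.
elim: k u => [|k IH] [|b u] //=; rewrite ?mem_cat //.
  by apply/negP => /orP[] /mapP[].
rewrite eqSS -IH; apply/orP/idP => [|uk].
  by case => /mapP[v vk [_ ->]].
by case: b; [right|left]; apply/mapP; exists u.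
Qed.

Lemma uniq_words k : uniq (words k).
Proof.
elim: k => //= k IH; rewrite cat_uniq !map_inj_uniq; try by move=> ? ? [].
by rewrite IH andbT; apply/hasPn => _ /mapP[u _ ->]; apply/negP => /mapP[].
Qed.

(** Summing [weight] over the two possible last letters doubles the splitting term, whence
    [2 * nu]. *)
Fixpoint mass k (z : 'rV[int]_d) : \bar R :=
  if k is k'.+1 then
    ((2 * nu)%:E * mass k' z + \esum_(y in [set: 'rV[int]_d]) (a y)%:E * mass k' (z - y))%E
  else if z == 0 then 1%E else 0%E.

Lemma sum_weight k z : (\sum_(u <- words k) weight u z = mass k z)%E.
Proof.
elim: k z => [|k IH] z /=; first by rewrite big_seq1.
rewrite big_cat !big_map /= big_split /=.
under [X in (_ + _ + X)%E]eq_bigr do rewrite adde0.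
rewrite -!ge0_sume_distrr; try by move=> u _; exact: weight_ge0.
rewrite IH addeAC; congr (_ + _)%E.
  by rewrite -ge0_muleDl ?lee_fin ?(ltW nu0)// -EFinD -mulr2n mulr_natl.
rewrite -esum_sum; last by move=> y u _ _; rewrite mule_ge0 ?lee_fin// weight_ge0.
apply: eq_esum => y _; rewrite -IH ge0_sume_distrr// => u _; exact: weight_ge0.
Qed.

(** There are finitely many labels of each length, so the population becomes a series of finite
    sums, which can be integrated term by term. *)
Lemma counting_words (A : set (seq bool)) :
  (counting A = \sum_(0 <= k <oo) \sum_(u <- words k) (\1_A u)%:E :> \bar R)%E.
Proof.
have cardE : (counting A = \esum_(u in A) 1 :> \bar R)%E.
  rewrite /counting; case: asboolP => [fA|iA].
    rewrite esum_fset// fsbig_finite//= sumEFin; congr EFin.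
    by rewrite big_const_seq count_predT iter_addr_0.
  (* For an infinite set both sides are infinite: it has finite subsets of any cardinality. *)
  apply/esym/eqyP => r r0.
  have [B BA Br] := infinite_set_fset (Num.bound r) iA.
  apply: esum_ge; eexists; first by split; last exact: BA; exact: finite_fset.
  rewrite fsbig_finite//= set_fsetK sumEFin lee_fin big_const_seq count_predT iter_addr_0.
  by rewrite (le_trans (ltW (archi_boundP (ltW r0))))// ler_nat.
transitivity (\esum_(u in [set: seq bool]) (\1_A u)%:E : \bar R)%E.
  rewrite cardE esum_mkcond; apply: eq_esum => u _; rewrite indicE.
  by case: ifP.
have -> : [set: seq bool] = \bigcup_k [set` words k].
  by apply/seteqP; split => // u _; exists (size u) => //=; rewrite mem_words.
rewrite nneseries_sum_bigcup//.
- apply: eq_eseriesr => k _; rewrite esum_fset//; last exact: finite_seq.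
  by rewrite -fsbig_seq ?uniq_words.
- apply/trivIsetP => i j _ _ ij; apply/seteqP; split => // u [/=].
  by rewrite !mem_words => /eqP ui /eqP uj; rewrite -ui -uj eqxx in ij.
Qed.

Lemma m1_series t x : 0 <= t ->
  (m1 X t x = \sum_(0 <= k <oo) mass k x * (gammaw (1 + nu) t k 0)%:E)%E.
Proof.
move=> t0; rewrite /m1 /particles.
under eq_integral do rewrite counting_words.
have mA u : measurable [set w | alive X u t w /\ site X u w = x].
  have mw := measurable_funPT (wait X u); have ms := measurable_funPT (splt X u).
  have -> : [set w | alive X u t w /\ site X u w = x] =
    at_site u x `&` [set w | start X u w <= t < start X u w + duration X u w].
    apply/seteqP; split=> w /=; rewrite /at_site /alive /=.
      by move=> [/andP[-> ->] ->].
    by move=> [[-> ->] ->].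
  apply: measurableI.
    have h := (@measurable_history u (inr u) (leqnn _)).2 x.
    exact: (others_measurable clock_measurable (i := (inr u : index)) h).
  rewrite -[X in measurable X]setTI.
  apply: measurable_and => //; first exact: measurable_fun_ler.
  apply: measurable_fun_ltr => //; apply: measurable_funD => //.
  exact: measurable_minr.
have mind u : measurable_fun setT (fun w => (\1_[set u | alive X u t w /\ site X u w = x] u)%:E : \bar R).
  apply/measurable_EFinP.
  exact: (measurable_indic (mA u)).
rewrite integral_nneseries//; last 2 first.
- by move=> k; apply: emeasurable_sum.
- by move=> k w _; apply: sume_ge0.
apply: eq_eseriesr => k _; rewrite ge0_integral_sum//.
rewrite -sum_weight ge0_sume_distrl; last by move=> u _; exact: weight_ge0.
rewrite big_seq [RHS]big_seq; apply: eq_bigr => u; rewrite mem_words => /eqP <-.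
exact: probability_alive.
Qed.

End Walk.


(** * The Euclidean norm on vectors and on lattice points *)

Section EuclideanNorm.
Context {R : realType} {d : nat}.
Implicit Types (u v : 'rV[R]_d) (x y z : 'rV[int]_d).

Lemma enorm_ge0 u : 0 <= enorm u.
Proof. exact: sqrtr_ge0. Qed.

Lemma sqr_enorm u : enorm u ^+ 2 = \sum_i u 0 i ^+ 2.
Proof. by rewrite sqr_sqrtr// sumr_ge0// => i _; rewrite sqr_ge0. Qed.

Lemma enormZ (a : R) u : enorm (a *: u) = `|a| * enorm u.
Proof.
rewrite /enorm -sqrtr_sqr -sqrtrM ?sqr_ge0// mulr_sumr.
by congr Num.sqrt; apply: eq_bigr => i _; rewrite mxE exprMn.
Qed.

Lemma enormN u : enorm (- u) = enorm u.
Proof. by rewrite -scaleN1r enormZ normrN normr1 mul1r. Qed.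

Lemma enorm0 : enorm (0 : 'rV[R]_d) = 0.
Proof. by rewrite -(scale0r 0) enormZ normr0 mul0r. Qed.

Lemma enorm_eq0 u : (enorm u == 0) = (u == 0).
Proof.
apply/eqP/eqP => [u0|->]; last exact: enorm0.
have : \sum_i u 0 i ^+ 2 = 0 by rewrite -sqr_enorm u0 expr0n.
move/eqP; rewrite psumr_eq0 => [/allP h|i _]; last exact: sqr_ge0.
apply/rowP => i; rewrite mxE; apply/eqP.
by have := h i (mem_index_enum _); rewrite sqrf_eq0.
Qed.

(** Cauchy-Schwarz: the sum of the squares of [|v| u_i - |u| v_i] equals
    [2 |u| |v| (|u| |v| - u.v)]. *)
Lemma dot_le_enorm u v : \sum_i u 0 i * v 0 i <= enorm u * enorm v.
Proof.
have [->|u0] := eqVneq u 0.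
  by rewrite enorm0 mul0r big1// => i _; rewrite mxE mul0r.
have [->|v0] := eqVneq v 0.
  by rewrite enorm0 mulr0 big1// => i _; rewrite mxE mulr0.
have nu : 0 < enorm u by rewrite lt_neqAle enorm_ge0 eq_sym enorm_eq0 u0.
have nv : 0 < enorm v by rewrite lt_neqAle enorm_ge0 eq_sym enorm_eq0 v0.
have : 0 <= \sum_i (enorm v * u 0 i - enorm u * v 0 i) ^+ 2.
  by apply: sumr_ge0 => i _; exact: sqr_ge0.
have -> : \sum_i (enorm v * u 0 i - enorm u * v 0 i) ^+ 2 =
    enorm v ^+ 2 * \sum_i u 0 i ^+ 2 + enorm u ^+ 2 * \sum_i v 0 i ^+ 2
    - 2 * enorm u * enorm v * \sum_i u 0 i * v 0 i.
  rewrite !mulr_sumr -big_split -sumrB /=; apply: eq_bigr => i _; ring.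
rewrite -!sqr_enorm; set s := \sum_i _.
have -> : enorm v ^+ 2 * enorm u ^+ 2 + enorm u ^+ 2 * enorm v ^+ 2 - 2 * enorm u * enorm v * s =
  (2 * enorm u * enorm v) * (enorm u * enorm v - s) by ring.
by rewrite pmulr_rge0 ?subr_ge0// !mulr_gt0.
Qed.

Lemma enormD u v : enorm (u + v) <= enorm u + enorm v.
Proof.
rewrite -(ler_pXn2r (n := 2))// ?nnegrE ?addr_ge0 ?enorm_ge0//.
rewrite sqr_enorm sqrrD !sqr_enorm.
have -> : \sum_i (u + v) 0 i ^+ 2 =
    \sum_i u 0 i ^+ 2 + \sum_i v 0 i ^+ 2 + (\sum_i u 0 i * v 0 i) *+ 2.
  rewrite -mulr_natl mulr_sumr -!big_split /=; apply: eq_bigr => i _; rewrite mxE; ring.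
rewrite addrAC lerD2r lerD2l ler_wMn2r// dot_le_enorm//.
Qed.

Lemma lerB_enorm u v : enorm u - enorm v <= enorm (u - v).
Proof. by rewrite lerBlDr -{1}(subrK v u) enormD. Qed.

Lemma latticeD x y : latt (x + y) = latt x + latt y :> 'rV[R]_d.
Proof. by rewrite /latt map_mxD. Qed.

Lemma latticeN x : latt (- x) = - latt x :> 'rV[R]_d.
Proof. by rewrite /latt map_mxN. Qed.

Lemma lnorm_ge0 x : 0 <= lnorm R x.
Proof. exact: enorm_ge0. Qed.

Lemma lnormN x : lnorm R (- x) = lnorm R x.
Proof. by rewrite /lnorm latticeN enormN. Qed.

Lemma lnormD x y : lnorm R (x + y) <= lnorm R x + lnorm R y.
Proof. by rewrite /lnorm latticeD enormD. Qed.

Lemma lnormB x y : lnorm R (x - y) <= lnorm R x + lnorm R y.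
Proof. by rewrite -(lnormN y) lnormD. Qed.

Lemma lerB_lnorm x y : lnorm R x - lnorm R y <= lnorm R (x - y).
Proof. by rewrite /lnorm latticeD latticeN lerB_enorm. Qed.

Lemma lnorm0 : lnorm R (0 : 'rV[int]_d) = 0.
Proof. by rewrite /lnorm /latt map_mx0 enorm0. Qed.

End EuclideanNorm.

(** * Real powers *)

Section RealPower.
Context {R : realType}.
Implicit Types (x y p r s : R).

Lemma ler_powRN x y p : 0 <= p -> 0 < x -> x <= y -> y `^ (- p) <= x `^ (- p).
Proof.
move=> p0 x0 xy; rewrite !powRN lef_pV2 ?posrE ?powR_gt0 ?(lt_le_trans x0)//.
by rewrite ge0_ler_powR ?nnegrE// ltW ?(lt_le_trans x0).
Qed.

Lemma powR_scaleN x y p r : 0 <= p -> 0 < r -> 0 < x -> r * x <= y ->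
  y `^ (- p) <= r `^ (- p) * x `^ (- p).
Proof.
move=> p0 r0 x0 xy; rewrite -powRM; [|exact: ltW|exact: ltW].
by apply: ler_powRN => //; rewrite mulr_gt0.
Qed.

(** The target [(1 + s) / 2] lies halfway between 1 and [s]: short steps may consume this factor,
    and the remaining [(s - 1) / 2] is kept for the long ones. *)
Lemma powR_near1 p s : 0 < p -> 1 < s ->
  exists r : R, [/\ 0 < r, r <= 2^-1 & (1 - r) `^ (- p) <= (1 + s) / 2].
Proof.
move=> p0 s1; pose s' := (1 + s) / 2; have s'1 : 1 < s' by rewrite /s'; lra.
have s'0 : 0 < s' by lra.
pose r := 1 - s' `^ (- p^-1).
have pv : 0 < p^-1 by rewrite invr_gt0.
have r0 : 0 < r.
  rewrite subr_gt0 powRN invf_lt1 ?powR_gt0//.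
  have := @gt0_ltr_powR R _ pv 1 s'; rewrite powR1; apply => //; rewrite nnegrE; exact: ltW.
have r1 : r < 1 by rewrite ltrBlDr ltrDl powR_gt0.
exists (Num.min r 2^-1); split.
- by rewrite lt_min r0 invr_gt0 ltr0n.
- by rewrite ge_min lexx orbT.
- apply: (@le_trans _ _ ((1 - r) `^ (- p))).
    apply: ler_powRN; [exact: ltW|by rewrite subr_gt0|].
    by rewrite lerB// ge_min lexx.
  rewrite /r opprB addrC subrK -powRrM mulNr mulrN opprK mulVf ?gt_eqF// powRr1//.
  exact: ltW.
Qed.

(** Bernoulli's inequality; a factor linear in the number of steps is absorbed by [s^n]. *)
Lemma natr_le_exp s : 1 < s -> forall n, n%:R <= (s - 1)^-1 * s ^+ n.
Proof.
move=> s1 n; have s0 : 0 < s - 1 by rewrite subr_gt0.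
rewrite mulrC ler_pdivlMr//.
elim: n => [|n IH]; first by rewrite mul0r expr0.
rewrite exprS -natr1 mulrDl mul1r.
have : 1 <= s ^+ n by rewrite exprn_ege1// ltW.
nra.
Qed.

End RealPower.

(** * Real-valued summands on a countable set *)

Section LatticeSum.
Context {R : realType} {V : countType}.
Implicit Types f g : V -> R.

Definition hsum f : \bar R := (\esum_(x in [set: V]) (f x)%:E)%E.

Lemma le_hsum f g : (forall x, f x <= g x) -> (hsum f <= hsum g)%E.
Proof. by move=> fg; apply: le_esum => x _; rewrite lee_fin. Qed.

Lemma eq_hsum f g : f =1 g -> hsum f = hsum g.
Proof. by move=> fg; apply: eq_esum => x _; rewrite fg. Qed.

Lemma hsum_ge0 f : (forall x, 0 <= f x) -> (0 <= hsum f)%E.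
Proof. by move=> f0; apply: esum_ge0 => x _; rewrite lee_fin. Qed.

Lemma hsumD f g : (forall x, 0 <= f x) -> (forall x, 0 <= g x) ->
  (hsum (fun x => (f x + g x)%R) = hsum f + hsum g)%E.
Proof. by move=> f0 g0; rewrite -esumD// => x _; rewrite lee_fin. Qed.

Lemma hsumZ c f : 0 <= c -> (forall x, 0 <= f x) ->
  (hsum (fun x => (c * f x)%R) = c%:E * hsum f)%E.
Proof. by move=> c0 f0; rewrite -esumZl// => x; rewrite lee_fin. Qed.

Lemma hsum_ge_term f x : (forall x, 0 <= f x) -> ((f x)%:E <= hsum f)%E.
Proof.
move=> f0; apply: esum_ge; exists [set x]; first by split.
by rewrite fsbig_set1.
Qed.

Lemma hsum_exchange (F : V -> V -> R) : (forall x y, 0 <= F x y) ->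
  (\esum_(x in [set: V]) hsum (F x) = \esum_(y in [set: V]) hsum (F^~ y))%E.
Proof.
move=> F0; rewrite /hsum !esum_esum; try by move=> *; rewrite lee_fin.
rewrite (reindex_esum ([set: V] `*`` (fun=> [set: V])) _ (fun z => (z.2, z.1)))//.
by split => //= [[? ?] [? ?] _ _ [-> ->]|[x y] _]//; exists (y, x).
Qed.

End LatticeSum.

(** * Convolution powers of a probability kernel *)

Section Convolution.
Context {R : realType} {d : nat}.
Local Notation V := 'rV[int]_d.
Variable b : V -> R.
Hypothesis b0 : forall x, 0 <= b x.
Hypothesis b1 : hsum b = 1%E.

Lemma hsum_reflect (f : V -> R) x : hsum (fun y => f (x - y)) = hsum f.
Proof.
rewrite /hsum [RHS](reindex_esum [set: V] _ (fun y => x - y))//.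
split => //= [y z _ _ /addrI/oppr_inj//|y _].
by exists (x - y) => //; rewrite subKr.
Qed.

Lemma hsum_translate (f : V -> R) x : hsum (fun y => f (y - x)) = hsum f.
Proof.
rewrite /hsum [RHS](reindex_esum [set: V] _ (fun y => y - x))//.
split => //= [y z _ _ /addIr//|y _].
by exists (y + x) => //; rewrite addrK.
Qed.

(** [fine] loses nothing: the sum is at most the total mass 1 of [b]. *)
Fixpoint convn n (x : V) : R :=
  if n is n'.+1 then fine (hsum (fun y => b y * convn n' (x - y)))
  else (x == 0)%:R.

Let convn_01 n x : 0 <= convn n x <= 1.
Proof.
elim: n x => [|n IH] x /=; first by case: eqP; rewrite ?lexx ?ler01.
have h0 : (0 <= hsum (fun y => (b y * convn n (x - y))%R))%E.
  by apply: hsum_ge0 => y; rewrite mulr_ge0//; have /andP[] := IH (x - y).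
rewrite fine_ge0//=.
have h1 : (hsum (fun y => (b y * convn n (x - y))%R) <= 1)%E.
  rewrite -b1; apply: le_hsum => y; rewrite ler_piMr//.
  by have /andP[] := IH (x - y).
by rewrite -lee_fin fineK// ge0_fin_numE// (le_lt_trans h1)// ltry.
Qed.

Lemma convn_ge0 n x : 0 <= convn n x.
Proof. by have /andP[] := convn_01 n x. Qed.

Lemma convn_le1 n x : convn n x <= 1.
Proof. by have /andP[] := convn_01 n x. Qed.

Lemma convnS n x : (convn n.+1 x)%:E = hsum (fun y => b y * convn n (x - y)).
Proof.
have h0 : (0 <= hsum (fun y => (b y * convn n (x - y))%R))%E.
  by apply: hsum_ge0 => y; rewrite mulr_ge0// convn_ge0.
rewrite /= fineK// ge0_fin_numE// (@le_lt_trans _ _ 1%E) ?ltry//.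
by rewrite -b1; apply: le_hsum => y; rewrite ler_piMr// convn_le1.
Qed.

Lemma convnS' n x : (convn n.+1 x)%:E = hsum (fun z => b (x - z) * convn n z).
Proof.
rewrite convnS -[RHS](hsum_reflect _ x); apply: eq_hsum => y.
by rewrite subKr.
Qed.

Lemma hsum_convn n : hsum (convn n) = 1%E.
Proof.
elim: n => [|n IH].
  rewrite /hsum -(@esum_set1 _ _ (0 : V) (fun=> 1%E)) ?lee_fin// [RHS]esum_mkcond.
  by apply: eq_esum => y _ /=; rewrite in_set1; case: eqP.
rewrite {1}/hsum; under eq_esum do rewrite convnS.
rewrite (hsum_exchange (F := fun x y => b y * convn n (x - y))); last first.
  by move=> x y; rewrite mulr_ge0// convn_ge0.
under eq_esum => y _.
  rewrite hsumZ//; last by move=> x; exact: convn_ge0.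
  by rewrite hsum_translate IH mule1; over.
exact: b1.
Qed.

Let conv0 x : (x == 0)%:R = convn 0 x. Proof. by []. Qed.

(** * Uniform bounds for the powers: one long step dominates *)

Variables (gam c C1 C M : R).
Hypothesis gam0 : 0 < gam.
Hypothesis c0 : 0 < c.
Hypothesis c1 : c <= 1.
Hypothesis C10 : 0 <= C1.
Hypothesis C0 : 0 <= C.
Hypothesis M0 : 0 <= M.

Variable N : V -> R.
Hypothesis N_ge0 : forall x, 0 <= N x.
Hypothesis N_0 : N 0 = 0.
Hypothesis N_B : forall x y, N x - N y <= N (x - y).

Local Notation w x := (1 + N x).
Local Notation g x := ((1 + N x) `^ (- gam)).
Local Notation h x := ((1 + N x) `^ (- (gam + c))).

Hypothesis bg : forall x, b x <= C1 * g x.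
Hypothesis breg : forall x y, N y <= N x / 2 ->
  b (x - y) <= b x + C * (w y `^ c * h x) /\ b x <= b (x - y) + C * (w y `^ c * h x).
Hypothesis gsum : (hsum (fun x => (w x `^ c * g x)%R) <= M%:E)%E.

Let w1 x : 1 <= w x. Proof. by rewrite lerDl N_ge0. Qed.
Let w0 x : 0 < w x. Proof. exact: lt_le_trans (w1 x). Qed.
Let g0 x : 0 <= g x. Proof. exact: powR_ge0. Qed.
Let h0 x : 0 <= h x. Proof. exact: powR_ge0. Qed.
Let wc1 x : 1 <= w x `^ c.
Proof. by rewrite -[leLHS](powRr0 (w x)) ler_powR// ltW. Qed.

Let w_near x y r : 0 <= r -> r <= 1 -> N y <= r * N x -> (1 - r) * w x <= w (x - y).
Proof.
move=> r0 r1 yx; have := N_B x y; have := N_ge0 x => nx nxy.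
nra.
Qed.

Let w_far x y r : r <= 1 -> r * N x <= N y -> r * w x <= w y.
Proof. by move=> r1 xy; lra. Qed.

Let g_far x y r : 0 < r -> r * w x <= w y -> g y <= r `^ (- gam) * g x.
Proof. by move=> r0 xy; apply: powR_scaleN => //; exact: ltW. Qed.

(* A distance comparable with [N x] may be traded for a factor [w y `^ c * w x `^ (-c)]. *)
Let g_trade x y r : 0 < r -> r <= 1 -> r * w x <= w y -> g x <= r^-1 * (w y `^ c * h x).
Proof.
move=> r0 r1 xy.
have -> : h x = g x * w x `^ (- c) by rewrite opprD powRD//; apply/implyP => _; rewrite gt_eqF.
have -> : r^-1 * (w y `^ c * (g x * w x `^ (- c))) = g x * (r^-1 * (w y `^ c * w x `^ (- c))) by ring.
rewrite ler_peMr// ler_pdivlMl// mulr1.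
have h : r * w x `^ c <= w y `^ c.
  apply: (@le_trans _ _ ((r * w x) `^ c)).
    rewrite powRM; [|exact: ltW|exact: ltW]; rewrite ler_wpM2r ?powR_ge0//.
    by apply: ger1_powR => //; rewrite r0.
  by apply: ge0_ler_powR; rewrite ?nnegrE//; [exact: ltW|apply: mulr_ge0; exact: ltW|exact: ltW].
by rewrite powRN ler_pdivlMr// powR_gt0.
Qed.

(* The convolution is split at [N y = r * N x]: for a short step [y] the induction hypothesis at
   [x - y] loses only the factor [(1 - r) `^ (- gam)]; a long step [y] satisfies [bg]. *)
Lemma convn_bound s : 1 < s ->
  exists2 K, 0 < K & forall n x, convn n x <= K * s ^+ n * g x.
Proof.
move=> s1; have [r [r0 r2 rs]] := powR_near1 gam0 s1.
have r1 : r <= 1 by lra.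
pose E := C1 * r `^ (- gam).
have E0 : 0 <= E by rewrite mulr_ge0// powR_ge0.
(* Chosen so that [K (1 + s) / 2 + E <= K s]: half of the gain [s - 1] pays for the long steps. *)
pose K := 1 + 2 * E / (s - 1).
have s10 : 0 < s - 1 by lra.
have K0 : 1 <= K.
  by rewrite lerDl; apply: mulr_ge0; [lra|rewrite invr_ge0; lra].
exists K; first exact: lt_le_trans K0.
elim=> [|n IH] x.
  rewrite -conv0; case: eqP => [->|_]; last by rewrite !mulr_ge0 ?powR_ge0//; lra.
  by rewrite N_0 addr0 powR1 expr0 !mulr1.
have sn0 : 1 <= s ^+ n by rewrite exprn_ege1// ltW.
pose A := K * s ^+ n * ((1 + s) / 2) * g x; pose B := E * g x.
have A0 : 0 <= A by rewrite !mulr_ge0 ?powR_ge0//; lra.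
have B0 : 0 <= B by rewrite mulr_ge0// powR_ge0.
rewrite -lee_fin convnS.
(* Each case is dominated by a multiple of [b] or of the reflected power, both of total mass 1. *)
apply: (@le_trans _ _ (hsum (fun y => A * b y + B * convn n (x - y)))).
  apply: le_hsum => y.
  have cn := convn_ge0 n (x - y).
  have [yx|xy] := leP (N y) (r * N x).
    apply: ler_wpDr; first exact: mulr_ge0.
    rewrite [leRHS]mulrC; apply: ler_wpM2l; first exact: b0.
    apply: (le_trans (IH _)); rewrite /A -[leRHS]mulrA; apply: ler_wpM2l; first by apply: mulr_ge0; lra.
    apply: (@le_trans _ _ ((1 - r) `^ (- gam) * g x)).
      by apply: g_far; [lra|apply: w_near => //; exact: ltW].
    by apply: ler_wpM2r; [exact: g0|exact: rs].
  apply: ler_wpDl; first exact: mulr_ge0.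
  apply: ler_wpM2r; first exact: cn.
  apply: (le_trans (bg y)); rewrite /B /E -mulrA; apply: ler_wpM2l; first exact: C10.
  by apply: g_far => //; apply: w_far => //; exact: ltW.
rewrite hsumD; [|by move=> y; exact: mulr_ge0|by move=> y; rewrite mulr_ge0// convn_ge0].
rewrite !hsumZ//; last by move=> y; exact: convn_ge0.
rewrite hsum_reflect hsum_convn b1 !mule1 -EFinD lee_fin /A /B -mulrDl ler_wpM2r//.
have KE : E <= K * (s - 1) / 2.
  by rewrite /K mulrDl mul1r divfK ?gt_eqF//; lra.
rewrite exprS; nra.
Qed.

Let hsum_b_moment : (hsum (fun y => (w y `^ c * b y)%R) <= (C1 * M)%:E)%E.
Proof.
rewrite EFinM; apply: le_trans (lee_wpmul2l _ gsum); last by rewrite lee_fin.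
rewrite -hsumZ//; last by move=> x; rewrite mulr_ge0 ?powR_ge0.
by apply: le_hsum => x; rewrite mulrCA ler_wpM2l ?powR_ge0.
Qed.

Let hsum_convn_moment K s n : 0 <= K -> (forall x, convn n x <= K * s ^+ n * g x) -> 0 <= s ->
  (hsum (fun y => (w y `^ c * convn n y)%R) <= (K * s ^+ n * M)%:E)%E.
Proof.
move=> K0 KE s0; have Ks : 0 <= K * s ^+ n by rewrite mulr_ge0// exprn_ge0.
rewrite EFinM; apply: le_trans (lee_wpmul2l _ gsum); last by rewrite lee_fin.
rewrite -hsumZ//; last by move=> x; rewrite mulr_ge0 ?powR_ge0.
by apply: le_hsum => x; rewrite mulrCA ler_wpM2l ?powR_ge0.
Qed.

Let trade_half x z : N x <= 2 * N z -> g x <= 2 * (w z `^ c * h x).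
Proof.
move=> xz; have := @g_trade x z 2^-1; rewrite invrK; apply.
- by rewrite invr_gt0.
- lra.
- have := N_ge0 x; lra.
Qed.

(** This half of [breg] extends to long shifts, for which [b x] itself is an error term. The other
    half does not: [x - y] may fall where [b] is large. *)
Let breg_all x y : b x <= b (x - y) + (C + 2 * C1) * (w y `^ c * h x).
Proof.
have wh : 0 <= w y `^ c * h x by rewrite mulr_ge0 ?powR_ge0.
have [yx|xy] := leP (N y) (N x / 2).
  have [_ bx] := breg yx; apply: (le_trans bx); rewrite lerD2l.
  by apply: ler_wpM2r => //; rewrite lerDl mulr_ge0.
apply: (le_trans (bg x)); apply: ler_wpDl; first exact: b0.
have gx : g x <= 2 * (w y `^ c * h x) by apply: trade_half; lra.
apply: (@le_trans _ _ (C1 * (2 * (w y `^ c * h x)))); first exact: ler_wpM2l.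
rewrite mulrA; apply: ler_wpM2r; first exact: wh.
have := C0; have := C10; lra.
Qed.

Let near_half x y r : r <= 2^-1 -> N y <= r * N x -> N x <= 2 * N (x - y).
Proof. by move=> r2 yx; have := N_B x y; have := N_ge0 x; nra. Qed.

Let le_add13 (u p1 p2 p3 p4 : R) : 0 <= p2 -> 0 <= p4 -> u <= p1 + p3 ->
  u <= p1 + p2 + (p3 + p4).
Proof. lra. Qed.

Let le_add24 (u p1 p2 p3 p4 : R) : 0 <= p1 -> 0 <= p3 -> u <= p2 + p4 ->
  u <= p1 + p2 + (p3 + p4).
Proof. lra. Qed.

Let leD_near (u1 u2 u p1 p3 p4 z : R) : u1 <= u + p1 + p3 -> u2 <= p4 ->
  u1 + u2 <= u + (p1 + 0 * z + (p3 + p4)).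
Proof. lra. Qed.

Let leD_far (u1 u2 u p1 p3 p4 z : R) : 0 <= p1 -> u1 <= p3 -> u2 <= u + p4 ->
  u1 + u2 <= u + (p1 + 0 * z + (p3 + p4)).
Proof. lra. Qed.

Let le_chain (u v p q A e : R) : v <= p + q -> q <= A -> u <= v + e -> u <= p + A + e.
Proof. lra. Qed.

(** One step [y] is convolved with n steps ending at [x - y]. If [y] is short, the n steps
    contribute about [n b(x - y)], close to [n b(x)]; if [y] is long, [b y] is close to [b x]. The
    discrepancies carry [w y^c] or [w (x - y)^c], whose means are controlled, the second through
    [convn_bound]. *)
Lemma convn_asymp s : 1 < s ->
  exists2 K, 0 < K & forall n x, `|convn n x - n%:R * b x| <= K * s ^+ n * h x.
Proof.
move=> s1; have s0 : 0 < s by lra.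
have gc0 : 0 < gam + c by rewrite addr_gt0.
have [r [r0 r2 rs]] := powR_near1 gc0 s1.
have r1 : r <= 1 by lra.
have [K1 K10 HK1] := convn_bound s1.
(* [C'] dominates the constants of all cases: regularity, long shifts, the comparison of [g y] with
   [g x], and the trade at ratio [r]. *)
pose C' := C + 2 * C1 + C1 * r `^ (- gam) * 2 + C1 * r^-1.
have rg0 : 0 <= r `^ (- gam) := powR_ge0 _ _.
have ri0 : 0 <= r^-1 by rewrite invr_ge0 ltW.
have t1 : 0 <= C1 * r `^ (- gam) * 2 by rewrite !mulr_ge0.
have t2 : 0 <= C1 * r^-1 by rewrite mulr_ge0.
have C'0 : 0 <= C' by rewrite /C'; have := C0; have := C10; lra.
have C'C : C <= C' by rewrite /C'; have := C10; lra.
have C'1 : C1 * 2 <= C' by rewrite /C'; have := C0; have := C10; lra.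
have C'2 : C + 2 * C1 <= C' by rewrite /C'; lra.
have C'3 : C1 * r `^ (- gam) * 2 <= C' by rewrite /C'; have := C0; have := C10; lra.
have C'4 : C1 * r^-1 <= C' by rewrite /C'; have := C0; have := C10; lra.
have s10 : 0 < s - 1 by lra.
have si0 : 0 <= (s - 1)^-1 by rewrite invr_ge0 ltW.
(* The two moment errors; the first comes with a factor [n], replaced by [s^n / (s - 1)]. *)
pose E := C' * (C1 * M) * (s - 1)^-1 + C' * (K1 * M).
have E0 : 0 <= E by rewrite addr_ge0 ?mulr_ge0 ?mulr_ge0// ltW.
pose K := 1 + 2 * E / (s - 1).
have K0 : 1 <= K.
  by rewrite lerDl; apply: mulr_ge0; [lra|exact: si0].
have KE : E <= K * (s - 1) / 2 by rewrite /K mulrDl mul1r divfK ?gt_eqF//; lra.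
exists K; first exact: lt_le_trans K0.
suff HB n : forall x, convn n x <= n%:R * b x + K * s ^+ n * h x /\
    n%:R * b x <= convn n x + K * s ^+ n * h x.
  by move=> n x; have [u l] := HB n x; rewrite ler_norml; apply/andP; split; lra.
elim: n => [|n IH] x.
  rewrite mul0r add0r; split.
    rewrite -conv0; case: eqP => [->|_]; last by rewrite !mulr_ge0 ?powR_ge0//; lra.
    by rewrite N_0 addr0 powR1 expr0 !mulr1.
  by rewrite addr_ge0 ?convn_ge0// !mulr_ge0 ?powR_ge0//; lra.
have sn0 : 1 <= s ^+ n by rewrite exprn_ege1// ltW.
have n0 : 0 <= n%:R :> R by exact: ler0n.
pose A := K * s ^+ n * ((1 + s) / 2) * h x.
have Ks : 0 <= K * s ^+ n by apply: mulr_ge0; lra.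
have A0 : 0 <= A.
  by apply: mulr_ge0; [apply: mulr_ge0 => //; lra|exact: powR_ge0].
(* Four profiles with controlled sums, two of mass 1 and two [w^c]-moments; every bound below is a
   combination of them. *)
pose f1 y := b y; pose f2 y := convn n (x - y).
pose f3 y := w y `^ c * b y; pose f4 y := w (x - y) `^ c * convn n (x - y).
have f10 y : 0 <= f1 y by exact: b0.
have f20 y : 0 <= f2 y by exact: convn_ge0.
have f30 y : 0 <= f3 y by rewrite mulr_ge0 ?powR_ge0.
have f40 y : 0 <= f4 y by rewrite mulr_ge0 ?powR_ge0// convn_ge0.
have S1 : hsum f1 = 1%E := b1.
have S2 : hsum f2 = 1%E by rewrite hsum_reflect hsum_convn.
have S3 : (hsum f3 <= (C1 * M)%:E)%E := hsum_b_moment.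
have S4 : (hsum f4 <= (K1 * s ^+ n * M)%:E)%E.
  rewrite /f4 (hsum_reflect (fun y => w y `^ c * convn n y)).
  by apply: hsum_convn_moment => //; exact: ltW.
have near_h y : N y <= r * N x -> h (x - y) <= (1 + s) / 2 * h x.
  move=> yx; apply: (@le_trans _ _ ((1 - r) `^ (- (gam + c)) * h x)).
    apply: powR_scaleN; [exact: ltW|lra|exact: w0|].
    by apply: w_near => //; exact: ltW.
  by apply: ler_wpM2r; [exact: h0|exact: rs].
have tot : A + n%:R * C' * h x * (C1 * M) + C' * h x * (K1 * s ^+ n * M) <= K * s ^+ n.+1 * h x.
  have -> : A + n%:R * C' * h x * (C1 * M) + C' * h x * (K1 * s ^+ n * M) =
    (K * s ^+ n * ((1 + s) / 2) + n%:R * (C' * (C1 * M)) + C' * (K1 * M) * s ^+ n) * h x.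
    by rewrite /A; ring.
  apply: ler_wpM2r; first exact: h0.
  have nl := natr_le_exp s1 n.
  have D0 : 0 <= C' * (C1 * M) by rewrite mulr_ge0// mulr_ge0.
  have : n%:R * (C' * (C1 * M)) <= (s - 1)^-1 * s ^+ n * (C' * (C1 * M)) by exact: ler_wpM2r.
  have : E * s ^+ n <= K * (s - 1) / 2 * s ^+ n by apply: ler_wpM2r => //; lra.
  rewrite /E exprS; nra.
have hs2 al be ga de : 0 <= al -> 0 <= be -> 0 <= ga -> 0 <= de ->
  (hsum (fun y => (al * f1 y + be * f2 y + (ga * f3 y + de * f4 y))%R) <=
    (al + be + (ga * (C1 * M) + de * (K1 * s ^+ n * M)))%:E)%E.
  move=> a0 be0 ga0 de0.
  have p1 y : 0 <= al * f1 y by exact: mulr_ge0.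
  have p2 y : 0 <= be * f2 y by exact: mulr_ge0.
  have p3 y : 0 <= ga * f3 y by exact: mulr_ge0.
  have p4 y : 0 <= de * f4 y by exact: mulr_ge0.
  rewrite hsumD; [|by move=> y; exact: addr_ge0|by move=> y; exact: addr_ge0].
  rewrite !hsumD// !hsumZ// S1 S2 !mule1 !EFinD leeD2l// leeD//.
    by rewrite EFinM lee_wpmul2l// lee_fin.
  by rewrite EFinM lee_wpmul2l// lee_fin.
have hx := h0 x.
have pd : 0 <= C' * h x by exact: mulr_ge0.
have pg : 0 <= n%:R * C' * h x by apply: mulr_ge0 => //; exact: mulr_ge0.
have pA : 0 <= n%:R * b x + A by apply: addr_ge0 => //; exact: mulr_ge0.
split.
- rewrite -lee_fin convnS.
  apply: (@le_trans _ _ (hsum (fun y => (n%:R * b x + A) * f1 y + b x * f2 y +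
      (n%:R * C' * h x * f3 y + C' * h x * f4 y)))).
    apply: le_hsum => y.
    have cz := f20 y; have z0 := f40 y; have y0 := f30 y; have b0y := f10 y.
    have b0x := b0 x.
    have q1 : 0 <= C' * h x * f4 y by apply: mulr_ge0 => //; exact: mulr_ge0.
    have q2 : 0 <= n%:R * C' * h x * f3 y by apply: mulr_ge0 => //; apply: mulr_ge0 => //; exact: mulr_ge0.
    have q3 : 0 <= (n%:R * b x + A) * f1 y.
      by apply: mulr_ge0 => //; apply: addr_ge0 => //; exact: mulr_ge0.
    have q4 : 0 <= b x * f2 y by exact: mulr_ge0.
    have [yx|xy] := leP (N y) (r * N x).
      have [u _] := IH (x - y).
      have [br _] : b (x - y) <= b x + C * (w y `^ c * h x) /\ b x <= b (x - y) + C * (w y `^ c * h x).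
        by apply: breg; apply: (le_trans yx); rewrite mulrC; exact: ler_wpM2l.
      apply: le_add13 => //.
      have -> : (n%:R * b x + A) * f1 y + n%:R * C' * h x * f3 y =
         b y * (n%:R * (b x + C' * (w y `^ c * h x)) + A) by rewrite /f1 /f3; ring.
      apply: ler_wpM2l; first exact: b0.
      apply: (le_trans u); apply: lerD; last first.
        by rewrite /A -[leRHS]mulrA; apply: ler_wpM2l; [exact: Ks|exact: near_h].
      apply: ler_wpM2l; first exact: n0.
      by apply: (le_trans br); rewrite lerD2l; apply: ler_wpM2r => //; apply: mulr_ge0; exact: powR_ge0.
    apply: le_add24 => //.
    have -> : b x * f2 y + C' * h x * f4 y = (b x + C' * (w (x - y) `^ c * h x)) * convn n (x - y).
      by rewrite /f2 /f4; ring.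
    apply: ler_wpM2r; first exact: cz.
    have wh : 0 <= w (x - y) `^ c * h x by rewrite mulr_ge0 ?powR_ge0.
    have [zx|xz] := leP (N (x - y)) (N x / 2).
      have [+ _] := breg zx; rewrite subKr => br; apply: (le_trans br); rewrite lerD2l.
      exact: ler_wpM2r.
    apply: ler_wpDl => //; apply: (le_trans (bg y)).
    have gy : g y <= r `^ (- gam) * g x by apply: g_far => //; apply: w_far => //; exact: ltW.
    have gx : g x <= 2 * (w (x - y) `^ c * h x) by apply: trade_half; rewrite -ler_pdivrMl// mulrC ltW.
    apply: (@le_trans _ _ (C1 * (r `^ (- gam) * (2 * (w (x - y) `^ c * h x))))).
      apply: ler_wpM2l => //; apply: (le_trans gy).
      by apply: ler_wpM2l.
    by rewrite !mulrA -[_ * h x]mulrA -[leRHS]mulrA; exact: ler_wpM2r.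
  apply: (le_trans (hs2 _ _ _ _ pA (b0 x) pg pd)).
  by rewrite lee_fin (_ : n.+1%:R * b x = n%:R * b x + b x); [lra|rewrite -natr1 mulrDl mul1r].
- pose D := A + (n%:R * C' * h x * (C1 * M) + C' * h x * (K1 * s ^+ n * M)).
  suff H : n.+1%:R * b x <= convn n.+1 x + D by apply: (le_trans H); rewrite lerD2l /D; lra.
  have b0x := b0 x.
  (* The unit masses of [f1] and [f2] spread [n b x] and the additional [b x] over [y], so that the
     lower bound is checked term by term. *)
  have H0 : (hsum (fun y => (n%:R * b x * f1 y + b x * f2 y)%R) = (n.+1%:R * b x)%:E)%E.
    rewrite hsumD; [|by move=> y; apply: mulr_ge0 => //; exact: mulr_ge0|by move=> y; exact: mulr_ge0].
    by rewrite !hsumZ ?mulr_ge0// S1 S2 !mule1 -EFinD -natr1 [in RHS]mulrDl mul1r.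
  rewrite -lee_fin -H0 EFinD convnS.
  apply: (@le_trans _ _ (hsum (fun y => b y * convn n (x - y) +
     (A * f1 y + 0 * f2 y + (n%:R * C' * h x * f3 y + C' * h x * f4 y))))); last first.
    have q0 y : 0 <= A * f1 y + 0 * f2 y + (n%:R * C' * h x * f3 y + C' * h x * f4 y).
      by apply: addr_ge0; apply: addr_ge0; apply: mulr_ge0.
    rewrite hsumD//; last by move=> y; rewrite mulr_ge0// convn_ge0.
    rewrite leeD2l//; apply: (le_trans (hs2 _ _ _ _ A0 (lexx 0) pg pd)).
    by rewrite lee_fin /D; lra.
  apply: le_hsum => y.
  have cz := f20 y; have z0 := f40 y; have y0 := f30 y; have b0y := f10 y.
  have q1 : 0 <= C' * h x * f4 y by apply: mulr_ge0 => //; exact: mulr_ge0.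
  have q2 : 0 <= n%:R * C' * h x * f3 y by apply: mulr_ge0 => //; apply: mulr_ge0 => //; exact: mulr_ge0.
  have q3 : 0 <= A * f1 y by exact: mulr_ge0.
  have q5 : 0 <= b y * convn n (x - y) by rewrite mulr_ge0.
  have wh : 0 <= w (x - y) `^ c * h x by rewrite mulr_ge0 ?powR_ge0.
  have why : 0 <= w y `^ c * h x by rewrite mulr_ge0 ?powR_ge0.
  have [yx|xy] := leP (N y) (r * N x).
    have [_ l] := IH (x - y).
    have p1 : b x * f2 y <= C' * h x * f4 y.
      have -> : C' * h x * f4 y = (C' * (w (x - y) `^ c * h x)) * f2 y by rewrite /f2 /f4; ring.
      apply: ler_wpM2r => //; apply: (le_trans (bg x)).
      have gx : g x <= 2 * (w (x - y) `^ c * h x).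
        by apply: trade_half; exact: near_half yx.
      apply: (@le_trans _ _ (C1 * (2 * (w (x - y) `^ c * h x)))); first exact: ler_wpM2l.
      by rewrite mulrA; exact: ler_wpM2r.
    apply: leD_near => //.
    have -> : b y * convn n (x - y) + A * f1 y + n%:R * C' * h x * f3 y =
      b y * (convn n (x - y) + A + n%:R * (C' * (w y `^ c * h x))) by rewrite /f1 /f3; ring.
    rewrite mulrC; apply: ler_wpM2l => //.
    have br : n%:R * b x <= n%:R * b (x - y) + n%:R * (C' * (w y `^ c * h x)).
      rewrite -mulrDr; apply: ler_wpM2l => //; apply: (le_trans (breg_all x y)).
      by rewrite lerD2l; exact: ler_wpM2r.
    have hA : K * s ^+ n * h (x - y) <= A.
      by rewrite /A -[leRHS]mulrA; apply: ler_wpM2l; [exact: Ks|exact: near_h].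
    exact: le_chain l hA br.
  have p1 : n%:R * b x * f1 y <= n%:R * C' * h x * f3 y.
    have -> : n%:R * C' * h x * f3 y = n%:R * (C' * (w y `^ c * h x)) * f1 y by rewrite /f1 /f3; ring.
    apply: ler_wpM2r => //; apply: ler_wpM2l => //; apply: (le_trans (bg x)).
    have gx : g x <= r^-1 * (w y `^ c * h x).
      by apply: g_trade => //; apply: w_far => //; exact: ltW.
    apply: (@le_trans _ _ (C1 * (r^-1 * (w y `^ c * h x)))); first exact: ler_wpM2l.
    by rewrite (mulrA C1); exact: ler_wpM2r.
  apply: leD_far => //.
  have -> : b y * convn n (x - y) + C' * h x * f4 y =
    (b y + C' * (w (x - y) `^ c * h x)) * f2 y by rewrite /f2 /f4; ring.
  apply: ler_wpM2r => //; have := breg_all x (x - y); rewrite subKr => br.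
  by apply: (le_trans br); rewrite lerD2l; exact: ler_wpM2r.
Qed.

(** * A lower bound for the powers *)

Hypothesis N_D : forall x y, N (x - y) <= N x + N y.
Variables (v0 : V) (c2 : R).
Hypothesis c20 : 0 < c2.
Hypothesis glow : forall u, c2 * g u <= b 0 * b u + b v0 * b (u - v0).

(** Markov's inequality: the [w^c]-moment is at most [T], so [w <= L = (2T)^(1/c)] with probability
    at least 1/2, and there [g] is at least [L^(-gam)]. *)
Let hsum_g_convn (K s : R) n : 0 < K -> 0 < s -> (forall x, convn n x <= K * s ^+ n * g x) ->
  (((2 * K * (M + 1) * s ^+ n) `^ (- (gam / c)) / 2)%:E <= hsum (fun z => (g z * convn n z)%R))%E.
Proof.
move=> K0 s0 HK; have sn : 0 < s ^+ n by rewrite exprn_gt0.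
pose T := K * (M + 1) * s ^+ n.
have T0 : 0 < T by rewrite /T !mulr_gt0//; have := M0; lra.
pose L := (2 * T) `^ c^-1; have L0 : 0 < L by rewrite powR_gt0; lra.
have Lc : L `^ (- c) = (2 * T)^-1.
  by rewrite powRN -powRrM mulVf ?gt_eqF// powRr1//; lra.
have m0 z : 0 <= w z `^ c * convn n z by rewrite mulr_ge0 ?powR_ge0// convn_ge0.
have q0 z : 0 <= g z * convn n z by rewrite mulr_ge0// convn_ge0.
set G := hsum _.
have G0 : (0 <= G)%E by exact: hsum_ge0.
have G1 : G \is a fin_num.
  rewrite ge0_fin_numE// (@le_lt_trans _ _ 1%E) ?ltry// -(hsum_convn n).
  apply: le_hsum => z; apply: ler_piMl; first exact: convn_ge0.
  rewrite -[leRHS](powRr0 (w z)); apply: ler_powR; first exact: w1.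
  by rewrite oppr_le0 ltW.
have mom : (hsum (fun z => (w z `^ c * convn n z)%R) <= T%:E)%E.
  apply: le_trans (hsum_convn_moment (ltW K0) HK (ltW s0)) _.
  rewrite lee_fin /T; have := M0 => M0'; have : 0 <= K * s ^+ n by rewrite mulr_ge0// ltW.
  nra.
have : (1 <= L `^ gam * fine G + (2 * T)^-1 * T)%R.
  rewrite -lee_fin EFinD !EFinM fineK// -(hsum_convn n).
  apply: (@le_trans _ _ (hsum (fun z => L `^ gam * (g z * convn n z) +
     (2 * T)^-1 * (w z `^ c * convn n z)))).
    apply: le_hsum => z; have cz := convn_ge0 n z.
    have i0 : 0 <= (2 * T)^-1 by rewrite invr_ge0; lra.
    have [zL|Lz] := leP (w z) L.
      apply: ler_wpDr; first exact: mulr_ge0.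
      rewrite mulrA; apply: ler_peMl => //.
      by rewrite powRN ler_pdivlMr ?powR_gt0// mul1r ge0_ler_powR ?nnegrE//; exact: ltW.
    apply: ler_wpDl; first by rewrite mulr_ge0 ?powR_ge0.
    rewrite mulrA; apply: ler_peMl => //.
    have Lc0 : 0 < L `^ c by exact: powR_gt0.
    rewrite -Lc powRN ler_pdivlMl// mulr1; apply: ge0_ler_powR; rewrite ?nnegrE; exact: ltW.
  rewrite hsumD; [|by move=> z; rewrite mulr_ge0 ?powR_ge0|by move=> z; rewrite mulr_ge0// invr_ge0; lra].
  have i0 : 0 <= (2 * T)^-1 by rewrite invr_ge0; lra.
  by rewrite !hsumZ ?powR_ge0// leeD2l// lee_wpmul2l// lee_fin.
have -> : (2 * T)^-1 * T = 2^-1 by field; rewrite gt_eqF.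
move=> H; rewrite -(fineK G1) lee_fin.
have -> : (2 * K * (M + 1) * s ^+ n) `^ (- (gam / c)) = (L `^ gam)^-1.
  rewrite -powRN /L -powRrM; congr (_ `^ _); [by rewrite /T; ring|by rewrite mulrN mulrC].
rewrite mulrC ler_pdivrMr ?powR_gt0//; lra.
Qed.

(** After n steps the walk sits at [z] with the mean of [g z] bounded below. Two more steps lead
    from [z] to [x] with probability of order [g (x - z)], which is at least [g x * g z] since
    [w (x - z) <= w x * w z]. *)
Lemma convn_lower s : 1 < s ->
  exists2 K, 0 < K & forall n x, K * g x <= s ^+ n * convn n.+2 x.
Proof.
(* The exponent [-(gam / c)] of the Markov bound turns [s'^n] into [s^(-n)]. *)
move=> s1; pose s' := s `^ (c / gam).
have s0 : 0 < s by lra.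
have cg0 : 0 < c / gam by rewrite divr_gt0.
have s'1 : 1 < s'.
  have := @gt0_ltr_powR R _ cg0 1 s; rewrite powR1; apply => //; rewrite nnegrE; lra.
have [K1 K10 HK1] := convn_bound s'1.
pose D := (2 * K1 * (M + 1)) `^ (- (gam / c)) / 2.
have KM0 : 0 < 2 * K1 * (M + 1) by rewrite !mulr_gt0//; have := M0; lra.
have D0 : 0 < D by rewrite divr_gt0// powR_gt0.
exists (c2 * D / 2); first by rewrite divr_gt0// mulr_gt0.
move=> n x.
have := @hsum_g_convn K1 s' n K10 (lt_trans ltr01 s'1) (HK1 n).
have sn : 0 < s ^+ n by rewrite exprn_gt0.
have -> : (2 * K1 * (M + 1) * s' ^+ n) `^ (- (gam / c)) / 2 = D / s ^+ n.
  rewrite powRM ?exprn_ge0//; [|exact: ltW|lra].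
  rewrite -powR_mulrn; [|lra]; rewrite -!powRrM.
  have -> : c / gam * (n%:R * - (gam / c)) = - n%:R.
    by field; rewrite !gt_eqF.
  by rewrite powR_invn /D; [ring|lra].
move=> HG.
have B1 : c2 * g x * (D / s ^+ n) <= b 0 * convn n.+1 x + b v0 * convn n.+1 (x - v0).
  rewrite -lee_fin EFinM.
  have k0 : 0 <= c2 * g x by rewrite mulr_ge0// ltW.
  apply: (@le_trans _ _ ((c2 * g x)%:E * hsum (fun z => (g z * convn n z)%R))%E).
    by rewrite lee_wpmul2l// lee_fin.
  rewrite -hsumZ//; last by move=> z; rewrite mulr_ge0// convn_ge0.
  rewrite EFinD !EFinM !convnS' -!hsumZ//; try by move=> z; rewrite mulr_ge0// convn_ge0.
  rewrite -hsumD; try by move=> z; rewrite mulr_ge0// mulr_ge0// convn_ge0.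
  apply: le_hsum => z; have cz := convn_ge0 n z.
  have gg : g x * g z <= g (x - z).
    rewrite -powRM; [|exact: ltW|exact: ltW].
    apply: ler_powRN; [exact: ltW|exact: w0|].
    have := N_D x z; have := N_ge0 x; have := N_ge0 z; nra.
  have := glow (x - z); rewrite (_ : x - z - v0 = x - v0 - z); last by rewrite addrAC.
  move=> gl; rewrite !mulrA -mulrDl; apply: ler_wpM2r => //.
  apply: le_trans gl; rewrite -mulrA; apply: ler_wpM2l => //; exact: ltW.
have B2 y : b y * convn n.+1 (x - y) <= convn n.+2 x.
  rewrite -lee_fin (convnS n.+1 x); apply: (@hsum_ge_term _ _ (fun y => b y * convn n.+1 (x - y))).
  by move=> z; rewrite mulr_ge0// convn_ge0.
have B20 := B2 0; rewrite subr0 in B20; have B2v := B2 v0.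
have : c2 * g x * (D / s ^+ n) <= 2 * convn n.+2 x by lra.
rewrite mulrA ler_pdivrMr//; lra.
Qed.

End Convolution.


(** * Summability of powers over the lattice *)

Section Summability.
Context {R : realType}.
Implicit Types (q s kappa : R).

Lemma sum_powRN_nat s n : 0 < s ->
  \sum_(k < n) (1 + k%:R : R) `^ (- (1 + s)) <= 1 + s^-1.
Proof.
move=> s0; have si : 0 <= s^-1 by rewrite invr_ge0 ltW.
case: n => [|n]; first by rewrite big_ord0; lra.
(* The subtracted term is the tail of the integral of [x^(-1-s)]; with it the induction closes. *)
suff : \sum_(k < n.+1) (1 + k%:R : R) `^ (- (1 + s)) <= 1 + s^-1 * (1 - n.+1%:R `^ (- s)).
  by move=> /le_trans; apply; rewrite lerD2l ler_piMr// gerBl powR_ge0.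
elim: n => [|n IH].
  by rewrite big_ord1 addr0 !powR1 subrr mulr0 addr0.
rewrite big_ord_recr /=; apply: (le_trans (lerD IH (lexx _))).
rewrite -addrA lerD2l -lerBrDl -mulrBr mulrC ler_pdivlMr//.
have n1 : 0 < n.+1%:R :> R by rewrite ltr0n.
have n2 : 0 < n.+2%:R :> R by rewrite ltr0n.
have -> : 1 + n.+1%:R = n.+2%:R :> R by rewrite nat1r.
have E : n.+2%:R = n.+1%:R + 1 :> R by rewrite natr1.
have -> : n.+1%:R `^ (- s) = n.+2%:R `^ (- s) * (n.+1%:R / n.+2%:R) `^ (- s).
  by rewrite -powRM ?divr_ge0// ?ler0n// mulrCA divff ?gt_eqF// mulr1.
have -> : n.+2%:R `^ (- (1 + s)) = n.+2%:R `^ (- s) * n.+2%:R^-1.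
  have -> : - (1 + s) = - s + - 1 by ring.
  rewrite powRD; last by rewrite (gt_eqF n2) implybT.
  by rewrite powR_inv1// ler0n.
have r0 : 0 < n.+1%:R / n.+2%:R :> R by rewrite divr_gt0.
have : n.+2%:R^-1 * s <= (n.+1%:R / n.+2%:R) `^ (- s) - 1 :> R.
  rewrite /powR gt_eqF// lerBrDl; apply: le_trans (expR_ge1Dx _).
  rewrite lerD2l mulNr mulrC -mulrN ler_pM2l//.
  have -> : n.+1%:R / n.+2%:R = 1 + - n.+2%:R^-1 :> R.
    rewrite -[X in X / _](addrK 1) -E mulrBl divff ?gt_eqF// mul1r//.
  rewrite lerNr; apply: le_ln1Dx; rewrite ltrN2 invf_lt1// ltr1n//.
have p0 : 0 <= n.+2%:R `^ (- s) :> R by exact: powR_ge0.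
move=> /(ler_wpM2l p0); rewrite mulrBr mulr1 mulrA => /le_trans; apply.
set u := _ * _ `^ _; set v := _ `^ _; lra.
Qed.

Lemma hsum_powRN_int s : 0 < s ->
  (hsum (fun k : int => ((1 + `|k|%:~R : R) `^ (- (1 + s)))%R) <= (2 * (1 + s^-1))%:E)%E.
Proof.
move=> s0; pose f (k : int) : R := (1 + `|k|%:~R) `^ (- (1 + s)).
have f0 k : (0 <= (f k)%:E)%E by rewrite lee_fin powR_ge0.
rewrite /hsum (esumID (range Posz))//.
rewrite mulr_natl mulr2n EFinD; apply: leeD.
- rewrite setTI (reindex_esum [set: nat] _ Posz)//; last first.
    by split => [x _|x y _ _ []|]//=; by exists x.
  rewrite -nneseries_esumT//; apply: lime_le; first exact: is_cvg_nneseries.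
  apply: nearW => n; rewrite sumEFin lee_fin big_mkord; exact: sum_powRN_nat.
- rewrite setTI (reindex_esum [set: nat] _ Negz)//; last first.
    split => [x _ []//|x y _ _ []//|[x|x] H]; [by case: H; exists x|by exists x].
  rewrite -nneseries_esumT//; apply: lime_le; first exact: is_cvg_nneseries.
  apply: nearW => n; rewrite sumEFin lee_fin big_mkord; apply: le_trans (sum_powRN_nat n s0).
  apply: ler_sum => k _; apply: ler_powRN; [lra|by rewrite ltr_pwDl|].
  rewrite lerD2l /=; rewrite ler_nat; exact: leqnSn.
Qed.

Lemma hsum_prod (f : int -> R) (S : R) d : (forall k, 0 <= f k) -> (hsum f <= S%:E)%E ->
  (hsum (fun x : 'rV[int]_d => (\prod_(i < d) f (x 0%R i))%R) <= (S ^+ d)%:E)%E.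
Proof.
move=> f0 fS; have S0 : 0 <= S by rewrite -lee_fin; apply: le_trans fS; exact: hsum_ge0.
elim: d => [|d IH].
  rewrite /hsum (_ : [set: 'rV[int]_0] = [set 0]); last first.
    by apply/seteqP; split => // x _; rewrite /= [x]thinmx0.
  by rewrite esum_set1 ?lee_fin ?big_ord0// expr0.
have p0 e (x : 'rV[int]_e) : 0 <= \prod_(i < e) f (x 0 i) by exact: prodr_ge0.
rewrite /hsum (reindex_esum ([set: int] `*`` (fun=> [set: 'rV[int]_d])) _
   (fun z => row_mx (const_mx z.1) z.2 : 'rV[int]_(1 + d)))//; last first.
  split => //= [[j x] [k y] _ _ /= /eq_row_mx[/matrixP/(_ 0 0) + ->]|x _].
    by rewrite !mxE => ->.
  exists (lsubmx (x : 'rV_(1 + d)) 0 0, rsubmx (x : 'rV_(1 + d))) => //=.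
  rewrite -[RHS]hsubmxK; congr row_mx.
  by apply/matrixP => i j; rewrite !ord1 !mxE.
have E j (x : 'rV[int]_d) : \prod_(i < d.+1) f ((row_mx (const_mx j) x : 'rV_(1 + d)) 0 i) =
    f j * \prod_(i < d) f (x 0 i).
  rewrite (@big_split_ord _ _ _ 1 d) /= big_ord1 row_mxEl mxE; congr (_ * _).
  by apply: eq_bigr => i _; rewrite row_mxEr.
under eq_esum do rewrite E.
rewrite -(esum_esum (a := fun j (x : 'rV[int]_d) => (f j * \prod_(i < d) f (x 0 i))%:E)); last first.
  by move=> j x; rewrite lee_fin mulr_ge0.
under eq_esum => j _.
  rewrite -/(hsum (fun x : 'rV[int]_d => (f j * \prod_(i < d) f (x 0%R i))%R)) hsumZ//.
  over.
apply: (@le_trans _ _ (\esum_(j in [set: int]) ((S ^+ d * f j)%:E))%E).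
  apply: le_esum => j _; rewrite mulrC EFinM lee_wpmul2l//.
  by rewrite lee_fin.
rewrite -/(hsum (fun j => S ^+ d * f j)) hsumZ ?exprn_ge0// exprSr EFinM.
by rewrite lee_wpmul2l// lee_fin exprn_ge0.
Qed.

Lemma abs_le_lnorm d (x : 'rV[int]_d) i : `|x 0 i|%:~R <= lnorm R x.
Proof.
rewrite intr_norm -sqrtr_sqr /lnorm /enorm; apply: ler_wsqrtr.
rewrite (bigD1 i)//= mxE lerDl; apply: sumr_ge0 => j _; exact: sqr_ge0.
Qed.

(** Every [|x_i|] is at most [|x|], so the summand is bounded by a product over the coordinates,
    each with the summable exponent [1 + kappa / d]. *)
Lemma lattice_sum d kappa : (0 < d)%N -> 0 < kappa ->
  exists M : R, (hsum (fun x : 'rV[int]_d => ((1 + lnorm R x) `^ (- (d%:R + kappa)))%R) <= M%:E)%E.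
Proof.
move=> d0 k0; pose s := kappa / d%:R.
have dR : 0 < d%:R :> R by rewrite ltr0n.
have s0 : 0 < s by rewrite divr_gt0.
exists ((2 * (1 + s^-1)) ^+ d).
apply: le_trans (hsum_prod d _ (hsum_powRN_int s0)); last by move=> k; exact: powR_ge0.
apply: le_hsum => x.
have l0 := lnorm_ge0 (R := R) x.
have -> : - (d%:R + kappa) = - (1 + s) * d%:R.
  by rewrite mulNr mulrDl mul1r divfK ?gt_eqF.
rewrite powRrM powR_mulrn ?powR_ge0//.
rewrite -[X in _ ^+ X]card_ord -prodr_const; apply: ler_prod => i _.
rewrite powR_ge0/=; apply: ler_powRN; [lra| |by rewrite lerD2l abs_le_lnorm].
by rewrite ltr_pwDl// ler0z.
Qed.

End Summability.


(** * Smooth functions on the sphere are Lipschitz *)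

Section SphereLipschitz.
Context {R : realType}.
Implicit Types d : nat.

Lemma lipschitz_of_derivable (phi : R -> R) L a b : a <= b ->
  (forall t, a <= t <= b -> derivable phi t 1 /\ `|'D_1 phi t| <= L) ->
  `|phi b - phi a| <= L * (b - a).
Proof.
move=> ab H; have [->|nab] := eqVneq a b; first by rewrite !subrr normr0 mulr0.
have {nab} ab' : a < b by rewrite lt_neqAle nab.
have [] := @MVT R phi (fun t => 'D_1 phi t) a b ab'.
- move=> x; rewrite in_itv /= => /andP[/ltW ax /ltW xb].
  by apply: DeriveDef => //; have [] := H x; rewrite ?ax.
- apply: derivable_within_continuous => x; rewrite in_itv /= => axb.
  by have [] := H x.
- move=> c; rewrite in_itv /= => /andP[/ltW ac /ltW cb] ->.
  rewrite normrM (ger0_norm (x := b - a)) ?subr_ge0//.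
  by apply: ler_wpM2r; [rewrite subr_ge0|have [] := H c; rewrite ?ac].
Qed.

Lemma derivable_line d (g : 'rV[R]_d -> R) (x v : 'rV[R]_d) (t : R) :
  derivable g (x + t *: v) v ->
  derivable (fun s : R => g (x + s *: v)) t 1 /\
  'D_1 (fun s : R => g (x + s *: v)) t = 'D_v g (x + t *: v).
Proof.
have E : (fun h : R => h^-1 *: ((fun s : R => g (x + s *: v)) (h *: 1 + t) - g (x + t *: v))) =
    (fun h : R => h^-1 *: (g (h *: v + (x + t *: v)) - g (x + t *: v))).
  apply/funext => h; congr (_ *: (g _ - _)).
  by rewrite (_ : h *: 1 = h); [rewrite scalerDl addrCA|exact: mulr1].
by rewrite /derivable /derive /= !E.
Qed.

Definition upd d (x : 'rV[R]_d) (i : 'I_d) (t : R) : 'rV[R]_d :=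
  x + (t - x 0 i) *: delta_mx 0 i.

Lemma updE d (x : 'rV[R]_d) i t j : upd x i t 0 j = if j == i then t else x 0 j.
Proof.
rewrite !mxE eqxx /=; case: eqP => [->|_]; first by rewrite mulr1 subrKC.
by rewrite mulr0 addr0.
Qed.

Lemma lipschitz_upd d (g : 'rV[R]_d -> R) (A : set 'rV[R]_d) L (i : 'I_d) :
  (forall x : 'rV[R]_d, A x -> derivable g x (delta_mx 0 i) /\ `|'D_(delta_mx 0 i) g x| <= L) ->
  forall (x : 'rV[R]_d) t, (forall s, Num.min (x 0 i) t <= s <= Num.max (x 0 i) t -> A (upd x i s)) ->
  `|g (upd x i t) - g x| <= L * `|t - x 0 i|.
Proof.
move=> H x t seg; pose v : 'rV[R]_d := delta_mx 0 i.
pose phi (s : R) := g (x + s *: v).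
have Hphi s : Num.min 0 (t - x 0 i) <= s <= Num.max 0 (t - x 0 i) ->
    derivable phi s 1 /\ `|'D_1 phi s| <= L.
  move=> sP; have xs : x + s *: v = upd x i (s + x 0 i) by rewrite /upd addrK.
  have [] := H (x + s *: v).
    rewrite xs; apply: seg; move: sP.
    by rewrite !ge_min !le_max; lra.
  by move=> /derivable_line[? E] b; split => //; rewrite E.
have E1 : g (upd x i t) = phi (t - x 0 i) by [].
have E0 : g x = phi 0 by rewrite /phi scale0r addr0.
rewrite E1 E0; have [le|/ltW le] := leP 0 (t - x 0 i).
  have := @lipschitz_of_derivable phi L _ _ le; rewrite subr0 (ger0_norm le); apply => s sP.
  by apply: Hphi; rewrite min_l// max_r.
have := @lipschitz_of_derivable phi L _ _ le.
rewrite distrC sub0r (ler0_norm le); apply => s sP.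
by apply: Hphi; rewrite min_r// max_l.
Qed.

Lemma abs_le_enorm d (x : 'rV[R]_d) i : `|x 0 i| <= enorm x.
Proof.
rewrite -sqrtr_sqr /enorm; apply: ler_wsqrtr.
by rewrite (bigD1 i)//= lerDl; apply: sumr_ge0 => j _; exact: sqr_ge0.
Qed.

(** The coordinates of [x] are exchanged for those of [y] one at a time, so partial derivatives
    suffice. A box contains all the intermediate points, which a Euclidean ball need not. *)
Lemma lipschitz_box d (g : 'rV[R]_d -> R) (c : 'rV[R]_d) (r L : R) : 0 <= L ->
  (forall (i : 'I_d) (x : 'rV[R]_d), (forall j, `|x 0 j - c 0 j| < r) ->
     derivable g x (delta_mx 0 i) /\ `|'D_(delta_mx 0 i) g x| <= L) ->
  forall x y : 'rV[R]_d, (forall j, `|x 0 j - c 0 j| < r) -> (forall j, `|y 0 j - c 0 j| < r) ->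
  `|g y - g x| <= d%:R * L * enorm (y - x).
Proof.
move=> L0 H x y xr yr.
pose u k : 'rV[R]_d := \row_j (if (j < k)%N then y 0 j else x 0 j).
have ux : u 0%N = x by apply/rowP => j; rewrite mxE.
have uy : u d = y by apply/rowP => j; rewrite mxE ltn_ord.
suff K k : (k <= d)%N -> `|g (u k) - g x| <= k%:R * L * enorm (y - x).
  by have := K _ (leqnn d); rewrite uy.
elim: k => [_|k IH kd]; first by rewrite ux subrr normr0 !mul0r.
have uS : u k.+1 = upd (u k) (Ordinal kd) (y 0 (Ordinal kd)).
  apply/rowP => j; rewrite updE !mxE ltnS leq_eqVlt.
  have -> : (nat_of_ord j == k) = (j == Ordinal kd) by [].
  by case: eqP => [->|].
have -> : g (u k.+1) - g x = (g (u k.+1) - g (u k)) + (g (u k) - g x) by rewrite subrKA.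
apply: (le_trans (ler_normD _ _)); rewrite -natr1 mulrDl mulrDl mul1r addrC.
apply: lerD; first by apply: IH; exact: ltnW.
have ukd : u k 0 (Ordinal kd) = x 0 (Ordinal kd) by rewrite mxE ltnn.
rewrite uS; apply: (@le_trans _ _ (L * `|y 0 (Ordinal kd) - u k 0 (Ordinal kd)|)).
  apply: (lipschitz_upd (H (Ordinal kd))) => s.
  rewrite ukd => /andP[sm sM] j; rewrite updE; case: eqP => [->|_]; last first.
    by rewrite mxE; case: ifP.
  have := xr (Ordinal kd); have := yr (Ordinal kd).
  rewrite !ltr_norml => /andP[y1 y2] /andP[x1 x2].
  move: sm sM; rewrite ge_min le_max => /orP[?|?] /orP[?|?]; apply/andP; split; lra.
rewrite ukd; apply: ler_wpM2l => //.
by have := abs_le_enorm (y - x) (Ordinal kd); rewrite !mxE.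
Qed.

Lemma closed_sphere d : closed (sphere R d).
Proof.
have -> : sphere R d = (fun x : 'rV[R]_d => enorm x) @^-1` [set 1] by [].
apply: closed_comp => [x _|]; last exact: closed_eq.
apply: (@continuous_comp _ _ _ (fun x : 'rV[R]_d => \sum_i x 0 i ^+ 2) Num.sqrt); last exact: sqrt_continuous.
apply: (@cvg_big _ _ +%R); [exact: add_continuous|exact: nbhs_filter|] => i _.
have ci : (fun y : 'rV[R]_d => y 0 i) @ x --> x 0 i by exact: coord_continuous.
exact: (cvgM ci ci).
Qed.

Lemma compact_sphere d : compact (sphere R d).
Proof.
have := @rV_compact R d (fun=> `[-1, 1]%classic) (fun=> @segment_compact R (-1) 1).
move=> cube; apply: (subclosed_compact _ cube); first exact: closed_sphere.
move=> x /= x1 i; rewrite in_itv /= -ler_norml -x1; exact: abs_le_enorm.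
Qed.

Lemma Ck_continuous d k U (f : 'rV[R]_d -> R) : Ck k U f ->
  forall x, U x -> {for x, continuous f}.
Proof. by case: k => [|k] []. Qed.

(** Local extensions have locally bounded partial derivatives; compactness gives one constant [B]
    for all pairs closer than [1/B]. For the other pairs boundedness is enough. *)
Lemma Ck_sphere_lipschitz d k (f : 'rV[R]_d -> R) : Ck_sphere k.+1 f ->
  exists2 L : R, 0 < L & forall s s', sphere R d s -> sphere R d s' ->
    `|f s| <= L /\ `|f s - f s'| <= L * enorm (s - s').
Proof.
move=> Cf.
pose P (B : R) (s : 'rV[R]_d) := sphere R d s -> `|f s| <= B /\
  forall s', sphere R d s' -> enorm (s - s') < B^-1 -> `|f s - f s'| <= B * enorm (s - s').
have : \forall B \near +oo, sphere R d `<=` P B.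
  apply: (proj1 (compact_near_coveringP _)) => [|s0 /Cf[U [g [oU Us0 [gc Dg] fg]]]].
    exact: compact_sphere.
  have gs0 : \forall s \near s0, `|g s| <= `|g s0| + 1.
    have := gc _ Us0 => /cvgr_dist_lt/(_ _ (ltr01 : 0 < (1 : R))).
    apply: filterS => s; rewrite distrC => h.
    have : `|g s| <= `|g s0| + `|g s - g s0|.
      by rewrite -{1}(subrK (g s0) (g s)) addrC ler_normD.
    lra.
  pose L := 1 + \sum_i `|'D_(delta_mx 0 i) g s0|.
  have L0 : 0 <= L by rewrite addr_ge0// sumr_ge0.
  have Ds0 : \forall s \near s0, forall i, `|'D_(delta_mx 0 i) g s| <= L.
    suff Ds i : \forall s \near s0, `|'D_(delta_mx 0 i) g s| <= L.
      exact: (@filter_forall _ _ _ (nbhs s0) _ Ds).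
    have [_ /Ck_continuous Dc] := Dg i.
    have := Dc _ Us0 => /cvgr_dist_lt/(_ _ (ltr01 : 0 < (1 : R))).
    apply: filterS => s; rewrite distrC => h.
    have : `|'D_(delta_mx 0 i) g s| <= `|'D_(delta_mx 0 i) g s0| + `|'D_(delta_mx 0 i) g s - 'D_(delta_mx 0 i) g s0|.
      by rewrite -{1}(subrK ('D_(delta_mx 0 i) g s0) ('D_(delta_mx 0 i) g s)) addrC ler_normD.
    have : `|'D_(delta_mx 0 i) g s0| <= \sum_i `|'D_(delta_mx 0 i) g s0|.
      by rewrite (bigD1 i)//= lerDl sumr_ge0.
    rewrite /L; lra.
  have Us : \forall s \near s0, U s by exact: open_nbhs_nbhs.
  have [r /= r0 Hr] := (nbhs_ballP _ _).1 (filterI (filterI gs0 Ds0) Us).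
  have box (x : 'rV[R]_d) : (forall j, `|x 0 j - s0 0 j| < r) ->
     [/\ `|g x| <= `|g s0| + 1, (forall i, `|'D_(delta_mx 0 i) g x| <= L) & U x].
    move=> xr; have [|[? ?] ?] := Hr x; last by split.
    by split => // i j; rewrite !ord1 /ball /= distrC.
  have lip x y := @lipschitz_box d g s0 r L L0 (fun i x xr =>
     conj (let: And3 _ _ Ux := box x xr in (Dg i).1 x Ux)
          (let: And3 _ Dx _ := box x xr in Dx i)) x y.
  (* [B] exceeds the local bound and the local Lipschitz constant, and [1/B < r/2] keeps [s'] in the
     box around [s0]. *)
  exists (ball s0 (r / 2), [set B | `|g s0| + 1 + d%:R * L + 2 / r < B]).
    split; first by apply: nbhsx_ballx; rewrite divr_gt0.
    by apply: nbhs_pinfty_gt; rewrite num_real.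
  move=> [s B] /= [sr HB] sS.
  have dL0 : 0 <= d%:R * L by rewrite mulr_ge0.
  have r20 : 0 < 2 / r by rewrite divr_gt0.
  have gs00 := normr_ge0 (g s0).
  have B0 : 0 < B by lra.
  have sr2 j : `|s 0 j - s0 0 j| < r / 2 by have [_ /(_ 0 j)] := sr; rewrite /ball /= distrC.
  have srr j : `|s 0 j - s0 0 j| < r by apply: (lt_le_trans (sr2 j)); lra.
  have [gs _ Us1] := box s srr.
  rewrite fg//; split; first by lra.
  move=> s' s'S ss'.
  have B2 : B^-1 <= r / 2.
    rewrite -[r / 2]invrK invf_div lef_pV2 ?posrE//; lra.
  have s'r j : `|s' 0 j - s0 0 j| < r.
    have := abs_le_enorm (s - s') j; rewrite !mxE => h.
    have -> : s' 0 j - s0 0 j = (s' 0 j - s 0 j) + (s 0 j - s0 0 j) by rewrite subrKA.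
    apply: (le_lt_trans (ler_normD _ _)); rewrite distrC; have := sr2 j; lra.
  have [_ _ Us'] := box s' s'r.
  rewrite (fg s')//; apply: (le_trans (lip s' s s'r srr)).
  by apply: ler_wpM2r; [exact: enorm_ge0|lra].
move=> [B0 [_ HB]]; pose B := Num.max B0 0 + 1.
have B1 : 0 < B by rewrite ltr_wpDl// le_max lexx orbT.
have {}HB : sphere R d `<=` P B by apply: HB; rewrite /B ltr_pwDr// le_max lexx.
(* The term [2 B^2] serves pairs at distance at least [1/B], where values differ by at most
   [2 B]. *)
exists (2 * B ^+ 2 + B) => [|s s' sS s'S].
  by rewrite ltr_wpDl// mulr_ge0// sqr_ge0.
have [fs fss'] := HB s sS sS; have [fs' _] := HB s' s'S s'S.
have e0 := enorm_ge0 (s - s').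
split; first by have := sqr_ge0 B; lra.
have [lt|ge] := ltP (enorm (s - s')) B^-1.
  apply: (le_trans (fss' _ s'S lt)); apply: ler_wpM2r => //.
  by have := sqr_ge0 B; lra.
apply: (@le_trans _ _ (2 * B)).
  by apply: (le_trans (ler_normB _ _)); lra.
have : 1 <= B * enorm (s - s') by rewrite -(mulfV (x := B)) ?gt_eqF// ler_pM2l.
nra.
Qed.

End SphereLipschitz.


(** * Regularity of a kernel with a homogeneous leading tail *)

Section RegularTail.
Context {R : realType} {d : nat}.
Local Notation V := 'rV[int]_d.
Local Notation N := (@lnorm R d).
Local Notation w x := (1 + lnorm R x).
Implicit Types x y z : V.

Lemma ldir_sphere z : 0 < N z -> sphere R d (ldir R z).
Proof.
move=> z0; rewrite /sphere /= enormZ ger0_norm ?invr_ge0 ?lnorm_ge0//.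
by rewrite mulVf ?gt_eqF.
Qed.

Lemma ldir_lipschitz x y : 0 < N x -> 0 < N (x - y) ->
  enorm (ldir R (x - y) - ldir R x) <= 2 * (N y / N x).
Proof.
move=> x0 xy0.
have -> : ldir R (x - y) - ldir R x =
    (N x)^-1 *: (- latt y) + ((N (x - y))^-1 - (N x)^-1) *: latt (x - y).
  have E : latt x = latt (x - y) + latt y :> 'rV[R]_d by rewrite -latticeD subrK.
  by rewrite /ldir E scalerDr scalerN scalerBl opprD addrA [RHS]addrC.
apply: (le_trans (enormD _ _)); rewrite !enormZ enormN.
have -> : (N (x - y))^-1 - (N x)^-1 = (N x - N (x - y)) / (N x * N (x - y)).
  by field; rewrite !gt_eqF.
rewrite (ger0_norm (x := (N x)^-1)); last by rewrite invr_ge0 ltW.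
rewrite normrM normfV (ger0_norm (x := N x * _)); last by rewrite mulr_ge0// ltW.
have h : `|N x - N (x - y)| <= N y.
  rewrite ler_norml; have := lnormB (R := R) x y; have := lerB_lnorm (R := R) x (x - y).
  by rewrite subKr; lra.
have -> : `|N x - N (x - y)| / (N x * N (x - y)) * enorm (latt (x - y) : 'rV[R]_d) = `|N x - N (x - y)| / N x.
  by rewrite -/(N (x - y)) invfM mulrA divfK ?gt_eqF.
rewrite -/(N y) (mulrC _^-1) mulr2n mulrDl !mul1r lerD2l.
by apply: ler_wpM2r => //; rewrite invr_ge0 ltW.
Qed.

(** With [q = u / v <= 1] this reads [1 - q^p <= n (1 - q)]; as [q^n <= q^p], Bernoulli's inequality
    for the integer [n] suffices. *)
Lemma powRN_diff (p u v : R) (n : nat) : 0 <= p <= n%:R -> 0 < u -> u <= v ->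
  u `^ (- p) - v `^ (- p) <= u `^ (- p) * (n%:R * ((v - u) / v)).
Proof.
move=> /andP[p0 pn] u0 uv; have v0 := lt_le_trans u0 uv.
have r0 : 0 < u / v by rewrite divr_gt0.
have -> : v `^ (- p) = u `^ (- p) * (u / v) `^ p.
  have -> : u `^ (- p) = (u / v) `^ (- p) * v `^ (- p).
    by rewrite -powRM ?(ltW r0) ?(ltW v0)// divfK// lt0r_neq0.
  by rewrite mulrAC -powRD ?addNr ?powRr0 ?mul1r// lt0r_neq0 ?implybT.
rewrite -[X in X - _]mulr1 -mulrBr; apply: ler_wpM2l; first exact: powR_ge0.
have r1 : u / v <= 1 by rewrite ler_pdivrMr// mul1r.
have rn : (u / v) ^+ n <= (u / v) `^ p.
  by rewrite -powR_mulrn ?(ltW r0)//; apply: ger_powR => //; rewrite r0.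
have bern : 1 - n%:R * (1 - u / v) <= (u / v) ^+ n.
  elim: {pn rn} n => [|m IH]; first by rewrite mul0r subr0 expr0.
  rewrite exprS -natr1; have : (u / v) ^+ m <= 1 by apply: exprn_ile1 => //; exact: ltW.
  have : 0 <= m%:R :> R by exact: ler0n.
  move: (u / v) r0 r1 IH => q q0 q1 IH m0 qm.
  have := ler_wpM2l (ltW q0) IH; nra.
have -> : (v - u) / v = 1 - u / v by rewrite mulrBl mulfV ?gt_eqF.
lra.
Qed.

Lemma powRN_shift p z : 0 <= p -> 1 <= N z -> N z `^ (- p) <= 2^-1 `^ (- p) * w z `^ (- p).
Proof.
move=> p0 z1; have l0 := lnorm_ge0 (R := R) z.
by apply: powR_scaleN => //; lra.
Qed.

Variables (b : V -> R) (gam c L del C r0 : R) (f : 'rV[R]_d -> R).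
Hypotheses (gam0 : 0 < gam) (c0 : 0 < c) (c1 : c <= 1).
Hypotheses (L0 : 0 <= L) (del0 : 0 < del) (C0 : 0 <= C) (r01 : 1 <= r0).
Hypotheses (b0 : forall x, 0 <= b x) (b1 : forall x, b x <= 1) (bpos : 0 < b 0).
Hypothesis b_tail : forall z, r0 <= N z ->
  `|b z - f (ldir R z) * N z `^ (- gam)| <= C * N z `^ (- (gam + 1)).
Hypothesis f_le : forall s, sphere R d s -> `|f s| <= L.
Hypothesis f_ge : forall s, sphere R d s -> del <= f s.
Hypothesis f_lip : forall s s', sphere R d s -> sphere R d s' ->
  `|f s - f s'| <= L * enorm (s - s').

Local Notation g x := ((1 + lnorm R x) `^ (- gam)).
Local Notation h x := ((1 + lnorm R x) `^ (- (gam + c))).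

Let w1 x : 1 <= w x. Proof. by rewrite lerDl lnorm_ge0. Qed.
Let w0 x : 0 < w x. Proof. exact: lt_le_trans (w1 x). Qed.
Let wc1 x : 1 <= w x `^ c.
Proof. by rewrite -[leLHS](powRr0 (w x)) ler_powR// ltW. Qed.

Let near_ge p x r : 0 <= p -> N x <= r -> 1 <= (1 + r) `^ p * w x `^ (- p).
Proof.
move=> p0 xr; rewrite powRN ler_pdivlMr ?powR_gt0// mul1r.
have x0 := lnorm_ge0 (R := R) x.
by apply: ge0_ler_powR; rewrite ?nnegrE; lra.
Qed.

Let powS x : 0 < N x -> N x `^ (- (gam + 1)) = N x `^ (- gam) * (N x)^-1.
Proof.
move=> x0; rewrite (_ : - (gam + 1) = - gam + - 1); last by ring.
rewrite powRD; last by rewrite (gt_eqF x0) implybT.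
by rewrite powR_inv1// ltW.
Qed.

Lemma tail_le : exists2 C1, 0 <= C1 & forall x, b x <= C1 * g x.
Proof.
pose A := (L + C) * 2^-1 `^ (- gam); pose B := (1 + r0) `^ gam.
have A0 : 0 <= A by rewrite mulr_ge0 ?powR_ge0// addr_ge0.
have B0 : 0 <= B by exact: powR_ge0.
exists (A + B) => [|x]; first exact: addr_ge0.
have g0 : 0 <= g x by exact: powR_ge0.
rewrite mulrDl; have [xr|rx] := ltP (N x) r0.
  apply: ler_wpDl; first exact: mulr_ge0.
  by apply: (le_trans (b1 x)); apply: near_ge; exact: ltW.
apply: ler_wpDr; first exact: mulr_ge0.
have x1 : 1 <= N x by exact: le_trans rx.
have x0 : 0 < N x by exact: lt_le_trans x1.
have := b_tail rx; rewrite ler_norml powS// => /andP[_ bx].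
have fx := ler_normlP _ _ (f_le (ldir_sphere x0)).
have G0 : 0 <= N x `^ (- gam) by exact: powR_ge0.
have iv : (N x)^-1 <= 1 by rewrite invf_le1.
have s1 : f (ldir R x) * N x `^ (- gam) <= L * N x `^ (- gam) by apply: ler_wpM2r => //; case: fx.
have s2 : C * (N x `^ (- gam) * (N x)^-1) <= C * N x `^ (- gam).
  by apply: ler_wpM2l => //; apply: ler_piMr.
rewrite /A -mulrA; apply: (@le_trans _ _ ((L + C) * N x `^ (- gam))); first by lra.
by apply: ler_wpM2l; [exact: addr_ge0|apply: powRN_shift => //; exact: ltW].
Qed.

Lemma tail_ge : exists c3 r1, [/\ 0 < c3, 1 <= r1 & forall x, r1 <= N x -> c3 * g x <= b x].
Proof.
(* Beyond this radius the relative error [C / |x|] takes at most half of [del]. *)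
exists (del / 2), (r0 + 2 * C / del); split; first by rewrite divr_gt0.
  by apply: ler_wpDr => //; rewrite !mulr_ge0// invr_ge0 ltW.
move=> x xr; have Cd : 0 <= 2 * C / del by rewrite !mulr_ge0// invr_ge0 ltW.
have rx : r0 <= N x by lra.
have x1 : 1 <= N x by exact: le_trans rx.
have x0 : 0 < N x by exact: lt_le_trans x1.
have := b_tail rx; rewrite ler_norml powS// => /andP[bx _].
have fx := f_ge (ldir_sphere x0).
have G0 : 0 <= N x `^ (- gam) by exact: powR_ge0.
have s1 : del * N x `^ (- gam) <= f (ldir R x) * N x `^ (- gam) by exact: ler_wpM2r.
have s2 : C * (N x `^ (- gam) * (N x)^-1) <= del / 2 * N x `^ (- gam).
  rewrite (mulrC (N x `^ _)) mulrA; apply: ler_wpM2r => //.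
  rewrite ler_pdivrMr//.
  have : 2 * C / del <= N x by have := r01; lra.
  by rewrite ler_pdivrMr//; lra.
apply: (@le_trans _ _ (del / 2 * N x `^ (- gam))); last by lra.
apply: ler_wpM2l; first by rewrite divr_ge0// ltW.
by apply: ler_powRN; [exact: ltW|exact: x0|lra].
Qed.

Let b_dist x y : `|b x - b y| <= 1.
Proof.
have := b0 x; have := b0 y; have := b1 x; have := b1 y; rewrite ler_norml; lra.
Qed.

Let far_norms x y : N y <= N x / 2 -> 2 * r0 <= N x ->
  [/\ 0 < N x, 0 < N (x - y), r0 <= N x, r0 <= N (x - y) & w y <= N x].
Proof.
have := r01; have := lerB_lnorm (R := R) x y; have := lnorm_ge0 (R := R) y.
by move=> *; split; lra.
Qed.

Let near_norms x y : N y <= N x / 2 ->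
  [/\ 2^-1 * N x <= N (x - y), N (x - y) - N x <= N y & N x - N (x - y) <= N y].
Proof.
have := lerB_lnorm (R := R) x y; have := lnorm_ge0 (R := R) y.
have := lnormB (R := R) x y.
by move=> *; split; lra.
Qed.

Let dist3 (u v p q e1 e2 e3 : R) : `|u - p| <= e1 -> `|v - q| <= e2 -> `|p - q| <= e3 ->
  `|u - v| <= e1 + e2 + e3.
Proof. by rewrite !ler_norml; lra. Qed.

Let half_powN p : 0 <= p -> 1 <= (2^-1 : R) `^ (- p).
Proof.
move=> p0; rewrite -[leLHS](powRr0 (2^-1 : R)); apply: ger_powR; first lra.
by rewrite oppr_le0.
Qed.

Let powRN_dist (u v D : R) n : gam <= n%:R -> 0 < u -> 0 < v -> 2^-1 * v <= u -> `|v - u| <= D ->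
  `|u `^ (- gam) - v `^ (- gam)| <= 2^-1 `^ (- gam) * v `^ (- gam) * (n%:R * (2 * (D / v))).
Proof.
move=> gn u0 v0 vu uvD; have D0 := le_trans (normr_ge0 _) uvD.
have gn' : 0 <= gam <= n%:R by rewrite gn ltW.
have v2 : 0 <= v `^ (- gam) by exact: powR_ge0.
have v3 : 0 <= u `^ (- gam) by exact: powR_ge0.
have [uv|/ltW vu'] := leP u v.
  have uH : u `^ (- gam) <= 2^-1 `^ (- gam) * v `^ (- gam).
    by apply: powR_scaleN => //; exact: ltW.
  rewrite ger0_norm; last by rewrite subr_ge0; apply: ler_powRN => //; exact: ltW.
  apply: (le_trans (powRN_diff gn' u0 uv)).
  have uvv : 0 <= (v - u) / v by rewrite divr_ge0 ?subr_ge0// ltW.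
  apply: ler_pM => //; first exact: mulr_ge0.
  apply: ler_wpM2l => //; apply: (@le_trans _ _ (D / v)).
    apply: ler_wpM2r; first by rewrite invr_ge0 ltW.
    by apply: le_trans uvD; exact: ler_norm.
  by apply: ler_peMl; [rewrite divr_ge0// ltW|lra].
rewrite distrC ger0_norm; last by rewrite subr_ge0; apply: ler_powRN => //; exact: ltW.
apply: (le_trans (powRN_diff gn' v0 vu')).
have uvu : 0 <= (u - v) / u by rewrite divr_ge0 ?subr_ge0// ltW.
apply: ler_pM => //; first exact: mulr_ge0.
  by apply: ler_peMl => //; apply: half_powN; exact: ltW.
apply: ler_wpM2l => //; apply: (@le_trans _ _ (D / v)).
  apply: ler_pM; [by rewrite subr_ge0|by rewrite invr_ge0 ltW| |by rewrite lef_pV2].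
  by apply: le_trans uvD; rewrite distrC; exact: ler_norm.
by apply: ler_peMl; [rewrite divr_ge0// ltW|lra].
Qed.

(** A product rule: the direction and the power of the norm each change by an amount of relative
    order [w y / N x]. *)
Let tail_decay x y n : gam <= n%:R -> N y <= N x / 2 -> 2 * r0 <= N x ->
  `|f (ldir R (x - y)) * N (x - y) `^ (- gam) - f (ldir R x) * N x `^ (- gam)| <=
    2 * L * 2^-1 `^ (- gam) * (1 + n%:R) * (N x `^ (- gam) * (w y / N x)).
Proof.
move=> gn yx rx; have [x0 xy0 _ _ _] := far_norms yx rx.
have [lo u1 u2] := near_norms yx.
set G := N x `^ (- gam); have G0 : 0 <= G by exact: powR_ge0.
set H := 2^-1 `^ (- gam); have H0 : 0 <= H by exact: powR_ge0.
have Nw : N y <= w y by rewrite lerDr.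
have uw : `|N x - N (x - y)| <= w y.
  by apply: le_trans Nw; rewrite ler_norml lerNl opprB u1 u2.
have wN : 0 <= w y / N x by rewrite divr_ge0 ?ltW.
have flip : `|f (ldir R (x - y)) - f (ldir R x)| <= L * (2 * (w y / N x)).
  apply: (le_trans (f_lip (ldir_sphere xy0) (ldir_sphere x0))).
  apply: ler_wpM2l => //; apply: (le_trans (ldir_lipschitz x0 xy0)).
  by apply: ler_wpM2l => //; apply: ler_wpM2r; rewrite ?invr_ge0 ?(ltW x0).
have dpow := powRN_dist gn xy0 x0 lo uw.
have GH : N (x - y) `^ (- gam) <= H * G by apply: powR_scaleN => //; exact: ltW.
have -> : f (ldir R (x - y)) * N (x - y) `^ (- gam) - f (ldir R x) * G =
  (f (ldir R (x - y)) - f (ldir R x)) * N (x - y) `^ (- gam) + f (ldir R x) * (N (x - y) `^ (- gam) - G).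
  by rewrite mulrBl mulrBr addrA subrK.
have -> : 2 * L * H * (1 + n%:R) * (G * (w y / N x)) =
    L * (2 * (w y / N x)) * (H * G) + L * (H * G * (n%:R * (2 * (w y / N x)))).
  by move: (w y / N x) => q; ring.
apply: (le_trans (ler_normD _ _)); apply: lerD; rewrite normrM.
  rewrite (ger0_norm (powR_ge0 _ _)); apply: ler_pM; [exact: normr_ge0|exact: powR_ge0|exact: flip|exact: GH].
by apply: ler_pM => //; exact: f_le (ldir_sphere x0).
Qed.

(** The ratio [w y / N x] is at most 1, so its power with exponent [c <= 1] is larger. *)
Let trade_pow x y : 0 < N x -> w y <= N x ->
  N x `^ (- gam) * (w y / N x) <= w y `^ c * N x `^ (- (gam + c)).
Proof.
move=> x0 wx; rewrite opprD powRD; last by rewrite (gt_eqF x0) implybT.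
rewrite [leRHS]mulrCA; apply: ler_wpM2l; first exact: powR_ge0.
have -> : w y `^ c * N x `^ (- c) = (w y / N x) `^ c.
  have wN : 0 <= w y / N x by rewrite divr_ge0// ltW.
  rewrite powRN -{1}(divfK (lt0r_neq0 x0) (w y)) (powRM c wN (ltW x0)) mulfK//.
  by rewrite gt_eqF// powR_gt0.
apply: ger1_powR => //; rewrite divr_gt0//=.
by rewrite ler_pdivrMr// mul1r.
Qed.

Lemma tail_reg : exists2 C2, 0 <= C2 & forall x y, N y <= N x / 2 ->
  b (x - y) <= b x + C2 * (w y `^ c * h x) /\ b x <= b (x - y) + C2 * (w y `^ c * h x).
Proof.
have [n gn] : exists n : nat, gam <= n%:R.
  by exists (Num.bound gam); apply/ltW/archi_boundP; exact: ltW.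
pose H := 2^-1 `^ (- gam); have H0 : 0 <= H by exact: powR_ge0.
pose A := C * (2 * H) + C + 2 * L * H * (1 + n%:R).
have A0 : 0 <= A by rewrite !addr_ge0// !mulr_ge0// addr_ge0.
pose A' := A * 2^-1 `^ (- (gam + c)).
have A'0 : 0 <= A' by rewrite mulr_ge0 ?powR_ge0.
pose B := (1 + 2 * r0) `^ (gam + c).
have B0 : 0 <= B by exact: powR_ge0.
exists (A' + B) => [|x y yx]; first exact: addr_ge0.
suff : `|b (x - y) - b x| <= (A' + B) * (w y `^ c * h x).
  rewrite ler_norml => /andP[? ?].
  by split; rewrite -lerBlDl// -opprB lerNl.
have h0 : 0 <= h x by exact: powR_ge0.
have gc0 : 0 <= gam + c by rewrite addr_ge0 ?ltW.
have wh := ler_peMl h0 (wc1 y).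
have wh0 := le_trans h0 wh.
rewrite mulrDl; have [/ltW xr|rx] := ltP (N x) (2 * r0).
  apply: ler_wpDl; first exact: mulr_ge0.
  apply: (@le_trans _ _ (B * h x)); last exact: ler_wpM2l.
  by apply: le_trans (near_ge gc0 xr).
apply: ler_wpDr; first exact: mulr_ge0.
have [x0 xy0 rx1 rxy wx] := far_norms yx rx; have [lo _ _] := near_norms yx.
have G0 : 0 <= N x `^ (- gam) by exact: powR_ge0.
have Gw : N x `^ (- gam) * (N x)^-1 <= N x `^ (- gam) * (w y / N x).
  apply: ler_wpM2l => //; apply: ler_peMl; [by rewrite invr_ge0 ltW|exact: w1].
have e1 : C * N x `^ (- (gam + 1)) <= C * (N x `^ (- gam) * (w y / N x)).
  by apply: ler_wpM2l => //; rewrite powS.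
have e2 : C * N (x - y) `^ (- (gam + 1)) <= C * (2 * H) * (N x `^ (- gam) * (w y / N x)).
  rewrite -[leRHS]mulrA; apply: ler_wpM2l => //; rewrite powS//.
  apply: (@le_trans _ _ (2 * H * (N x `^ (- gam) * (N x)^-1))); last first.
    by apply: ler_wpM2l => //; exact: mulr_ge0.
  have -> : 2 * H * (N x `^ (- gam) * (N x)^-1) = (H * N x `^ (- gam)) * (2^-1 * N x)^-1.
    by rewrite invfM invrK (mulrC 2 H) !mulrA (mulrAC H 2).
  apply: ler_pM; [exact: powR_ge0|by rewrite invr_ge0 ltW| |].
    by apply: powR_scaleN => //; exact: ltW.
  by rewrite lef_pV2// posrE mulr_gt0.
have fin := dist3 (b_tail rxy) (b_tail rx1) (tail_decay gn yx rx).
apply: (le_trans fin).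
apply: (@le_trans _ _ (A * (N x `^ (- gam) * (w y / N x)))).
  rewrite /A [leRHS]mulrDl; apply: lerD => //.
  by rewrite [leRHS]mulrDl; exact: lerD.
rewrite /A' -[leRHS]mulrA; apply: ler_wpM2l => //.
apply: (le_trans (trade_pow x0 wx)); rewrite [leRHS]mulrCA; apply: ler_wpM2l; first exact: powR_ge0.
by apply: powRN_shift => //; exact: le_trans rx1.
Qed.

(** A far [u] is reached by resting at 0 and then stepping by [u]. The remaining [u] form a bounded
    set, which subtraction of the long vector [v0] moves into the range where the tail is
    positive. *)
Lemma tail_split : (0 < d)%N -> exists (v0 : V) c2, 0 < c2 /\
  forall u, c2 * g u <= b 0 * b u + b v0 * b (u - v0).
Proof.
move=> d0; have [c3 [r1 [c30 r11 Hr]]] := tail_ge.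
(* Norm at least [2 r1], so that [|u - v0| >= r1] whenever [|u| < r1]. *)
pose v0 : V := const_mx (Num.bound (2 * r1))%:Z.
have Nv0 : 2 * r1 <= N v0.
  have := abs_le_lnorm (R := R) v0 (Ordinal d0); rewrite mxE => /(le_trans _); apply.
  by rewrite ger0_norm// -pmulrn; apply/ltW/archi_boundP; lra.
have bv0 : 0 < b v0.
  by apply: lt_le_trans (Hr v0 _); [rewrite mulr_gt0 ?powR_gt0|lra].
pose k := c3 * (1 + r1 + N v0) `^ (- gam).
have k0 : 0 < k by rewrite mulr_gt0// powR_gt0//; have := lnorm_ge0 (R := R) v0; lra.
exists v0, (Num.min (b 0 * c3) (b v0 * k)); split.
  by rewrite lt_min; apply/andP; split; exact: mulr_gt0.
move=> u; have gu : 0 <= g u by exact: powR_ge0.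
have p1 : 0 <= b 0 * b u by exact: mulr_ge0.
have p2 : 0 <= b v0 * b (u - v0) by exact: mulr_ge0.
have [ru|ur] := leP r1 (N u).
  apply: ler_wpDr => //; apply: (@le_trans _ _ (b 0 * c3 * g u)).
    by apply: ler_wpM2r => //; rewrite ge_min lexx.
  by rewrite -mulrA; apply: ler_wpM2l; [exact: ltW|exact: Hr].
apply: ler_wpDl => //; apply: (@le_trans _ _ (b v0 * k)).
  apply: (@le_trans _ _ (b v0 * k * g u)).
    by apply: ler_wpM2r => //; rewrite ge_min lexx orbT.
  apply: ler_piMr; first by rewrite mulr_ge0// ltW.
  by rewrite -[leRHS](powRr0 (w u)); apply: ler_powR => //; rewrite oppr_le0 ltW.
apply: ler_wpM2l; first exact: ltW.
have uv1 := lnormB (R := R) u v0.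
have uv2 : N v0 - N u <= N (u - v0).
  by have := lerB_lnorm (R := R) v0 u; rewrite -(lnormN (v0 - u)) opprB.
apply: (@le_trans _ _ (c3 * g (u - v0))); last by apply: Hr; lra.
apply: ler_wpM2l; first exact: ltW.
by apply: ler_powRN; [exact: ltW|exact: w0|lra].
Qed.

End RegularTail.


(** * Poisson sums *)

Section PoissonSeries.
Context {R : realType}.

Lemma hsum_delta (T : countType) (m : T) (u : R) : 0 <= u ->
  hsum (fun n => (n == m)%:R * u) = u%:E.
Proof.
move=> u0; rewrite /hsum -(@esum_set1 _ _ m (fun=> u%:E)) ?lee_fin// [RHS]esum_mkcond.
by apply: eq_esum => y _ /=; rewrite in_set1; case: eqP; rewrite ?mul1r ?mul0r.
Qed.

Lemma hsum_nat_lim (u : nat -> R) (l : R) : (forall n, 0 <= u n) ->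
  (fun n => \sum_(k < n) u k) @ \oo --> l -> hsum u = l%:E.
Proof.
move=> u0 ul; rewrite /hsum -nneseries_esumT; last by move=> n; rewrite lee_fin.
rewrite -(cvg_lim _ ul)// -EFin_lim; last by apply/cvg_ex; exists l.
by apply/congr_lim/funext => n /=; rewrite sumEFin big_mkord.
Qed.

Let cvg_expR (y : R) : (fun n => \sum_(k < n) y ^+ k / k`!%:R) @ \oo --> expR y.
Proof.
have := @is_cvg_series_exp_coeff R y; rewrite -/(expR y).
rewrite (_ : series _ = fun n => \sum_(k < n) y ^+ k / k`!%:R)//.
by apply/funext => n; rewrite /series /= big_mkord.
Qed.

Lemma poisson_mass (y : R) : 0 <= y ->
  hsum (fun n : nat => y ^+ n / n`!%:R) = (expR y)%:E.
Proof.
move=> y0; apply: hsum_nat_lim => [n|]; last exact: cvg_expR.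
by rewrite divr_ge0// exprn_ge0.
Qed.

Lemma poisson_mean (y : R) : 0 <= y ->
  hsum (fun n : nat => n%:R * (y ^+ n / n`!%:R)) = (y * expR y)%:E.
Proof.
move=> y0; apply: hsum_nat_lim => [n|].
  by rewrite mulr_ge0// divr_ge0// exprn_ge0.
rewrite -cvg_shiftS /=.
rewrite (_ : (fun n => \sum_(k < n.+1) k%:R * (y ^+ k / k`!%:R)) = fun n => y * \sum_(k < n) y ^+ k / k`!%:R).
  by apply: cvgMr; exact: cvg_expR.
apply/funext => n; rewrite big_ord_recl mul0r add0r mulr_sumr; apply: eq_bigr => k _.
rewrite lift0 factS natrM exprS.
have k1 : k.+1%:R != 0 :> R by rewrite pnatr_eq0.
rewrite invfM; move: (y ^+ k) (k`!%:R^-1) => p q.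
by rewrite (mulrCA (y * p)) mulVKf// mulrA.
Qed.

End PoissonSeries.

(** * The first moment as a Poisson mixture of convolution powers *)

Section Kernel.
Context {disp : measure_display} {Omega : measurableType disp} {R : realType}.
Context {P : probability Omega R} {d : nat} {a : 'rV[int]_d -> R} {nu : R}.
Variable X : branching_walk P a nu.
Hypotheses (nu0 : 0 < nu) (a0 : forall z, 0 <= a z) (a1 : hsum a = 1%E).
Implicit Types (x y : 'rV[int]_d).

Definition kern x : R := ((x == 0)%:R * (2 * nu) + a x) / (1 + 2 * nu).
Let lam : R := 1 + 2 * nu.

Let lam0 : 0 < lam. Proof. by have := nu0; rewrite /lam; lra. Qed.
Let nu2 : 0 <= 2 * nu. Proof. by have := nu0; lra. Qed.

Lemma kern_ge0 x : 0 <= kern x.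
Proof. by rewrite divr_ge0 ?addr_ge0 ?mulr_ge0// ?ltW. Qed.

Lemma kern0_gt0 : 0 < kern 0.
Proof. by rewrite /kern divr_gt0// eqxx mul1r ltr_pwDl// mulr_gt0. Qed.

Lemma kern_neq0 x : x != 0 -> kern x = a x / lam.
Proof. by move=> /negbTE x0; rewrite /kern x0 mul0r add0r. Qed.

Lemma hsum_kern : hsum kern = 1%E.
Proof.
rewrite (@eq_hsum _ _ _ (fun x => lam^-1 * ((x == 0)%:R * (2 * nu) + a x))); last first.
  by move=> x; rewrite mulrC.
have p0 x : 0 <= (x == 0)%:R * (2 * nu) by exact: mulr_ge0.
rewrite hsumZ ?invr_ge0 ?ltW//; last by move=> x; rewrite addr_ge0.
by rewrite hsumD// hsum_delta// a1 -EFinD -EFinM addrC mulVf// gt_eqF.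
Qed.

(** The recursion of [mass] is convolution with [lam * kern], whose atom at 0 holds the splittings;
    it also shows that the masses are finite. *)
Lemma massE k x : @mass R d a nu k x = (lam ^+ k * convn kern k x)%:E.
Proof.
elim: k x => [|k IH] x; first by rewrite expr0 mul1r /=; case: eqP.
have c0 := convn_ge0 kern_ge0 hsum_kern k.
have l0 : 0 <= lam ^+ k by rewrite exprn_ge0// ltW.
rewrite EFinM (convnS kern_ge0 hsum_kern) -hsumZ//; last first.
- by move=> y; rewrite mulr_ge0// kern_ge0.
- by rewrite exprn_ge0// ltW.
rewrite (@eq_hsum _ _ _ (fun y => (y == 0)%:R * (2 * nu * (lam ^+ k * convn kern k x)) +
    a y * (lam ^+ k * convn kern k (x - y)))); last first.
  move=> y; rewrite exprS mulrACA mulrA -[lam * kern y]mulrC /kern divfK ?gt_eqF//.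
  have [->|_] := eqVneq y 0; first by rewrite subr0; ring.
  by rewrite !mul0r !add0r mulrA.
rewrite hsumD; first last.
- by move=> y; apply: mulr_ge0 => //; exact: mulr_ge0.
- by move=> y; apply: mulr_ge0 => //; apply: mulr_ge0 => //; exact: mulr_ge0.
have u0 : 0 <= 2 * nu * (lam ^+ k * convn kern k x) by apply: mulr_ge0 => //; exact: mulr_ge0.
rewrite (hsum_delta _ u0) EFinM -IH; congr (_ + _)%E.
by apply: eq_esum => y _; rewrite -/(mass k (x - y)) IH EFinM.
Qed.

(** The Poisson law of mean [lam t] times [e^(nu t)], the expected size of the population. *)
Let pois t n : R := expR (- (1 + nu) * t) * ((lam * t) ^+ n / n`!%:R).

Lemma m1_hsum t x : 0 <= t -> m1 X t x = hsum (fun n => pois t n * convn kern n x).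
Proof.
move=> t0; rewrite (m1_series X nu0 a0)//.
rewrite /hsum -nneseries_esumT; last first.
  move=> n; rewrite lee_fin !mulr_ge0 ?expR_ge0 ?invr_ge0 ?exprn_ge0//.
    by rewrite mulr_ge0// ltW.
  by apply: (convn_ge0 kern_ge0 hsum_kern).
apply: eq_eseriesr => n _; rewrite massE /gammaw t0 subr0 -EFinM /pois exprMn.
by congr (_%:E); ring.
Qed.

Let pois_ge0 t n : 0 <= t -> 0 <= pois t n.
Proof.
move=> t0; rewrite !mulr_ge0 ?expR_ge0 ?invr_ge0 ?exprn_ge0//.
by rewrite mulr_ge0// ltW.
Qed.

Let hsum_pois t (s : R) : 0 <= t -> 0 <= s ->
  hsum (fun n => pois t n * s ^+ n) = (expR ((nu + lam * (s - 1)) * t))%:E.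
Proof.
move=> t0 s0; have y0 : 0 <= s * (lam * t) by rewrite !mulr_ge0// ltW.
rewrite (@eq_hsum _ _ _ (fun n => expR (- (1 + nu) * t) * ((s * (lam * t)) ^+ n / n`!%:R))); last first.
  by move=> n; rewrite /pois !exprMn; ring.
rewrite hsumZ ?expR_ge0//; last by move=> n; rewrite divr_ge0// exprn_ge0.
rewrite poisson_mass// -EFinM -expRD; congr (expR _)%:E.
by rewrite /lam; ring.
Qed.

Let hsum_pois_mean t : 0 <= t ->
  hsum (fun n => pois t n * n%:R) = (lam * t * expR (nu * t))%:E.
Proof.
move=> t0; have y0 : 0 <= lam * t by rewrite !mulr_ge0// ltW.
rewrite (@eq_hsum _ _ _ (fun n => expR (- (1 + nu) * t) * (n%:R * ((lam * t) ^+ n / n`!%:R)))); last first.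
  by move=> n; rewrite /pois; ring.
rewrite hsumZ ?expR_ge0//; last by move=> n; rewrite mulr_ge0// divr_ge0// exprn_ge0.
rewrite poisson_mean// -EFinM mulrCA -expRD; congr (_ * expR _)%:E.
by rewrite /lam; ring.
Qed.

Lemma m1_asymp (s K H t : R) x : 0 <= t -> 0 <= s -> 0 <= K * H ->
  (forall n, `|convn kern n x - n%:R * kern x| <= K * s ^+ n * H) ->
  exists2 m : R, m1 X t x = m%:E &
    `|m - lam * t * expR (nu * t) * kern x| <= K * H * expR ((nu + lam * (s - 1)) * t).
Proof.
move=> t0 s0 KH cK.
have cn n := convn_ge0 kern_ge0 hsum_kern n x.
have p0 n := pois_ge0 n t0.
have sn n : 0 <= s ^+ n by exact: exprn_ge0.
have kx := kern_ge0 x.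
set D := lam * t * expR (nu * t) * kern x; set F := K * H * expR _.
have S1 : hsum (fun n => kern x * (pois t n * n%:R)) = D%:E.
  by rewrite hsumZ// ?hsum_pois_mean// -?EFinM 1?mulrC// => n; rewrite mulr_ge0.
have S2 : hsum (fun n => K * H * (pois t n * s ^+ n)) = F%:E.
  by rewrite hsumZ// ?hsum_pois// => n; rewrite mulr_ge0.
have pK n : 0 <= kern x * (pois t n * n%:R) by rewrite mulr_ge0// mulr_ge0.
have pH n : 0 <= K * H * (pois t n * s ^+ n) by rewrite mulr_ge0// mulr_ge0.
have pc n : 0 <= pois t n * convn kern n x by exact: mulr_ge0.
have m0 : (0 <= m1 X t x)%E.
  by rewrite m1_hsum//; apply: hsum_ge0 => n; rewrite mulr_ge0.
have up : (m1 X t x <= (D + F)%:E)%E.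
  rewrite EFinD -S1 -S2 -hsumD//.
  rewrite m1_hsum//; apply: le_hsum => n.
  rewrite mulrCA (mulrCA (K * H)) -mulrDr; apply: ler_wpM2l => //.
  by have := cK n; rewrite ler_norml => /andP[_]; lra.
have lo : (D%:E <= m1 X t x + F%:E)%E.
  rewrite -S1 -S2 m1_hsum// -hsumD//.
  apply: le_hsum => n.
  rewrite mulrCA (mulrCA (K * H)) -mulrDr; apply: ler_wpM2l => //.
  by have := cK n; rewrite ler_norml => /andP[+ _]; lra.
have fm : m1 X t x \is a fin_num by rewrite ge0_fin_numE// (le_lt_trans up)// ltry.
exists (fine (m1 X t x)); first by rewrite fineK.
rewrite -(fineK fm) in up lo; move: up lo; rewrite -EFinD !lee_fin ler_norml; lra.
Qed.

(** The hypothesis says nothing of the terms n = 0 and n = 1; a bound for their share of the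
    generating function is subtracted. *)
Lemma m1_lower (s K H t : R) x : 0 <= t -> 1 <= s -> 0 <= K * H ->
  (forall n, K * H <= s ^+ n * convn kern n.+2 x) ->
  ((K * H * (expR ((nu + lam * (s^-1 - 1)) * t) - expR (- (1 + nu) * t) * (1 + lam * t)))%:E
     <= m1 X t x)%E.
Proof.
move=> t0 s1 KH cK; have s0 : 0 < s by lra.
have cn n := convn_ge0 kern_ge0 hsum_kern n x.
have p0 n := pois_ge0 n t0.
have i0 : 0 <= s^-1 by rewrite invr_ge0 ltW.
have i1 : s^-1 <= 1 by rewrite invf_le1.
have sn n : 0 <= s^-1 ^+ n by exact: exprn_ge0.
have sn1 n : s^-1 ^+ n <= 1 by exact: exprn_ile1.
have S2 : hsum (fun n => K * H * (pois t n * s^-1 ^+ n)) = (K * H * expR ((nu + lam * (s^-1 - 1)) * t))%:E.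
  by rewrite hsumZ// ?hsum_pois// => n; rewrite mulr_ge0.
have q1 m : 0 <= K * H * pois t m by exact: mulr_ge0.
have q0 (m n : nat) : 0 <= (n == m)%:R * (K * H * pois t m) by exact: mulr_ge0.
have := @le_hsum R nat (fun n => K * H * (pois t n * s^-1 ^+ n))
  (fun n => pois t n * convn kern n x +
     ((n == 0)%:R * (K * H * pois t 0) + (n == 1)%:R * (K * H * pois t 1))).
rewrite S2 hsumD; [|by move=> n; exact: mulr_ge0|by move=> n; exact: addr_ge0].
rewrite hsumD// !hsum_delta// -m1_hsum//.
rewrite -EFinD.
have -> : K * H * pois t 0 + K * H * pois t 1 = K * H * (expR (- (1 + nu) * t) * (1 + lam * t)).
  by rewrite /pois expr0 expr1 fact0 factS fact0 muln1 divr1 divr1; ring.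
rewrite (mulrBr (K * H)) EFinB leeBlDr//; apply => -[|[|n]].
- rewrite -[(0 == 0)%N]/true -[(0 == 1)%N]/false expr0 mulr1 mul1r mul0r addr0 lerDr; exact: mulr_ge0.
- rewrite -[(1 == 0)%N]/false -[(1 == 1)%N]/true mul0r add0r mul1r; apply: ler_wpDl; first exact: mulr_ge0.
  by apply: ler_wpM2l => //; apply: ler_piMr.
rewrite -[(n.+2 == 0)%N]/false -[(n.+2 == 1)%N]/false !mul0r !addr0 mulrCA; apply: ler_wpM2l => //.
(* The hypothesis carries [s^n] against the power [n + 2]; the surplus [s^(-2)] is at most 1. *)
have := cK n; rewrite -ler_pdivrMl ?exprn_gt0// -exprVn mulrC; apply: le_trans.
rewrite -addn2 exprD mulrA; apply: ler_piMr => //; exact: mulr_ge0.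
Qed.

End Kernel.


(** * Asymptotics of the first moment and of the front *)

Section FirstMoment.
Context {disp : measure_display} {Omega : measurableType disp} {R : realType}.
Context {P : probability Omega R} {d : nat} {a : 'rV[int]_d -> R} {nu : R}.
Variable X : branching_walk P a nu.
Hypotheses (d0 : (0 < d)%N) (nu0 : 0 < nu) (a0 : forall z, 0 <= a z) (a1 : hsum a = 1%E).
Local Notation N := (@lnorm R d).
Local Notation w x := (1 + lnorm R x).
Implicit Types x e : 'rV[int]_d.

Variables (gam c M L del C r0 : R) (f : 'rV[R]_d -> R).
Hypotheses (gam1 : 1 <= gam) (c0 : 0 < c) (c1 : c <= 1).
Hypotheses (L0 : 0 <= L) (del0 : 0 < del) (C0 : 0 <= C) (r01 : 1 <= r0) (M0 : 0 <= M).
Hypothesis gsum : (hsum (fun x => (w x `^ c * w x `^ (- gam))%R) <= M%:E)%E.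
Hypothesis a_tail : forall z, r0 <= N z ->
  `|a z - f (ldir R z) * N z `^ (- gam)| <= C * N z `^ (- (gam + 1)).
Hypothesis f_le : forall s, sphere R d s -> `|f s| <= L.
Hypothesis f_ge : forall s, sphere R d s -> del <= f s.
Hypothesis f_lip : forall s s', sphere R d s -> sphere R d s' ->
  `|f s - f s'| <= L * enorm (s - s').

Local Notation g x := ((1 + lnorm R x) `^ (- gam)).
Local Notation h x := ((1 + lnorm R x) `^ (- (gam + c))).
Local Notation b := (@kern R d a nu).
Let lam : R := 1 + 2 * nu.
Let F s := f s / lam.

Let gam0 : 0 < gam. Proof. exact: lt_le_trans gam1. Qed.
Let gc0 : 0 <= gam + c. Proof. by rewrite addr_ge0 ?ltW. Qed.
Let lam0 : 0 < lam. Proof. by have := nu0; rewrite /lam; lra. Qed.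
Let w1 x : 1 <= w x. Proof. by rewrite lerDl lnorm_ge0. Qed.
Let w0 x : 0 < w x. Proof. exact: lt_le_trans (w1 x). Qed.
Let L'0 : 0 <= L / lam. Proof. by rewrite divr_ge0// ltW. Qed.
Let C'0 : 0 <= C / lam. Proof. by rewrite divr_ge0// ltW. Qed.

Let lnorm_neq0 x : 0 < N x -> x != 0.
Proof. by apply: contraTneq => ->; rewrite lnorm0 ltxx. Qed.

Let b0 x : 0 <= b x. Proof. exact: kern_ge0. Qed.
Let b1 : hsum b = 1%E. Proof. exact: hsum_kern. Qed.
Let b_le1 x : b x <= 1.
Proof. by rewrite -lee_fin -b1; apply: hsum_ge_term. Qed.

Let b_tail z : r0 <= N z ->
  `|b z - F (ldir R z) * N z `^ (- gam)| <= C / lam * N z `^ (- (gam + 1)).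
Proof.
move=> rz; have z0 : 0 < N z by apply: lt_le_trans rz; apply: lt_le_trans r01.
rewrite kern_neq0 ?lnorm_neq0// /F mulrAC -mulrBl normrM normfV (gtr0_norm lam0).
rewrite mulrAC; apply: ler_wpM2r; first by rewrite invr_ge0 ltW.
exact: a_tail.
Qed.

Let F_le s : sphere R d s -> `|F s| <= L / lam.
Proof.
move=> sS; rewrite normrM normfV (gtr0_norm lam0).
by apply: ler_wpM2r; [rewrite invr_ge0 ltW|exact: f_le].
Qed.

Let F_ge s : sphere R d s -> del / lam <= F s.
Proof.
by move=> sS; apply: ler_wpM2r; [rewrite invr_ge0 ltW|exact: f_ge].
Qed.

Let F_lip s s' : sphere R d s -> sphere R d s' ->
  `|F s - F s'| <= L / lam * enorm (s - s').
Proof.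
move=> sS sS'; rewrite -mulrBl normrM normfV (gtr0_norm lam0) mulrAC.
by apply: ler_wpM2r; [rewrite invr_ge0 ltW|exact: f_lip].
Qed.

Let bg : exists2 C1, 0 <= C1 & forall x, b x <= C1 * g x.
Proof. exact: (tail_le gam0 L'0 C'0 r01 b_le1 b_tail F_le). Qed.

Let breg : exists2 C2, 0 <= C2 & forall x y, N y <= N x / 2 ->
  b (x - y) <= b x + C2 * (w y `^ c * h x) /\ b x <= b (x - y) + C2 * (w y `^ c * h x).
Proof. exact: (tail_reg gam0 c0 c1 L'0 C'0 r01 b0 b_le1 b_tail F_le F_lip). Qed.

Let cancel_scale (l t E z : R) : l != 0 -> l * t * E * (z / l) = t * E * z.
Proof. by move=> l0; field. Qed.

Let half_out (k u v : R) : k / 2 * u * v = k * u * (v / 2).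
Proof. by field. Qed.

Lemma m1_near eps : 0 < eps -> exists2 K, 0 < K & forall t x, 0 <= t -> x != 0 ->
  exists2 m : R, m1 X t x = m%:E &
    `|m - t * expR (nu * t) * a x| <= K * h x * expR ((nu + eps) * t).
Proof.
move=> eps0; have [C1 C10 bC1] := bg; have [C2 C20 bC2] := breg.
(* With this [s] the excess rate [lam (s - 1)] is exactly [eps]. *)
have s1 : 1 < 1 + eps / lam by rewrite ltrDl divr_gt0.
have [K K0 HK] := convn_asymp b0 b1 gam0 c0 c1 C10 C20 M0 (@lnorm_ge0 R d) lnorm0
  (@lerB_lnorm R d) bC1 bC2 gsum s1.
exists K => // t x t0 x0.
have [|m mE mm] := m1_asymp X nu0 a0 a1 t0 (ltW (lt_trans ltr01 s1)) _ (HK^~ x).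
  by rewrite mulr_ge0 ?powR_ge0// ltW.
exists m => //; move: mm; rewrite kern_neq0// -/lam.
have -> : lam * t * expR (nu * t) * (a x / lam) = t * expR (nu * t) * a x.
  by apply: cancel_scale; rewrite gt_eqF.
by have -> : lam * (1 + eps / lam - 1) = eps by rewrite addrC addKr mulrC divfK ?gt_eqF.
Qed.

Lemma m1_growth : exists2 K, 0 < K & forall t x, 9 <= t ->
  ((K * g x * expR (nu / 2 * t))%:E <= m1 X t x)%E.
Proof.
have [C1 C10 bC1] := bg.
have [v0 [c2 [c20 gl]]] := tail_split gam0 (divr_gt0 del0 lam0) C'0 r01 b0 (kern0_gt0 nu0 a0) b_tail F_ge d0.
(* Makes the growth rate [nu + lam (1/s - 1)] equal to [nu / 2]. *)
pose s := (1 - nu / 2 / lam)^-1.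
have q0 : 0 < nu / 2 / lam by rewrite !divr_gt0.
have q1 : nu / 2 / lam < 1.
  by rewrite ltr_pdivrMr// mul1r; have := nu0; rewrite /lam; lra.
have s1 : 1 < s by rewrite /s invf_gt1; lra.
have [K K0 HK] := convn_lower b0 b1 gam0 c0 C10 M0 (@lnorm_ge0 R d) lnorm0
  (@lerB_lnorm R d) bC1 gsum (@lnormB R d) c20 gl s1.
exists (K / 2) => [|t x t9]; first by rewrite divr_gt0.
have t0 : 0 <= t by apply: le_trans t9.
have KH : 0 <= K * g x by rewrite mulr_ge0 ?powR_ge0// ltW.
apply: le_trans (m1_lower X nu0 a0 a1 t0 (ltW s1) KH (HK^~ x)).
rewrite lee_fin -/lam /s invrK.
have -> : nu + lam * (1 - nu / 2 / lam - 1) = nu / 2.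
  by rewrite addrAC subrr add0r mulrN mulrC divfK ?gt_eqF//; lra.
have -> : K / 2 * g x * expR (nu / 2 * t) = K * g x * (expR (nu / 2 * t) / 2).
  by apply: half_out.
apply: ler_wpM2l => //.
have e1 : 1 <= expR (nu / 2 * t) by rewrite -expR0 ler_expR mulr_ge0// divr_ge0// ltW.
(* By [e^y >= 1 + y^2 / 2] at [y = (1 + nu) t >= 9], the correction is at most 1/2, hence at most
   half of the growing exponential. *)
suff : expR (- (1 + nu) * t) * (1 + lam * t) <= 1 / 2 by lra.
have y0 : 0 <= (1 + nu) * t by rewrite mulr_ge0// addr_ge0// ltW.
have := expR_ge1Dxn 1 y0; rewrite mulNr expRN ler_pdivrMl ?expR_gt0//.
have : 9 <= (1 + nu) * t by have := nu0; nra.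
have : lam * t <= 2 * ((1 + nu) * t) by have := nu0; rewrite /lam; nra.
rewrite (_ : 2`! = 2)//; set y := (1 + nu) * t; set e := expR y => ly y9 ye.
have : 9 * y <= y ^+ 2 by rewrite expr2; nra.
lra.
Qed.

(** A front point is known only through its neighbours [x + e]. The shift costs no more than [h x],
    so direction and norm can be read at [x] itself. *)
Lemma jump_shift : exists2 C3, 0 < C3 & forall x e, 2 * r0 <= N x -> N e <= 1 ->
  [/\ x + e != 0, h (x + e) <= C3 * h x &
      `|a (x + e) - f (ldir R x) * N x `^ (- gam)| <= C3 * h x].
Proof.
have [C2 C20 bC2] := breg; pose H := (2^-1 : R) `^ (- (gam + c)).
have H0 : 0 < H by rewrite powR_gt0.
have D0 : 0 <= lam * (C2 * 2) by rewrite !mulr_ge0// ltW.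
have CH : 0 <= C * H by rewrite mulr_ge0// ltW.
exists (H + (lam * (C2 * 2) + C * H)) => [|x e xr e1].
  by rewrite ltr_pwDl// addr_ge0.
have h0 : 0 <= h x by exact: powR_ge0.
have := r01 => r1.
have lo : N x - N e <= N (x + e) by have := lerB_lnorm (R := R) x (- e); rewrite opprK lnormN.
have xe0 : x + e != 0 by apply: lnorm_neq0; lra.
split => //.
- rewrite mulrDl; apply: ler_wpDr; first by rewrite mulr_ge0// addr_ge0.
  by apply: powR_scaleN => //; lra.
- rewrite mulrDl; apply: ler_wpDl; first by rewrite mulr_ge0// ltW.
  have x0 : x != 0 by apply: lnorm_neq0; lra.
  have ab y : y != 0 -> a y = lam * b y.
    by move=> y0; rewrite kern_neq0// mulrC divfK// gt_eqF.
  have rx : r0 <= N x by lra.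
  have -> : a (x + e) - f (ldir R x) * N x `^ (- gam) =
     (a (x + e) - a x) + (a x - f (ldir R x) * N x `^ (- gam)) by rewrite subrKA.
  apply: (le_trans (ler_normD _ _)); rewrite mulrDl; apply: lerD.
    rewrite !ab// -mulrBr normrM (gtr0_norm lam0) -mulrA; apply: ler_wpM2l; first exact: ltW.
    have [|u l] := bC2 x (- e); first by rewrite lnormN; lra.
    rewrite opprK in u l; rewrite lnormN in u l.
    have we : w e `^ c <= 2.
      by apply: (le_trans (ler1_powR (w1 e) c1)); rewrite -[2]/(1 + 1) lerD2l.
    apply: (@le_trans _ _ (C2 * (w e `^ c * h x))).
      by rewrite ler_norml lerBlDl u andbT lerNl opprB lerBlDl l.
    by rewrite -mulrA; apply: ler_wpM2l => //; exact: ler_wpM2r.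
  apply: (le_trans (a_tail rx)); rewrite -mulrA; apply: ler_wpM2l => //.
  apply: (@le_trans _ _ (N x `^ (- (gam + c)))); last first.
    by apply: powRN_shift => //; lra.
  by apply: ler_powR; [lra|rewrite lerN2 lerD2l].
Qed.

(** [Y^p] lies between 1 and [Y]. *)
Let ratio_root (Y p eta : R) : 0 < Y -> 0 <= p -> p <= 1 -> `|Y - 1| <= eta -> `|Y `^ p - 1| <= eta.
Proof.
move=> Y0 p0 p1; rewrite !ler_norml => /andP[lo up].
have [Y1|/ltW Y1] := leP 1 Y.
  have a1' : Y `^ p <= Y by exact: ler1_powR.
  have b1' : 1 <= Y `^ p by rewrite -[leLHS](powRr0 Y); exact: ler_powR.
  by apply/andP; split; lra.
have a1' : Y <= Y `^ p by apply: ger1_powR => //; rewrite Y0.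
have b1' : Y `^ p <= 1 by rewrite -[leRHS](powRr0 Y); apply: ger_powR => //; rewrite Y0.
by apply/andP; split; lra.
Qed.

(** A front point has a neighbour with first moment below 1. Within radius [e^(nu t / (4 gam))] the
    spatial decay costs a constant times [e^(-nu t / 4)], which the growth [e^(nu t / 2)]
    outweighs. *)
Lemma front_far : exists2 t1, 9 <= t1 & forall t x, t1 <= t -> front X t x ->
  expR (nu / (4 * gam) * t) <= N x.
Proof.
have [K K0 HK] := m1_growth.
have D0 : 0 < 3 `^ gam / K by rewrite divr_gt0// powR_gt0.
(* From this time on [1 + nu t / 4] exceeds [3^gam / K], and so does [e^(nu t / 4)]. *)
exists (9 + 4 * (3 `^ gam / K) / nu) => [|t x tt [_ [e [_ e1 _ me]]]].
  by rewrite lerDl !mulr_ge0// ?invr_ge0 ltW.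
have Dn : 0 <= 4 * (3 `^ gam / K) / nu by rewrite !mulr_ge0// ?invr_ge0 ltW.
have t9 : 9 <= t by lra.
have t4 : 3 `^ gam / K < 1 + nu / 4 * t.
  have : 4 * (3 `^ gam / K) / nu <= t by lra.
  by rewrite ler_pdivrMr//; lra.
have := le_lt_trans (HK t (x + e) t9) me; rewrite lte_fin => small.
have Ne : N e <= 1 by case: e1 => ->; rewrite ?lnorm0 ?ler01 ?lexx.
rewrite leNgt; apply/negP => xlt.
set E := expR (nu / (4 * gam) * t) in xlt.
have E1 : 1 <= E by rewrite -expR0 ler_expR !mulr_ge0 ?invr_ge0 ?mulr_ge0 ?ltW//; lra.
have wE : w (x + e) <= 3 * E by have := lnormD (R := R) x e; lra.
have : 3 `^ (- gam) * expR (- (nu / 4 * t)) <= g (x + e).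
  have -> : 3 `^ (- gam) * expR (- (nu / 4 * t)) = (3 * E) `^ (- gam).
    rewrite powRM//; last by lra.
    rewrite /E -expRM; congr (_ * expR _).
    by field; rewrite gt_eqF.
  by apply: ler_powRN; [exact: ltW|exact: w0|].
move=> low; have : K * (3 `^ (- gam) * expR (- (nu / 4 * t))) * expR (nu / 2 * t) < 1.
  apply: le_lt_trans small; apply: ler_wpM2r; first exact: expR_ge0.
  by apply: ler_wpM2l => //; exact: ltW.
have -> : K * (3 `^ (- gam) * expR (- (nu / 4 * t))) * expR (nu / 2 * t) = expR (nu / 4 * t) / (3 `^ gam / K).
  rewrite powRN invf_div mulrA -mulrA -expRD.
  have -> : - (nu / 4 * t) + nu / 2 * t = nu / 4 * t by lra.
  by rewrite mulrC.
rewrite ltr_pdivrMr// mul1r => h.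
have := expR_ge1Dx (nu / 4 * t); lra.
Qed.

Let Q t x := t * expR (nu * t) * (f (ldir R x) * N x `^ (- gam)).

Lemma m1_front : exists A eps t2 : R, [/\ 0 < A, 0 < eps, 0 < t2 & forall t x, t2 <= t ->
  expR (nu / (4 * gam) * t) <= N x -> forall e, N e <= 1 ->
  exists2 m : R, m1 X t (x + e) = m%:E & `|m - Q t x| <= Q t x * (A * expR (- eps * t))].
Proof.
(* Beyond radius [e^(be t)], [h x] is below [N x^(-gam)] by a factor [e^(-2 eps t)]: one [eps] pays
   for the error rate of [m1_near], the other remains. *)
have [C3 C30 HC] := jump_shift; pose be := nu / (4 * gam); pose eps := be * c / 2.
have be0 : 0 < be by rewrite divr_gt0// mulr_gt0.
have eps0 : 0 < eps by rewrite divr_gt0// mulr_gt0.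
have [K K0 HK] := m1_near eps0.
pose B := K * C3 + C3; have B0 : 0 < B by rewrite addr_gt0// mulr_gt0.
have rb : 0 < 2 * r0 / be by rewrite divr_gt0// mulr_gt0// (lt_le_trans ltr01).
(* The bound [f >= del] turns the absolute error into a relative one; the time ensures
   [2 r0 <= be t <= N x]. *)
exists (B / del), eps, (1 + 2 * r0 / be); split; [exact: divr_gt0|by []|exact: addr_gt0|].
move=> t x tt xt e e1; have t1 : 1 <= t by lra.
have t0 : 0 <= t by lra.
have bt : 2 * r0 <= be * t.
  have : 2 * r0 / be <= t by lra.
  by rewrite ler_pdivrMr// (mulrC be).
have xr : 2 * r0 <= N x.
  apply: (le_trans bt); apply: le_trans xt; apply: le_trans (expR_ge1Dx _).
  by rewrite lerDr.
have [xe0 hxe axe] := HC x e xr e1.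
have x0 : 0 < N x by apply: lt_le_trans xr; rewrite mulr_gt0// (lt_le_trans ltr01).
have fx := f_ge (ldir_sphere x0).
have [m mE mm] := HK t _ t0 xe0; exists m => //.
set E := expR (nu * t) in mm; have E0 : 0 < E by exact: expR_gt0.
have G0 : 0 <= N x `^ (- gam) by exact: powR_ge0.
have h0 : 0 <= h x by exact: powR_ge0.
have ex1 : 1 <= expR (eps * t) by rewrite -expR0 ler_expR mulr_ge0// ltW.
have hG : h x <= N x `^ (- gam) * expR (- (eps * t) *+ 2).
  apply: (@le_trans _ _ (N x `^ (- (gam + c)))).
    by apply: ler_powRN => //; rewrite lerDr.
  rewrite opprD powRD; last by rewrite (gt_eqF x0) implybT.
  apply: ler_wpM2l => //.
  apply: (@le_trans _ _ (expR (be * t) `^ (- c))).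
    by apply: ler_powRN => //; [exact: ltW|exact: expR_gt0].
  rewrite -expRM; have -> : - (eps * t) *+ 2 = be * t * - c; last by [].
  by rewrite mulr2n /eps; field.
have S1 : `|m - t * E * a (x + e)| <= K * C3 * (h x * (E * expR (eps * t))).
  apply: (le_trans mm); rewrite mulrDl expRD -/E -mulrA -[leRHS]mulrA.
  apply: ler_wpM2l; first exact: ltW.
  rewrite (mulrA C3); apply: ler_wpM2r => //.
  by apply: mulr_ge0; [exact: ltW|exact: expR_ge0].
have S2 : `|t * E * a (x + e) - Q t x| <= t * E * (C3 * h x).
  rewrite /Q -mulrBr normrM ger0_norm ?mulr_ge0 ?expR_ge0//.
  by apply: ler_wpM2l => //; rewrite mulr_ge0 ?expR_ge0.
have -> : m - Q t x = (m - t * E * a (x + e)) + (t * E * a (x + e) - Q t x) by rewrite subrKA.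
apply: (le_trans (ler_normD _ _)); apply: (le_trans (lerD S1 S2)).
apply: (@le_trans _ _ (t * E * (B * (h x * expR (eps * t))))).
  have hE : 0 <= h x * E by rewrite mulr_ge0// ltW.
  have he : h x * E <= h x * E * expR (eps * t) by exact: ler_peMr.
  have het : h x * E * expR (eps * t) <= t * (h x * E * expR (eps * t)).
    by apply: ler_peMl => //; rewrite mulr_ge0// expR_ge0.
  have KC : 0 <= K * C3 by rewrite mulr_ge0// ltW.
  have -> : t * E * (B * (h x * expR (eps * t))) =
      K * C3 * (t * (h x * E * expR (eps * t))) + t * (C3 * (h x * E * expR (eps * t))).
    by rewrite /B; ring.
  apply: lerD; first by apply: ler_wpM2l => //; rewrite mulrA.
  rewrite -mulrA; apply: ler_wpM2l => //; rewrite mulrCA; apply: ler_wpM2l; first exact: ltW.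
  by rewrite mulrC.
have -> : - eps * t = - (eps * t) *+ 2 + eps * t by rewrite mulr2n; ring.
rewrite expRD /Q -[leRHS]mulrA; apply: ler_wpM2l.
  by apply: mulr_ge0 => //; exact: expR_ge0.
apply: (@le_trans _ _ (B * (N x `^ (- gam) * expR (- (eps * t) *+ 2) * expR (eps * t)))).
  by apply: ler_wpM2l; [exact: ltW|apply: ler_wpM2r => //; exact: expR_ge0].
have -> : f (ldir R x) * N x `^ (- gam) * (B / del * (expR (- (eps * t) *+ 2) * expR (eps * t))) =
   f (ldir R x) / del * (B * (N x `^ (- gam) * expR (- (eps * t) *+ 2) * expR (eps * t))) by ring.
apply: ler_peMl; last by rewrite ler_pdivlMr// mul1r.
by rewrite !mulr_ge0 ?expR_ge0// ltW.
Qed.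

Lemma front_radius : exists C' t0 : R, 0 < t0 /\ forall t x, t0 <= t -> front X t x ->
  exists theta : R, `|theta| <= C' / t /\
    N x = (f (ldir R x) * t) `^ gam^-1 * expR (nu / gam * t) * (1 + theta).
Proof.
have [t1 t19 far] := front_far.
have [A [eps [t2 [A0 eps0 t20 near]]]] := m1_front.
have D0 : 0 < 2 * A / eps by rewrite divr_gt0// mulr_gt0.
exists (A / eps), (t1 + t2 + 2 * A / eps); split; first by lra.
move=> t x tt fr; have xt : expR (nu / (4 * gam) * t) <= N x by apply: far => //; lra.
have t2t : t2 <= t by lra.
have t0 : 0 < t by lra.
case: fr => ep [em [ep1 em1 mp mm]].
have unit_le e : e = 0 \/ N e = 1 -> N e <= 1 by case=> ->; rewrite ?lnorm0 ?ler01 ?lexx.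
have [m mE mQ] := near t x t2t xt ep (unit_le _ ep1).
have [m' m'E m'Q] := near t x t2t xt em (unit_le _ em1).
move: mp mm; rewrite mE m'E lee_fin lte_fin => mp mm.
set q := Q t x in mQ m'Q; set eta := A * _ in mQ m'Q.
(* Here the exponential error is weakened to [1/t], through [e^(eps t) >= eps t]. *)
have etaC : eta <= A / eps / t.
  rewrite /eta -mulrA -invfM; apply: ler_wpM2l; first exact: ltW.
  rewrite mulNr expRN lef_pV2 ?posrE ?expR_gt0 ?mulr_gt0//.
  by apply: le_trans (expR_ge1Dx _); rewrite lerDr.
have eta2 : A / eps / t <= 2^-1.
  rewrite ler_pdivrMr//.
  have : 2 * (A / eps) <= t by rewrite mulrA; lra.
  lra.
have eta0 : 0 <= eta by rewrite mulr_ge0 ?expR_ge0// ltW.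
have x0 : 0 < N x by apply: lt_le_trans xt; exact: expR_gt0.
have fx : 0 < f (ldir R x) by apply: lt_le_trans (f_ge (ldir_sphere x0)).
have q0 : 0 < q by rewrite !mulr_gt0 ?expR_gt0// powR_gt0.
(* The two neighbours share the same [q], which depends on [x] only: one gives [1 <= q (1 + eta)],
   the other [q (1 - eta) < 1]. *)
have qY : `|q^-1 - 1| <= eta.
  move: mQ m'Q; rewrite !ler_norml => /andP[_ u] /andP[l _].
  have qu : 1 <= q * (1 + eta) by lra.
  have ql : q * (1 - eta) < 1 by lra.
  apply/andP; split.
    rewrite lerBrDr addrC -(ler_pM2l q0) mulfV ?gt_eqF//; exact: ltW.
  by rewrite lerBlDr addrC -(ler_pM2l q0) mulfV ?gt_eqF.
(* Solving [q = t e^(nu t) f |x|^(-gam)] for [|x|] leaves the factor [q^(-1/gam)]; as [gam >= 1],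
   the root is no farther from 1 than [q^(-1)]. *)
exists (q^-1 `^ gam^-1 - 1); split.
  apply: le_trans etaC; apply: ratio_root => //; first by rewrite invr_gt0.
    by rewrite invr_ge0 ltW.
  by rewrite invf_le1.
rewrite [1 + _]addrC subrK.
have -> : expR (nu / gam * t) = expR (nu * t) `^ gam^-1 by rewrite -expRM mulrAC.
have ft0 : 0 <= f (ldir R x) * t by rewrite mulr_ge0// ltW.
have qi : 0 <= q^-1 by rewrite invr_ge0 ltW.
rewrite -powRM ?expR_ge0// -powRM//; last by rewrite mulr_ge0 ?expR_ge0.
have -> : f (ldir R x) * t * expR (nu * t) * q^-1 = N x `^ gam.
  have G0 : 0 < N x `^ gam by rewrite powR_gt0.
  have E0 : 0 < expR (nu * t) by exact: expR_gt0.
  rewrite /q /Q powRN.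
  move: (expR _) (N x `^ _) (f _) E0 G0 fx => E G fl E0 G0 fl0.
  by field; rewrite !gt_eqF.
by rewrite -powRrM mulfV ?gt_eqF// powRr1// ltW.
Qed.

End FirstMoment.


(** * Reduction to the leading term of the expansion, and conclusion *)

Lemma tail_leading_term (R : realType) (d n : nat) (a : 'rV[int]_d -> R)
    (aj : nat -> 'rV[R]_d -> R) (gam p C r : R) : gam + 1 <= p ->
  (forall z, r <= lnorm R z ->
     `|a z - \sum_(0 <= j < n.+1) aj j (ldir R z) / lnorm R z `^ (gam + j%:R)|
       <= C / lnorm R z `^ p) ->
  (forall j, (j <= n)%N -> exists B, forall s, sphere R d s -> `|aj j s| <= B) ->
  exists C' r', [/\ 0 <= C', 1 <= r' & forall z, r' <= lnorm R z ->
    `|a z - aj 0 (ldir R z) * lnorm R z `^ (- gam)| <= C' * lnorm R z `^ (- (gam + 1))].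
Proof.
move=> gp Ha Hj.
(* Indices above [n] receive the default bound 0, which makes [B] a total function. *)
have /choice[B HB] : forall j, exists B, 0 <= B /\
    ((j <= n)%N -> forall s, sphere R d s -> `|aj j s| <= B).
  move=> j; have [jn|_] := boolP (j <= n)%N; last by exists 0.
  have [B HB] := Hj j jn; exists `|B|; split => // _ s sS.
  by apply: (le_trans (HB s sS)); exact: ler_norm.
exists (`|C| + \sum_(1 <= j < n.+1) B j), (Num.max 1 r); split.
- by rewrite addr_ge0// sumr_ge0// => j _; have [] := HB j.
- by rewrite le_max lexx.
move=> z; rewrite ge_max => /andP[z1 rz].
have z0 : 0 < lnorm R z by exact: lt_le_trans z1.
have zs := ldir_sphere z0.
have := Ha z rz; rewrite big_ltn// addr0 opprD addrA -powRN => Hz.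
set S := \sum_(1 <= j < n.+1) _ in Hz; set D := a z - _ in Hz *.
rewrite -(subrK S D); apply: (le_trans (ler_normD _ _)); rewrite mulrDl; apply: lerD.
  apply: (le_trans Hz); apply: (@le_trans _ _ (`|C| / lnorm R z `^ p)).
    by apply: ler_wpM2r; [rewrite invr_ge0 powR_ge0|exact: ler_norm].
  by apply: ler_wpM2l => //; rewrite -powRN; apply: ler_powR => //; rewrite lerN2.
apply: (le_trans (ler_norm_sum _ _ _)); rewrite mulr_suml.
rewrite big_nat_cond [leRHS]big_nat_cond; apply: ler_sum => j /andP[/andP[j1 jn] _].
rewrite normrM normfV (ger0_norm (powR_ge0 _ _)); apply: ler_pM => //.
- by rewrite invr_ge0 powR_ge0.
- by have [_] := HB j; apply.
- by rewrite -powRN; apply: ler_powR => //; rewrite lerN2 lerD2l ler1n.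
Qed.

Theorem theorem1p1 (R : realType) (d : nat) (nu alpha : R)
  (a : 'rV[int]_d -> R) (aj : nat -> 'rV[R]_d -> R)
  (disp : measure_display) (Omega : measurableType disp)
  (P : probability Omega R) (X : branching_walk P a nu) :
  let eps : nat := if alpha == 1 then 1%N else 0%N in
  (1 <= d)%N ->
  0 < nu ->
  0 < alpha < 2 ->
  (forall z, 0 <= a z) ->
  (\esum_(z in [set: 'rV[int]_d]) (a z)%:E)%E = 1%E ->
  (forall z, a z = a (- z)) ->
  (exists C r : R, forall z : 'rV[int]_d, r <= lnorm R z ->
     `| a z - \sum_(0 <= j < (d + eps).+1)
          aj j (ldir R z) / lnorm R z `^ (d%:R + alpha + j%:R) |
     <= C / lnorm R z `^ ((2 * d)%:R + alpha + 1 + eps%:R)) ->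
  (forall j, (j <= d + eps)%N -> Ck_sphere (d + 1 - j + eps) (aj j)) ->
  (exists delta : R, 0 < delta /\
     forall s, sphere R d s -> delta < aj 0%N s) ->
  exists C t0 : R, 0 < t0 /\
    forall (t : R) (x : 'rV[int]_d), t0 <= t -> front X t x ->
      exists theta : R, `| theta | <= C / t /\
        lnorm R x =
          (aj 0%N (ldir R x) * t) `^ (d%:R + alpha)^-1
          * expR (nu / (d%:R + alpha) * t) * (1 + theta).
Proof.
move=> eps d1 nu0 /andP[al0 al2] a0 a1 _ [C [r Ha]] Caj [del [del0 Hdel]].
set gam := d%:R + alpha in Ha *.
have dR : 1 <= d%:R :> R by rewrite ler1n.
(* The order [d + 1 - j + eps] is at least 1 for all these [j]: when [j = d + 1] the difference is
   0, but then [eps] is 1. *)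
have Lj j : (j <= d + eps)%N -> exists2 L : R, 0 < L & forall s s', sphere R d s -> sphere R d s' ->
    `|aj j s| <= L /\ `|aj j s - aj j s'| <= L * enorm (s - s').
  move=> jn; apply: (@Ck_sphere_lipschitz R d (d + 1 - j + eps).-1).
  rewrite prednK; first exact: Caj.
  rewrite addn_gt0 subn_gt0 addn1 ltnS; have [//|dj] := leqP j d.
  by rewrite -(ltn_add2l d) addn0 (leq_trans dj).
have [L L0 HL] := Lj 0%N (leq0n _).
have [||C' [r' [C'0 r'1 tail]]] := @tail_leading_term R d (d + eps) a aj gam _ C r _ Ha.
- by rewrite /gam natrM; have : 0 <= eps%:R :> R by []; lra.
- move=> j jn; have [B _ HB] := Lj j jn; exists B => s sS.
  by have [] := HB s s sS sS.
(* Half of [alpha] leaves [alpha - c] positive, the margin for summing [w^(c - gam)] over the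
   lattice. *)
pose c := Num.min 1 (alpha / 2).
have c0 : 0 < c by rewrite lt_min ltr01 divr_gt0.
have c1 : c <= 1 by rewrite ge_min lexx.
have ca : 0 < alpha - c.
  have : c <= alpha / 2 by rewrite ge_min lexx orbT.
  lra.
have [M HM] := @lattice_sum R d _ d1 ca.
have M0 : 0 <= M.
  by rewrite -lee_fin; apply: le_trans HM; apply: hsum_ge0 => x; exact: powR_ge0.
have gsum : (hsum (fun x : 'rV[int]_d => ((1 + lnorm R x) `^ c * (1 + lnorm R x) `^ (- gam))%R) <= M%:E)%E.
  rewrite (@eq_hsum _ _ _ (fun x : 'rV[int]_d => (1 + lnorm R x) `^ (- (d%:R + (alpha - c)))))// => x.
  have w0 : 0 < 1 + lnorm R x by rewrite ltr_pwDl// lnorm_ge0.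
  rewrite -powRD; last by rewrite (gt_eqF w0) implybT.
  by congr (_ `^ _); rewrite /gam; ring.
apply: (@front_radius _ _ R P d a nu X d1 nu0 a0 a1 gam c M L del C' r' (aj 0%N)) => //.
- by rewrite /gam; lra.
- exact: ltW.
- by move=> s sS; have [] := HL s s sS sS.
- by move=> s sS; apply: ltW; exact: Hdel.
- by move=> s s' sS s'S; have [] := HL s s' sS s'S.
Qed.
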